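(* Let $N\ge2$, $p>N$ and $R>0$. The function $$u_p(|x|):=1-\left(\frac{|x|}{R}\right)^{\frac{p-N}{p-1}},\quad 0\le|x|\le R,$$ is the unique positive extremal function of $\Lambda_p(B_R)$.
   Context: $B_R$ is the ball of $\mathbb{R}^N$ of radius $R$ centered at the origin. For a bounded smooth domain $\Omega\subset\mathbb{R}^N$, $\|\cdot\|_s$ denotes the norm of $L^s(\Omega)$; for $q\ge1$, $\lambda_q(\Omega):=\inf\{\|\nabla u\|_p^p: u\in W_0^{1,p}(\Omega),\ \|u\|_q=1\}$ and $\Lambda_p(\Omega):=\lim_{q\to\infty}\lambda_q(\Omega)$ (the limit exists); one has $\Lambda_p(\Omega)=\inf\{\|\nabla u\|_p^p:u\in W_0^{1,p}(\Omega),\ \|u\|_\infty=1\}$. A function $v\in W_0^{1,p}(\Omega)$ is an extremal function of $\Lambda_p(\Omega)$ if $\|\nabla v\|_p^p=\Lambda_p(\Omega)$ and $\|v\|_\infty=1$; it is positive if $v>0$ in $\Omega$. *)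

(* Defs.v *)
From HB Require Import structures.
From mathcomp Require Import all_boot all_order all_algebra.
From mathcomp Require Import all_classical all_reals all_analysis.

Set Implicit Arguments.
Unset Strict Implicit.
Unset Printing Implicit Defensive.
Import Order.TTheory GRing.Theory Num.Theory.
Import numFieldNormedType.Exports.

Local Open Scope classical_set_scope.
Local Open Scope ring_scope.

(* Borel structure of R^n: the coarsest one making the coordinates
   measurable. *)
Section row_measurable.
Context {R : realType} (n : nat).

Definition row_coord (i : 'I_n) (x : 'rV[R]_n) : measurableTypeR R := x ord0 i.

Let row_set0 : g_sigma_preimage row_coord set0.
Proof. exact: sigma_algebra0. Qed.

Let row_setC A : g_sigma_preimage row_coord A ->
  g_sigma_preimage row_coord (~` A).
Proof. exact: sigma_algebraC. Qed.

Let row_bigcup (F : (set 'rV[R]_n)^nat) :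
  (forall i, g_sigma_preimage row_coord (F i)) ->
  g_sigma_preimage row_coord (\bigcup_i F i).
Proof. exact: sigma_algebra_bigcup. Qed.

HB.instance Definition _ := @isMeasurable.Build default_measure_display
  'rV[R]_n (g_sigma_preimage row_coord) row_set0 row_setC row_bigcup.

Lemma measurable_row_coord i : measurable_fun [set: 'rV[R]_n] (row_coord i).
Proof.
move=> _ Y mY; rewrite setTI; apply: sub_sigma_algebra => /=.
rewrite -bigcup_seq/=; exists i => /=; first by rewrite mem_index_enum.
by exists Y => //; rewrite setTI.
Qed.

Lemma measurable_fun_rowP d (T : measurableType d) (f : T -> 'rV[R]_n) :
  (forall i, measurable_fun setT (row_coord i \o f)) -> measurable_fun setT f.
Proof.
move=> mf _ A mA; rewrite setTI.
suff : g_sigma_preimage row_coord `<=` [set B | measurable (f @^-1` B)] by exact.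
apply: smallest_sub.
  split => /=; first by rewrite preimage_set0.
    by move=> B mB; rewrite setTD preimage_setC; exact: measurableC.
  by move=> F mF; rewrite preimage_bigcup; exact: bigcup_measurable.
rewrite -bigcup_seq/=; apply: bigcup_sub => i _ B [C mC <-].
by have := mf i measurableT C mC; rewrite /= !setTI.
Qed.

End row_measurable.

Section lebesgue_row.
Context {R : realType}.

Definition row_cons n (p : measurableTypeR R * 'rV[R]_n) : 'rV[R]_n.+1 :=
  row_mx (const_mx p.1 : 'rV_1) p.2.

Definition row_uncons n (x : 'rV[R]_n.+1) : measurableTypeR R * 'rV[R]_n :=
  (x ord0 ord0, rsubmx (x : 'rV_(1 + n))).

Lemma row_consK n : cancel (@row_cons n) (@row_uncons n).
Proof.
move=> [a x]; rewrite /row_uncons /row_cons /=; congr (_, _).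
  by rewrite mxE; case: splitP => // j _; rewrite mxE.
by rewrite row_mxKr.
Qed.

Lemma row_unconsK n : cancel (@row_uncons n) (@row_cons n).
Proof.
move=> x; rewrite /row_uncons /row_cons /=.
rewrite -[RHS](@hsubmxK _ 1 1 n); congr (@row_mx R 1 1 n _ _).
by apply/rowP => i; rewrite !mxE !ord1; congr (x _ _); exact: val_inj.
Qed.

Lemma measurable_row_cons n : measurable_fun setT (@row_cons n).
Proof.
apply: measurable_fun_rowP => i.
have [j ij|j ij] := @split_ordP 1 n i.
  rewrite (_ : _ \o _ = fst) //; apply/funext => p /=.
  by rewrite /row_coord ij; exact: etrans (row_mxEl _ _ _ _) (mxE _ _ _ _).
rewrite (_ : _ \o _ = row_coord j \o snd).
  by apply: measurableT_comp => //; exact: measurable_row_coord.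
by apply/funext => p /=; rewrite /row_coord ij; exact: row_mxEr.
Qed.

Lemma measurable_row_uncons n : measurable_fun setT (@row_uncons n).
Proof.
apply/measurable_fun_pairP; split => /=.
  exact: (measurable_row_coord ord0).
apply: measurable_fun_rowP => i.
rewrite (_ : _ \o _ = row_coord (rshift 1 i : 'I_n.+1)).
  exact: measurable_row_coord.
by apply/funext => x /=; rewrite /row_coord mxE.
Qed.

Section step.
Context (n : nat) (mu : {sigma_finite_measure set 'rV[R]_n -> \bar R}).

Definition lebesgue_row_step : set 'rV[R]_n.+1 -> \bar R :=
  pushforward (@lebesgue_measure R \x mu)%E (@row_cons n).

Let step0 : lebesgue_row_step set0 = 0%E.
Proof. by rewrite /lebesgue_row_step /pushforward preimage_set0 measure0. Qed.

Let step_ge0 A : (0 <= lebesgue_row_step A)%E.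
Proof. by rewrite /lebesgue_row_step /pushforward; exact: measure_ge0. Qed.

Let step_sigma_additive : semi_sigma_additive lebesgue_row_step.
Proof.
have mf := @measurable_row_cons n.
exact: (@measure_semi_sigma_additive _ _ _
  (measure_function_pushforward__canonical__measure_function_Measure
    (@lebesgue_measure R \x mu)%E mf)).
Qed.

HB.instance Definition _ := isMeasure.Build _ _ _ lebesgue_row_step
  step0 step_ge0 step_sigma_additive.

Let sigma_finite_step : sigma_finite setT lebesgue_row_step.
Proof.
have /sigma_finiteP[F [FT ndF Foo]] := sigma_finiteT (@lebesgue_measure R).
have /sigma_finiteP[G [GT ndG Goo]] := sigma_finiteT mu.
exists (fun k => @row_uncons n @^-1` (F k `*` G k)).
  rewrite -preimage_bigcup -(preimage_setT (@row_uncons n)) -setXTT FT GT.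
  congr (_ @^-1` _); apply/seteqP; split => [[x y]|[x y] [k _ []]].
    move=> [/= [k _ Fkx] [l _ Gly]]; exists (maxn k l) => //; split.
    - by move: x Fkx; exact/subsetPset/ndF/leq_maxl.
    - by move: y Gly; exact/subsetPset/ndG/leq_maxr.
  by move=> ? ?; split; exists k.
move=> k; have [mF Fk] := Foo k; have [mG Gk] := Goo k; split.
  by rewrite -[X in measurable X]setTI; apply: measurable_row_uncons => //;
    exact: measurableX.
rewrite /lebesgue_row_step /pushforward -comp_preimage.
rewrite (_ : _ \o _ = id); last by apply/funext => p /=; rewrite row_consK.
by rewrite preimage_id product_measure1E// lte_mul_pinfty// ge0_fin_numE.
Qed.

HB.instance Definition _ :=
  Measure_isSigmaFinite.Build _ _ _ lebesgue_row_step sigma_finite_step.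

End step.

(* Lebesgue measure on R^n, by iterated products with the Lebesgue measure
   of R; see lebesgue_row_box. *)
Fixpoint lebesgue_row n : {sigma_finite_measure set 'rV[R]_n -> \bar R} :=
  if n is n'.+1 then lebesgue_row_step (lebesgue_row n') else \d_(0 : 'rV[R]_0).

Definition row_box n (a b : 'rV[R]_n) : set 'rV[R]_n :=
  [set x | forall i, x ord0 i \in `[a ord0 i, b ord0 i]].

Lemma measurable_row_box n (a b : 'rV[R]_n) :
  measurable (row_box a b).
Proof.
rewrite (_ : row_box a b =
    \bigcap_(i in [set: 'I_n]) (row_coord i @^-1` `[a ord0 i, b ord0 i])).
  apply: fin_bigcap_measurable; first exact: finite_finset.
  move=> i _; rewrite -[X in measurable X]setTI.
  exact: measurable_row_coord.
by apply/seteqP; split => x /= H i => [_|]; exact: H.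
Qed.

Lemma lebesgue_row_box n (a b : 'rV[R]_n) : (forall i, a ord0 i <= b ord0 i) ->
  lebesgue_row n (row_box a b) = (\prod_i (b ord0 i - a ord0 i))%:E.
Proof.
elim: n a b => [|n IH] a b ab.
  by rewrite big_ord0 /= diracE mem_set // => -[].
pose tl (x : 'rV[R]_n.+1) : 'rV[R]_n := rsubmx (x : 'rV_(1 + n)).
have tlE x i : tl x ord0 i = x ord0 (lift ord0 i).
  by rewrite mxE; congr (x _ _); exact: val_inj.
have -> : lebesgue_row n.+1 (row_box a b) =
  (@lebesgue_measure R \x lebesgue_row n)%E (@row_cons n @^-1` row_box a b) by [].
have -> : @row_cons n @^-1` row_box a b = `[a ord0 ord0, b ord0 ord0]%classic `*`
    row_box (tl a) (tl b).
  apply/seteqP; split => -[u y]; have := row_consK (u, y);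
      rewrite /row_uncons => -[u0 ytl].
    move=> Auy; split => /= [|i]; first by rewrite -u0; exact: Auy.
    by rewrite -ytl -[rsubmx _]/(tl _) !tlE; exact: Auy.
  move=> [/= uab yab] i; have [j ->|->] := unliftP ord0 i.
    by have := yab j; rewrite -!tlE /tl ytl.
  by rewrite u0.
rewrite [LHS]product_measure1E //; last exact: measurable_row_box.
rewrite IH; last by move=> i; rewrite !tlE.
rewrite big_ord_recl EFinM; congr (_ * _)%E.
  rewrite [LHS](lebesgue_measure_itv `[_, _]) /= lte_fin -EFinB; case: ltP => // ba.
  by congr _%:E; apply/esym/eqP; rewrite subr_eq0 eq_le ba ab.
by congr _%:E; apply: eq_bigr => i _; rewrite !tlE.
Qed.

End lebesgue_row.

Section sobolev.
Context {R : realType} {N : nat}.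
Implicit Types (Om : set 'rV[R]_N) (u v phi : 'rV[R]_N -> R).
Implicit Types (G : 'rV[R]_N -> 'rV[R]_N) (p q : R).

Local Notation mu := (@lebesgue_row R N).

(* The library norm `|x| of a row vector is the sup norm, hence this
   Euclidean norm and the corresponding open balls centered at 0. *)
Definition enorm (x : 'rV[R]_N) : R := Num.sqrt (\sum_i x ord0 i ^+ 2).

Definition eball (r : R) : set 'rV[R]_N := [set x | enorm x < r].

Definition partial (i : 'I_N) u : 'rV[R]_N -> R :=
  fun x => 'D_(delta_mx ord0 i) u x.

(* C^oo: all the iterated partial derivatives are differentiable, hence
   continuous. *)
Definition smooth u :=
  forall (s : seq 'I_N) (x : 'rV[R]_N), differentiable (foldr partial u s) x.

Definition test_function Om phi :=
  smooth phi /\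
  exists2 K, compact K /\ K `<=` Om & forall x, ~ K x -> phi x = 0.

(* Functions on Om are represented by total functions whose values outside Om
   are irrelevant, and elements of L^s(Om) by Borel representatives. *)
Definition Lnorm_on Om (s : \bar R) u : \bar R :=
  'N[mu]_s[(EFin \o u) \_ Om].

Definition in_Lp Om p u :=
  measurable_fun Om u /\ (Lnorm_on Om p%:E u < +oo)%E.

Definition locally_integrable Om u :=
  measurable_fun Om u /\
  forall K, compact K -> K `<=` Om -> mu.-integrable K (EFin \o u).

Definition is_weak_gradient Om u G :=
  forall i : 'I_N, locally_integrable Om (fun x => G x ord0 i) /\
    forall phi, test_function Om phi ->
      \int[mu]_(x in Om) (u x * partial i phi x) =
      - \int[mu]_(x in Om) (G x ord0 i * phi x).

(* Weak gradients are unique almost everywhere on Om (open); junk value when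
   there is none. *)
Definition weak_gradient Om u : 'rV[R]_N -> 'rV[R]_N :=
  get [set G | is_weak_gradient Om u G].

Definition in_W1p Om p u :=
  in_Lp Om p u /\
  exists2 G, is_weak_gradient Om u G & in_Lp Om p (enorm \o G).

Definition grad_norm Om p u : \bar R :=
  Lnorm_on Om p%:E (enorm \o weak_gradient Om u).

Definition W1p_norm Om p u : \bar R :=
  (Lnorm_on Om p%:E u + grad_norm Om p u)%E.

(* Closure of the test functions in W^{1,p}(Om). *)
Definition in_W01p Om p u :=
  in_W1p Om p u /\
  exists2 phi : nat -> 'rV[R]_N -> R, forall n, test_function Om (phi n) &
    (fun n => W1p_norm Om p (phi n \- u)) @ \oo --> 0%E.

Definition lambda_ Om p q : \bar R :=
  ereal_inf [set (grad_norm Om p u `^ p)%E | u in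
    [set u | in_W01p Om p u /\ Lnorm_on Om q%:E u = 1%E]].

Definition Lambda_ Om p : \bar R := lim (lambda_ Om p q @[q --> +oo]).

Definition is_extremal Om p v :=
  [/\ in_W01p Om p v, (grad_norm Om p v `^ p)%E = Lambda_ Om p
    & Lnorm_on Om +oo%E v = 1%E].

Definition positive_on Om v := forall x, Om x -> 0 < v x.

Definition radial_extremal (r p : R) : 'rV[R]_N -> R :=
  fun x => 1 - (enorm x / r) `^ ((p - N%:R) / (p - 1)).

End sobolev.

(* Main.v *)
From HB Require Import structures.
Require Import Defs.
From mathcomp Require Import all_boot all_order all_algebra.
From mathcomp Require Import all_classical all_reals all_analysis.
From mathcomp Require Import measurable_realfun ess_sup_inf ring lra.
Import Order.TTheory GRing.Theory Num.Theory.
Import numFieldNormedType.Exports.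

Local Open Scope classical_set_scope.
Local Open Scope ring_scope.
Set Implicit Arguments.
Unset Strict Implicit.
Unset Printing Implicit Defensive.

(* Sharp Morrey inequality with a pole: if phi is a test function on B_r and |x0| < r,
   Hoelder's inequality on each ray issued from x0, up to its exit from the ball, bounds
   the p-energy of phi along the ray from below by a constant times |phi x0|^p T^-(p-N),
   T being the exit time.  Pairing opposite rays and using the power of the point x0 with
   respect to the sphere (with AM-GM), the integral over all directions gives
     C(x0) |phi x0|^p <= ||grad phi||_p^p,   C(x0) = C (r^2 - |x0|^2)^(-(p-N)/2).
   C(0) is the energy of u_p, and C(x0) > C(0) for x0 != 0.  The inequality makes every
   element of W_0^{1,p} continuous up to a null set and satisfied by it, whence
   Lambda_p(B_r) = C(0) and the extremality of u_p.  A positive extremal v attains its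
   maximum 1 only at 0, like u_p; so does (v + u_p)/2, whose energy is then at least C(0),
   and Clarkson's inequality forces grad v = grad u_p. *)

(** * Lebesgue measure on R^n *)

(** The weight t^(N-1) of polar coordinates decides everything: since p > N, the dual weight
    t^(-(N-1)/(p-1)) is integrable at 0 with primitive a multiple of t^a, a = (p - N)/(p - 1), and
    equality in Hoelder's inequality forces |f'| to be a multiple of t^(a - 1); this is where the
    profile of u_p comes from. There is no surface measure: the directions are the points y of the
    unit ball, with the weight |y|^N, because the integral along the ray through y is homogeneous of
    degree -N in y. The product of two opposite exit times depends on the direction through |y|
    only, so the constant at each pole is explicit and is compared with C(0) without any
    rearrangement. Applied to differences of test functions, the inequality turns convergence of
    gradients in L^p into uniform convergence, so its pointwise form survives the closure; applied
    to (v - u_p)/2, whose energy is 0, it yields v = u_p almost everywhere. The function u_p itself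
    is singular at 0 and its support is not a compact subset of the open ball, so its membership in
    W_0^{1,p} needs a regularization at both places. *)

Section affine_change_of_variables.
Context {R : realType}.
Local Open Scope ereal_scope.
Local Notation leb := (@lebesgue_measure R).

Definition affine1 (a c : R) : measurableTypeR R -> measurableTypeR R :=
  fun x => (a + c * x)%R.

Lemma measurable_affine1 a c : measurable_fun setT (affine1 a c).
Proof.
apply: (@measurable_funD _ (measurableTypeR R) _ setT (cst a) (fun x => c * x)%R) => //.
exact: mulrl_measurable.
Qed.

(** By uniqueness of Lebesgue measure: the image measure scaled by |c| gives each half-open interval
    its length. For c < 0 the preimage of an interval is half-open on the other side, which does not
    change its length. *)
Lemma lebesgue_measure_affine (a c : R) (A : set (measurableTypeR R)) :
  c != 0%R -> measurable A ->
  leb (affine1 a c @^-1` A) = `|c|^-1%:E * leb A.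
Proof.
move=> c0 mA.
have mf := measurable_affine1 a c.
have c_gt0 : (0 < `|c|)%R by rewrite normr_gt0.
pose nu := measure_function_pushforward__canonical__measure_function_Measure leb mf.
pose ac : {nonneg R} := NngNum (ltW c_gt0).
have -> : leb A = mscale ac nu A.
  apply: lebesgue_measure_unique => // _ [[u v]] _ <- /=.
  rewrite /mscale/= /pushforward.
  move: c0; rewrite neq_lt => /orP[cn|cp].
  - rewrite (_ : _ @^-1` _ = `[((v - a) / c)%R, ((u - a) / c)%R[%classic); last first.
      apply/seteqP; split => x /=; rewrite /affine1 !in_itv/=.
        by rewrite ler_ndivrMr// ltr_ndivlMr// lerBrDl ltrBlDl (mulrC x) andbC.
      by rewrite ler_ndivrMr// ltr_ndivlMr// lerBrDl ltrBlDl (mulrC x) andbC.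
    rewrite !lebesgue_measure_itv/= !lte_fin ltr_nM2r ?invr_lt0// ltrD2r.
    case: ifPn => uv; rewrite ?mule0//.
    rewrite ltr0_norm// -EFinB -EFinM; congr EFin.
    by field; rewrite lt_eqF.
  - rewrite (_ : _ @^-1` _ = `]((u - a) / c)%R, ((v - a) / c)%R]%classic); last first.
      apply/seteqP; split => x /=; rewrite /affine1 !in_itv/=.
        by rewrite ltr_pdivrMr// ler_pdivlMr// lerBrDl ltrBlDl (mulrC x) andbC.
      by rewrite ltr_pdivrMr// ler_pdivlMr// lerBrDl ltrBlDl (mulrC x) andbC.
    rewrite !lebesgue_measure_itv/= !lte_fin ltr_pM2r ?invr_gt0// ltrD2r.
    case: ifPn => uv; rewrite ?mule0//.
    rewrite gtr0_norm// -EFinB -EFinM; congr EFin.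
    by field; rewrite gt_eqF.
rewrite /mscale/= muleA -EFinM mulVf ?gt_eqF// mul1e.
by [].
Qed.

Lemma ge0_integral_affine1 (a c : R) (f : measurableTypeR R -> \bar R) : c != 0%R ->
  measurable_fun [set: measurableTypeR R] f -> (forall x, 0 <= f x) ->
  \int[leb]_x f (a + c * x)%R = `|c|^-1%:E * \int[leb]_x f x.
Proof.
move=> c0 mf f0.
have c_gt0 : (0 < `|c|)%R by rewrite normr_gt0.
have mphi := measurable_affine1 a c.
have := @ge0_integral_pushforward _ _ _ _ R _ mphi leb setT f measurableT mf.
rewrite preimage_setT => <- //.
pose ac : {nonneg R} := NngNum (ltW (eqbRL (invr_gt0 _) c_gt0)).
transitivity (\int[mscale ac leb]_x f x); last first.
  by rewrite (ge0_integral_mscale _ measurableT).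
apply: eq_measure_integral => A mA _.
exact: lebesgue_measure_affine.
Qed.

(** [lebesgue_row n.+1] is the image of the product measure under [row_cons], so this is a change of
    variables followed by Tonelli's theorem. *)
Lemma ge0_integral_row_cons n (f : 'rV[R]_n.+1 -> \bar R) :
  measurable_fun setT f -> (forall x, 0 <= f x) ->
  \int[lebesgue_row n.+1]_x f x =
  \int[leb]_t \int[lebesgue_row n]_y f (row_cons (t, y)).
Proof.
move=> mf f0.
rewrite -(fubini_tonelli1 (f \o @row_cons R n)) //=; last first.
  exact: measurableT_comp mf (@measurable_row_cons R n).
have := @ge0_integral_pushforward _ _ _ _ R _ (@measurable_row_cons R n)
  (leb \x lebesgue_row n) setT f measurableT mf.
by rewrite preimage_setT => <-.
Qed.

Lemma measurable_row_affine n (a : 'rV[R]_n) (c : R) :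
  measurable_fun setT (fun x : 'rV[R]_n => a + c *: x)%R.
Proof.
apply: measurable_fun_rowP => i.
rewrite (_ : _ \o _ = affine1 (a ord0 i) c \o row_coord i).
  apply: measurableT_comp; first exact: measurable_affine1.
  exact: measurable_row_coord.
by apply/funext => x /=; rewrite /row_coord /affine1 !mxE.
Qed.

(** Induction on the dimension; each coordinate contributes one factor 1/|c|. *)
Lemma ge0_integral_row_affine n (a : 'rV[R]_n) (c : R)
    (f : 'rV[R]_n -> \bar R) : c != 0%R ->
  measurable_fun setT f -> (forall x, 0 <= f x) ->
  \int[lebesgue_row n]_x f (a + c *: x)%R =
  ((`|c|^-1) ^+ n)%:E * \int[lebesgue_row n]_x f x.
Proof.
move=> c0; elim: n a f => [|n IH] a f mf f0.
  rewrite expr0 mul1e; apply: eq_integral => x _; congr f.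
  by apply/rowP => -[].
rewrite ge0_integral_row_cons //; last first.
  exact: measurableT_comp mf (measurable_row_affine _ _).
pose a0 := a ord0 ord0; pose a' : 'rV[R]_n := rsubmx (a : 'rV_(1 + n)).
have E t y : (a + c *: row_cons (t, y))%R = row_cons (a0 + c * t, a' + c *: y)%R.
  rewrite -(row_unconsK (a + _)%R); congr row_cons.
  rewrite /row_uncons !mxE; congr (_, _).
    by case: splitP => // j _; rewrite mxE.
  by apply/rowP => i; rewrite !mxE; case: splitP => j //= ij;
     [case: j ij => -[]//|]; rewrite (_ : j = i)//; apply/val_inj/eqP;
     rewrite -(eqn_add2l 1)  -ij.
have mfr : measurable_fun setT (f \o @row_cons R n).
  exact: measurableT_comp mf (@measurable_row_cons R n).
under eq_integral do under eq_integral do rewrite E.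
pose g t := \int[lebesgue_row n]_y f (row_cons (t, y)).
have mg : measurable_fun setT g.
  apply: (measurable_fun_fubini_tonelli_F (f \o @row_cons R n)) => //.
  by move=> ?; exact: f0.
have g0 t : 0 <= g t by apply: integral_ge0.
transitivity (\int[leb]_t (((`|c|^-1) ^+ n)%:E * g (a0 + c * t)%R)).
  apply: eq_integral => t _.
  rewrite (IH a' (fun y => f (row_cons ((a0 + c * t)%R, y)))) //.
  exact: measurableT_comp mfr (measurable_pair1 _).
rewrite ge0_integralZl //; last first.
  exact: measurableT_comp mg (measurable_affine1 _ _).
rewrite ge0_integral_affine1// muleA -EFinM -exprSr; congr (_ * _).
by rewrite ge0_integral_row_cons.
Qed.

End affine_change_of_variables.

(** * Open sets of row vectors and Borel measurability *)

Section row_topology.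
Context {R : realType} {n : nat}.

Lemma row_ballE (x y : 'rV[R]_n) (e : R) : 0 < e ->
  (forall i, `|x ord0 i - y ord0 i| < e) -> ball x e y.
Proof. by move=> e0 H; split => // i j; rewrite (ord1 i); exact: H. Qed.

Lemma row_ball_coord (x y : 'rV[R]_n) (e : R) i :
  ball x e y -> `|x ord0 i - y ord0 i| < e.
Proof. by move=> -[_ H]; exact: H. Qed.

(** Second countability in the form needed later: the point lies in an open cube with rational
    centre and half-side 1/(k+1), and the closed cube, which is compact, is still contained in the
    open set. *)
Lemma open_row_rational_box (A : set 'rV[R]_n) (x : 'rV[R]_n) : open A -> A x ->
  exists2 q : 'rV[rat]_n * nat,
    forall i, `|ratr (q.1 ord0 i) - x ord0 i| < q.2.+1%:R^-1 &
    forall y : 'rV[R]_n,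
      (forall i, `|ratr (q.1 ord0 i) - y ord0 i| <= q.2.+1%:R^-1) -> A y.
Proof.
move=> oA Ax.
have [e /= e0 eA] : nbhs_ball x A by rewrite nbhs_ballE; exact: open_nbhs_nbhs.
near \oo => k.
have ke : k.+1%:R^-1 < e / 2.
  near: k; apply: near_infty_natSinv_lt (PosNum _); exact: divr_gt0.
have k0 : 0 < k.+1%:R^-1 :> R by rewrite invr_gt0.
have /choice[q hq] i : exists q : rat, `|ratr q - x ord0 i| < k.+1%:R^-1.
  have [z [xq [q _ qE]]] := @dense_rat R (ball (x ord0 i : R) k.+1%:R^-1)
    (ex_intro _ (x ord0 i) (ballxx _ k0)) (ball_open _ _).
  by exists q; move: xq; rewrite -qE distrC.
exists (\row_i q i, k) => [i|y Hy] /=; first by rewrite mxE.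
apply: eA; apply: row_ballE => // i.
have := Hy i; rewrite mxE => Hi; have H2 := hq i.
rewrite (_ : x ord0 i - _ = (x ord0 i - ratr (q i)) + (ratr (q i) - y ord0 i)); last by ring.
apply: (le_lt_trans (ler_normD _ _)); rewrite (splitr e).
by apply: ltr_leD; [rewrite distrC; exact: lt_trans ke|exact: le_trans Hi (ltW ke)].
Unshelve. all: by end_near. Qed.

(** The sigma-algebra is generated by the coordinates, not by the open sets; an open set is the
    union of the countably many rational cubes that it contains. *)
Lemma open_row_measurable (A : set 'rV[R]_n) : open A -> measurable A.
Proof.
move=> oA.
pose Q := ('rV[rat]_n * nat)%type.
pose U (q : Q) : set 'rV[R]_n :=
  [set x | forall i, `|ratr (q.1 ord0 i) - x ord0 i| < q.2.+1%:R^-1].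
have mU q : measurable (U q).
  rewrite (_ : U q = \bigcap_(i in [set: 'I_n])
    (row_coord i @^-1` ball (ratr (q.1 ord0 i) : R) (q.2.+1%:R^-1))).
    apply: fin_bigcap_measurable; first exact: finite_finset.
    move=> i _; rewrite -[X in measurable X]setTI.
    apply: measurable_row_coord => //.
    exact: measurable_ball.
  by apply/seteqP; split => x /= H i => [_|]; exact: H.
rewrite (_ : A = \bigcup_(q in [set q | U q `<=` A]) U q).
  rewrite bigcup_mkcond; apply: countable_bigcupT_measurable => [|q].
    exact: countableP.
  by case: ifP.
apply/seteqP; split => [x Ax|x [q /= qA]]; last exact: qA.
have [q xq qA] := open_row_rational_box oA Ax.
by exists q => // y /= yq; apply: qA => i; exact: ltW.
Qed.

Lemma closed_row_measurable (A : set 'rV[R]_n) : closed A -> measurable A.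
Proof.
move=> cA; rewrite -(setCK A); apply: measurableC.
by apply: open_row_measurable; rewrite openC.
Qed.

Lemma compact_row_measurable (A : set 'rV[R]_n) : compact A -> measurable A.
Proof.
move=> cA; apply: closed_row_measurable; apply: compact_closed cA.
exact: norm_hausdorff.
Qed.

Lemma continuous_row_measurable (f : 'rV[R]_n -> R) : continuous f ->
  measurable_fun setT f.
Proof.
move=> cf; apply: (measurability _ (RGenOpens.measurableE R)).
move=> _ [_ [a [b ->] <-]]; rewrite setTI.
apply: open_row_measurable.
by move/continuousP: cf; apply; exact: interval_open.
Qed.

End row_topology.

(** * Euclidean norm and gradients *)

Section euclidean_norm.
Context {R : realType} {n : nat}.
Implicit Types (x y v : 'rV[R]_n) (c : R).

Definition dot x y : R := \sum_i x ord0 i * y ord0 i.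

Lemma enorm_ge0 x : 0 <= enorm x. Proof. exact: sqrtr_ge0. Qed.

Lemma enorm_sqr x : enorm x ^+ 2 = \sum_i x ord0 i ^+ 2.
Proof. by rewrite sqr_sqrtr // sumr_ge0 // => i _; exact: sqr_ge0. Qed.

Lemma enorm0 : enorm (0 : 'rV[R]_n) = 0.
Proof.
by apply/eqP; rewrite -sqrf_eq0 enorm_sqr big1 // => i _; rewrite mxE expr0n.
Qed.

Lemma coord_le_enorm x i : `|x ord0 i| <= enorm x.
Proof.
rewrite -(ler_pXn2r (n := 2)) ?nnegrE ?enorm_ge0//.
rewrite enorm_sqr (bigD1 i)//= real_normK ?num_real// lerDl.
by apply: sumr_ge0 => j _; exact: sqr_ge0.
Qed.

Lemma enorm_eq0 x : enorm x = 0 -> x = 0.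
Proof.
move=> x0; apply/rowP => i; rewrite mxE; apply/eqP; rewrite -normr_le0 -x0.
exact: coord_le_enorm.
Qed.

Lemma enorm_gt0 x : x != 0 -> 0 < enorm x.
Proof.
move=> x0; rewrite lt_neqAle enorm_ge0 andbT eq_sym; apply: contra x0 => /eqP H.
by apply/eqP; exact: enorm_eq0.
Qed.

Lemma enormZ c x : enorm (c *: x) = `|c| * enorm x.
Proof.
apply/eqP; rewrite -(@eqrXn2 _ 2)// ?mulr_ge0 ?enorm_ge0//.
rewrite exprMn !enorm_sqr real_normK ?num_real// mulr_sumr.
by apply/eqP/eq_bigr => i _; rewrite mxE exprMn.
Qed.

Lemma enormN x : enorm (- x) = enorm x.
Proof. by rewrite -scaleN1r enormZ normrN normr1 mul1r. Qed.

Lemma enormD_sqr x y :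
  enorm (x + y) ^+ 2 = enorm x ^+ 2 + 2 * dot x y + enorm y ^+ 2.
Proof.
rewrite !enorm_sqr /dot mulr_sumr -!big_split/=; apply: eq_bigr => i _.
by rewrite mxE; ring.
Qed.

Lemma dotZr c x y : dot x (c *: y) = c * dot x y.
Proof. by rewrite /dot mulr_sumr; apply: eq_bigr => i _; rewrite mxE; ring. Qed.

Lemma dotNr x y : dot x (- y) = - dot x y.
Proof. by rewrite -scaleN1r dotZr mulN1r. Qed.

(** The square of the norm of |y|^2 x - (x.y) y is nonnegative and equals |y|^2 (|x|^2 |y|^2 -
    (x.y)^2). *)
Lemma cauchy_schwarz x y : `|dot x y| <= enorm x * enorm y.
Proof.
rewrite -(ler_pXn2r (n := 2)) ?nnegrE ?mulr_ge0 ?enorm_ge0//.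
rewrite real_normK ?num_real// exprMn.
have [->|y0] := eqVneq y 0.
  rewrite enorm0 (_ : dot x 0 = 0) ?expr0n ?mulr0//= /dot big1// => i _.
  by rewrite mxE mulr0.
have B0 : 0 < enorm y ^+ 2 by rewrite exprn_gt0// enorm_gt0.
have := sqr_ge0 (enorm (enorm y ^+ 2 *: x + (- dot x y) *: y)).
rewrite enormD_sqr !enormZ !exprMn !real_normK ?num_real// dotZr.
have -> : dot (enorm y ^+ 2 *: x) y = enorm y ^+ 2 * dot x y.
  by rewrite /dot mulr_sumr; apply: eq_bigr => i _; rewrite !mxE mulrA.
set A := enorm x ^+ 2; set B := enorm y ^+ 2 in B0 *; set C := dot x y => H.
rewrite -subr_ge0 -(pmulr_rge0 _ B0).
apply: le_trans H _; rewrite le_eqVlt; apply/orP; left; apply/eqP; ring.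
Qed.

Lemma enormD x y : enorm (x + y) <= enorm x + enorm y.
Proof.
rewrite -(ler_pXn2r (n := 2)) ?nnegrE ?addr_ge0 ?enorm_ge0//.
rewrite enormD_sqr sqrrD lerD2r lerD2l -[X in _ <= X]mulr_natl.
by rewrite ler_wpM2l//; exact: le_trans (ler_norm _) (cauchy_schwarz _ _).
Qed.

Lemma enormB x y : enorm x - enorm y <= enorm (x - y).
Proof. by rewrite lerBlDr; apply: le_trans (enormD _ _); rewrite subrK. Qed.

Lemma enorm_parallelogram x y :
  enorm (x + y) ^+ 2 + enorm (x - y) ^+ 2 = 2 * (enorm x ^+ 2 + enorm y ^+ 2).
Proof. by rewrite !enormD_sqr enormN dotNr; ring. Qed.

Lemma enorm_le_sum x : enorm x <= \sum_i `|x ord0 i|.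
Proof.
have S0 : 0 <= \sum_i `|x ord0 i| by apply: sumr_ge0.
rewrite -(ler_pXn2r (n := 2)) ?nnegrE ?enorm_ge0//.
rewrite enorm_sqr expr2 mulr_suml; apply: ler_sum => i _.
rewrite -(real_normK (num_real (x ord0 i))) expr2 ler_wpM2l//.
by rewrite (bigD1 i)//= lerDl sumr_ge0.
Qed.

Lemma coord_le_norm x i : `|x ord0 i| <= `|x|.
Proof.
have [x0|x0] := eqVneq `|x| 0.
  by move/normr0_eq0 : x0 => ->; rewrite mxE normr0.
rewrite leNgt; apply/negP => xi.
(* Assuming |x| < |x_i|, the midpoint is a radius larger than |x|, so x lies in that ball, and every
   coordinate is smaller than the radius: a contradiction. *)
pose e := (`|x| + `|x ord0 i|) / 2.
have : ball (0 : 'rV[R]_n) e x.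
  rewrite mx_norm_ball /ball_ /= sub0r normrN /e; lra.
move=> /(row_ball_coord i); rewrite mxE sub0r normrN /e; lra.
Qed.

Lemma enorm_le_norm x : enorm x <= n%:R * `|x|.
Proof.
apply: le_trans (enorm_le_sum _) _.
rewrite mulr_natl -[X in _ *+ X](card_ord n) -sumr_const.
by apply: ler_sum => i _; exact: coord_le_norm.
Qed.

Lemma norm_le_enorm x : `|x| <= enorm x.
Proof.
apply/ler_addgt0Pl => e e0.
have : ball (0 : 'rV[R]_n) (e + enorm x) x.
  apply: row_ballE => [|i]; first by rewrite ltr_wpDr// enorm_ge0.
  rewrite mxE sub0r normrN; apply: le_lt_trans (coord_le_enorm _ _) _.
  by rewrite ltrDr.
by rewrite mx_norm_ball /ball_ /= sub0r normrN => /ltW.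
Qed.

Lemma enorm_continuous : continuous (@enorm R n).
Proof.
move=> x; apply/(@cvgrPdist_lt _ _ _ (nbhs x) (nbhs_filter x)) => e e0.
(* The Lipschitz constant n is replaced by n + 1 because n may be 0 and the tolerance is divided by
   it. *)
have n0 : 0 < (n%:R + 1 : R) by rewrite ltr_wpDl.
near=> y.
have H : enorm (x - y) < e.
  apply: le_lt_trans (enorm_le_norm _) _.
  apply: (@le_lt_trans _ _ ((n%:R + 1) * `|x - y|)).
    by rewrite ler_wpM2r// lerDl.
  rewrite mulrC -ltr_pdivlMr//.
  near: y; apply: (@cvgr_dist_lt _ _ _ (nbhs x) _ id x) => //.
  exact: divr_gt0.
apply: le_lt_trans H.
rewrite ler_norml enormB andbT lerNl opprB.
by rewrite -(enormN (x - y)) opprB enormB.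
Unshelve. all: by end_near. Qed.

Lemma open_eball (r : R) : open (@eball R n r).
Proof.
rewrite (_ : eball r = @enorm R n @^-1` [set y | y < r]) //.
by move/continuousP: enorm_continuous; apply; exact: open_lt.
Qed.

Lemma measurable_eball (r : R) : measurable (@eball R n r).
Proof. by apply: open_row_measurable; exact: open_eball. Qed.

Lemma closed_cball (r : R) : closed [set x : 'rV[R]_n | enorm x <= r].
Proof.
rewrite (_ : mkset _ = @enorm R n @^-1` [set y | y <= r]) //.
by move/continuous_closedP: enorm_continuous; apply; exact: closed_le.
Qed.

Lemma compact_cball (r : R) : compact [set x : 'rV[R]_n | enorm x <= r].
Proof.
apply: bounded_closed_compact; last exact: closed_cball.
exists r; split; first exact: num_real.
move=> M rM x /= xr; apply: le_trans (norm_le_enorm _) _.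
exact: le_trans xr (ltW rM).
Qed.

Lemma measurable_enorm : measurable_fun setT (@enorm R n).
Proof. by apply: continuous_row_measurable; exact: enorm_continuous. Qed.

End euclidean_norm.

(** * Gradients and derivatives along lines *)

Section gradient.
Context {R : realType} {n : nat}.
Implicit Types (u w : 'rV[R]_n -> R) (x v : 'rV[R]_n).

Definition grad u x : 'rV[R]_n := \row_i partial i u x.

Lemma derive_dot u x v : differentiable u x -> 'D_v u x = dot v (grad u x).
Proof.
move=> du; rewrite deriveE // [in LHS](row_sum_delta v) linear_sum/=.
by apply: eq_bigr => i _; rewrite linearZ/= mxE /partial deriveE.
Qed.

(** The difference quotient of u in the direction v and that of its restriction to the line are the
    same function of h, so existence and value of the derivative both transfer. *)
Lemma is_derive_line u x v (t : R) : differentiable u (x + t *: v) ->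
  is_derive t (1 : R) (fun s : R => u (x + s *: v)) (dot v (grad u (x + t *: v))).
Proof.
move=> du; rewrite -derive_dot//.
have dv : derivable u (x + t *: v) v by exact: diff_derivable.
split.
  move: dv; rewrite /derivable.
  suff -> : (fun h : R => h^-1 *: ((u \o shift (x + t *: v)) (h *: v) - u (x + t *: v)))
    = (fun h : R => h^-1 *: (((fun s : R => u (x + s *: v)) \o shift t) (h *: 1) - u (x + t *: v))) by [].
  apply/funext => h /=; congr (_ *: (u _ - _)).
  by rewrite /shift/= [h%:A]mulr1 scalerDl addrCA.
rewrite /derive.
suff -> : (fun h : R => h^-1 *: ((u \o shift (x + t *: v)) (h *: v) - u (x + t *: v)))
    = (fun h : R => h^-1 *: (((fun s : R => u (x + s *: v)) \o shift t) (h *: 1) - u (x + t *: v))) by [].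
apply/funext => h /=; congr (_ *: (u _ - _)).
by rewrite /shift/= [h%:A]mulr1 scalerDl addrCA.
Qed.

Lemma smooth_differentiable u x : smooth u -> differentiable u x.
Proof. by move=> /(_ [::]); exact. Qed.

Lemma smooth_continuous u : smooth u -> continuous u.
Proof. by move=> su x; apply: differentiable_continuous; exact: smooth_differentiable. Qed.

Lemma smooth_partial u i : smooth u -> smooth (partial i u).
Proof. by move=> su s x; have := su (rcons s i) x; rewrite foldr_rcons. Qed.

End gradient.

(** * The inequality on a ray *)

Lemma measurable_powR_comp {d} {T : measurableType d} {R : realType} (D : set T)
    (f : T -> R) (p : R) :
  measurable_fun D f -> measurable_fun D (fun x => f x `^ p).
Proof. by move=> mf; exact: (measurableT_comp (measurable_powR p) mf). Qed.

Section power_integrals.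
Context {R : realType}.
Local Notation leb := (@lebesgue_measure R).

Lemma is_derive_powR (b t : R) : 0 < t ->
  is_derive t (1 : R) (fun s : R => s `^ b) (b * t `^ (b - 1)).
Proof.
move=> t0; have tp : t \in `]0, +oo[ by rewrite in_itv/= t0.
apply: DeriveDef; first by apply: derivable_powR.
by have := powR_derive1 b tp; rewrite derive1E.
Qed.

Lemma powR_continuous (b t : R) : 0 < t -> {for t, continuous (fun s : R => s `^ b)}.
Proof.
move=> t0; apply: differentiable_continuous; apply/derivable1_diffP.
by have [] := is_derive_powR b t0.
Qed.

Lemma measurable_powRl (b : R) (D : set R) : measurable_fun D (fun s : R => s `^ b).
Proof. exact: measurable_funTS (measurable_powR _). Qed.

(** For a < 1 the integrand is singular at 0, so the fundamental theorem of calculus is applied on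
    intervals away from 0 and monotone convergence follows. An upper bound is all that is needed:
    the boundary term at the left end is simply dropped. *)
Lemma integral_powR_le (a T : R) : 0 < a -> 0 < T ->
  (\int[leb]_(t in `]0%R, T]) (a * t `^ (a - 1))%:E <= (T `^ a)%:E)%E.
Proof.
move=> a0 T0.
(* The denominator i + 2 keeps the left end strictly below T. *)
pose F (i : nat) : set R := `[T / i.+2%:R, T]%classic.
have UF : \bigcup_i F i = `]0, T]%classic.
  apply/seteqP; split => [t [i _]|t] /=; rewrite /F/= !in_itv/=.
    by move=> /andP[Ht ->]; rewrite (lt_le_trans _ Ht)// divr_gt0.
  move=> /andP[t0 tT].
  near \oo => i; exists i => //; rewrite /F/= in_itv/= tT andbT.
  rewrite ler_pdivrMr// mulrC -ler_pdivrMr//.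
  have : T / t <= i%:R by near: i; exact: nbhs_infty_ger.
  by move=> /le_trans; apply; rewrite ler_nat -addn2 leq_addr.
pose f (t : R) := (a * t `^ (a - 1))%:E.
have mf (D : set R) : measurable_fun D f.
  apply/measurable_EFinP; apply: measurable_funM; first exact: measurable_cst.
  exact: measurable_powRl.
have f0 t : (0 <= f t)%E by rewrite lee_fin mulr_ge0 ?powR_ge0 ?ltW.
have cv : (\int[leb]_(t in F i) f t)%E @[i --> \oo] -->
    (\int[leb]_(t in \bigcup_i F i) f t)%E.
  apply: ge0_nondecreasing_set_cvg_integral => //.
  - move=> i j ij; apply/subsetPset => t; rewrite /F/= !in_itv/=.
    move=> /andP[+ ->]; rewrite andbT; apply: le_trans.
    by rewrite ler_pM2l// lef_pV2 ?posrE// ler_nat !ltnS.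
  - by move=> i; exact: measurable_itv.
  - by move=> i; exact: mf.
rewrite -UF -(cvg_lim _ cv)//; apply: lime_le; first exact: cvgP cv.
apply: nearW => i.
have d0 : 0 < T / i.+2%:R by rewrite divr_gt0.
have dT : T / i.+2%:R < T.
  by rewrite ltr_pdivrMr// ltr_pMr// ltr1n.
rewrite (@continuous_FTC2 _ _ (fun s : R => s `^ a)) //.
- by rewrite -EFinB lee_fin lerBlDr lerDl powR_ge0.
- apply: continuous_in_subspaceT => t; rewrite inE/= in_itv/= => /andP[dt _].
  apply: cvgMr; apply: powR_continuous; exact: lt_le_trans dt.
- split.
  + move=> t; rewrite in_itv/= => /andP[dt _].
    by have [] := is_derive_powR a (lt_trans d0 dt).
  + by apply: cvg_at_right_filter; exact: powR_continuous.
  + by apply: cvg_at_left_filter; exact: powR_continuous.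
- move=> t; rewrite in_itv/= => /andP[dt _].
  by have [_ Dt] := is_derive_powR a (lt_trans d0 dt); rewrite derive1E Dt.
Unshelve. all: by end_near. Qed.

(** This is the inner integral of [polar_integral], with s = |x|; a primitive is - t^(-k) / k. *)
Lemma integral_powR_infty (k : nat) (s : R) : (0 < k)%N -> 0 < s ->
  (\int[leb]_(t in `]s, +oo[) (t `^ (- k%:R - 1))%:E = (s ^- k / k%:R)%:E)%E.
Proof.
move=> k0 s0.
have kR : 0 < k%:R :> R by rewrite ltr0n.
pose F (t : R) := - (t `^ (- k%:R) / k%:R).
pose f (t : R) := t `^ (- k%:R - 1).
have dF (t : R) : 0 < t -> is_derive t (1 : R) F (f t).
  move=> t0.
  have -> : F = - (k%:R^-1 \*: (fun t : R => t `^ (- k%:R))).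
    by apply/funext => x; rewrite /F /GRing.opp/= /GRing.scale/= mulrC.
  have -> : f t = - (k%:R^-1 *: (- k%:R * t `^ (- k%:R - 1))).
    by rewrite /GRing.scale/= /f; field; rewrite gt_eqF.
  apply: is_deriveN; apply: is_deriveZ; exact: is_derive_powR.
have -> : (fun t : R => (t `^ (- k%:R - 1))%:E) = (fun t => (f t)%:E) by [].
rewrite integral_itv_obnd_cbnd; last first.
  by apply/measurable_EFinP; exact: measurable_powRl.
rewrite (@ge0_continuous_FTC2y _ _ F s 0) //.
- by rewrite sub0e -EFinN /F opprK powR_invn// ltW.
- by move=> t _; exact: powR_ge0.
- apply: continuous_in_subspaceT => t; rewrite inE/= in_itv/= andbT => st.
  by apply: powR_continuous; exact: lt_le_trans st.
- rewrite -oppr0; apply: cvgN; rewrite -[X in _ --> X](mul0r k%:R^-1).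
  apply: cvgMl.
  have H : (fun t : R => t^-1) @ +oo --> (0 : R).
    apply/gtr0_cvgV0; last exact: cvg_id.
    by near=> t; near: t; exact: nbhs_pinfty_gt.
  apply: (@squeeze_cvgr _ _ _ _ (cst 0) (fun t : R => t^-1)) => //; last first.
    exact: cvg_cst.
  near=> t; rewrite powR_ge0/=.
  have t1 : 1 <= t by near: t; exact: nbhs_pinfty_ge.
  have t0 : 0 < t by exact: lt_le_trans t1.
  rewrite (powR_invn _ (ltW t0)) lef_pV2 ?posrE ?exprn_gt0//.
  by rewrite -[X in X <= _]expr1 ler_weXn2l.
- by move=> t st; have [] := dF t (lt_trans s0 st).
- apply: cvg_at_right_filter; apply: differentiable_continuous.
  by apply/derivable1_diffP; have [] := dF s s0.
- move=> t; rewrite in_itv/= andbT => st.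
  by have [_ Dt] := dF t (lt_trans s0 st); rewrite derive1E Dt.
Unshelve. all: by end_near. Qed.

End power_integrals.

Section ray_inequality.
Context {R : realType}.
Local Notation leb := (@lebesgue_measure R).

(** Young's inequality for the exponents p and p/(p-1), cleared of denominators: the graph of b |->
    b^p lies above its tangent line at q. *)
Lemma young_powR (p b q : R) : 1 < p -> 0 <= b -> 0 <= q ->
  p * (q `^ (p - 1) * b) <= b `^ p + (p - 1) * q `^ p.
Proof.
move=> p1 b0 q0; have p0 : 0 < p by exact: lt_trans p1.
have pm0 : 0 < p - 1 by rewrite subr_gt0.
have := @conjugate_powR R b (q `^ (p - 1)) p (p / (p - 1)) b0 (powR_ge0 _ _) p0.
rewrite divr_gt0// => /(_ isT) H.
have {H} : b * q `^ (p - 1) <= b `^ p / p + q `^ p / (p / (p - 1)).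
  rewrite (_ : q `^ p = q `^ (p - 1) `^ (p / (p - 1))).
    apply: H; field; apply/andP; split; exact: lt0r_neq0.
  by rewrite -powRrM mulrC divfK// gt_eqF.
rewrite -(ler_pM2l p0); congr (_ <= _); first by ring.
field; apply/andP; split; exact: lt0r_neq0.
Qed.

(* Tangent line (Young) inequality at the optimal profile s |-> |f 0| (1 - (s / T)^a),
   whose weighted derivative to the power p - 1 is constant. *)
Lemma ray_inequality (N : nat) (p T : R) (f f' : R -> R) :
  (2 <= N)%N -> N%:R < p -> 0 < T ->
  (forall t : R, is_derive t (1 : R) f (f' t)) -> continuous f' -> f T = 0 ->
  ((`|f 0| `^ p * ((p - N%:R) / (p - 1)) `^ (p - 1) * T `^ (- (p - N%:R)))%:E <=
  \int[leb]_(t in `]0%R, T]) (`|f' t| `^ p * t ^+ N.-1)%:E)%E.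
Proof.
move=> N2 Np T0 df cf' fT.
have N1 : 1 < N%:R :> R by rewrite ltr1n.
have hN1 : N.-1%:R = N%:R - 1 :> R by rewrite -subn1 natrB// ltnW.
have p1 : 1 < p by exact: lt_trans Np.
have p0 : 0 < p by exact: lt_trans p1.
have pm0 : 0 < p - 1 by rewrite subr_gt0.
have pN0 : 0 < p - N%:R by rewrite subr_gt0.
set a := (p - N%:R) / (p - 1).
have a0 : 0 < a by rewrite divr_gt0.
have Ta0 : 0 < T `^ a by rewrite powR_gt0.
(* A t^(a - 1) is the modulus of the derivative of the optimal profile. *)
pose A : R := `|f 0| * a / T `^ a.
have A0 : 0 <= A by apply: divr_ge0 (ltW Ta0); apply: mulr_ge0 => //; exact: ltW.
(* The constant value of (A t^(a - 1))^(p - 1) t^(N - 1), since (a - 1)(p - 1) = - (N - 1). *)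
pose c : R := A `^ (p - 1).
have c0 : 0 <= c by exact: powR_ge0.
have mf' (D : set R) : measurable_fun D f'.
  by apply: measurable_funTS; exact: continuous_measurable_fun.
have mabs (D : set R) : measurable_fun D (fun t => `|f' t|).
  by apply: measurableT_comp (mf' D); exact: normr_measurable.
have mI : measurable (`]0, T]%classic : set R) by exact: measurable_itv.
have s1 : ((`|f 0|)%:E <= \int[leb]_(t in `]0%R, T]) (`|f' t|)%:E)%E.
  have cf t : {for t, continuous f}.
    by apply: differentiable_continuous; apply/derivable1_diffP; have [] := df t.
  have E : (\int[leb]_(t in `[0%R, T]) (f' t)%:E = (f T)%:E - (f 0)%:E)%E.
    apply: continuous_FTC2 => //.
    - by apply: continuous_subspaceT.
    - split; first by move=> t _; have [] := df t.
        by apply: cvg_at_right_filter; exact: cf.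
      by apply: cvg_at_left_filter; exact: cf.
    - by move=> t _; rewrite derive1E; have [_ ->] := df t.
  rewrite integral_itv_obnd_cbnd; last by apply/measurable_EFinP; exact: mabs.
  have := @le_abse_integral _ _ R leb `[0%R, T] (EFin \o f') (measurable_itv _).
  rewrite /= E fT sub0e abseN /=; apply.
  by apply/measurable_EFinP; exact: mf'.
pose X := (\int[leb]_(t in `]0%R, T]) (`|f' t| `^ p * t ^+ N.-1)%:E)%E.
have mX : measurable_fun `]0%R, T] (fun t => (`|f' t| `^ p * t ^+ N.-1)%:E).
  apply/measurable_EFinP; apply: measurable_funM.
    by apply: measurable_powR_comp; exact: mabs.
  exact: exprn_measurable.
have mq : measurable_fun `]0%R, T] (fun t => (a * t `^ (a - 1))%:E).
  apply/measurable_EFinP; apply: measurable_funM; first exact: measurable_cst.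
  exact: measurable_powRl.
have pc0 : 0 <= p * c by rewrite mulr_ge0// ltW.
pose d : R := (p - 1) * c * (`|f 0| / T `^ a).
have d0 : 0 <= d by rewrite !mulr_ge0 ?invr_ge0// ltW.
(* The tangent inequality at q = A t^(a - 1), multiplied by t^(N - 1) and integrated. As q^(p - 1)
   t^(N - 1) = c, the weight disappears from both integrals other than X. *)
have s2 : ((p * c)%:E * \int[leb]_(t in `]0%R, T]) (`|f' t|)%:E <=
     X + d%:E * \int[leb]_(t in `]0%R, T]) (a * t `^ (a - 1))%:E)%E.
  rewrite -ge0_integralZl//; last by apply/measurable_EFinP; exact: mabs.
  rewrite -ge0_integralZl//; last first.
    by move=> t _; rewrite lee_fin mulr_ge0 ?powR_ge0 ?ltW.
  rewrite -ge0_integralD//; last 3 first.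
  - move=> t; rewrite /= in_itv/= => /andP[t0 _].
    by rewrite lee_fin mulr_ge0 ?powR_ge0 ?exprn_ge0// ltW.
  - by move=> t _; rewrite lee_fin !mulr_ge0 ?powR_ge0 ?invr_ge0// ltW.
  - exact: measurable_funeM.
  apply: ge0_le_integral => //.
  - by move=> t _; rewrite mule_ge0 ?lee_fin.
  - by apply: measurable_funeM; apply/measurable_EFinP; exact: mabs.
  - by apply: emeasurable_funD => //; exact: measurable_funeM.
  move=> t; rewrite /= in_itv/= => /andP[t0 _].
  rewrite -!EFinM -EFinD lee_fin.
  have tk0 : 0 < t ^+ N.-1 by rewrite exprn_gt0.
  pose q : R := A * t `^ (a - 1).
  have q0 : 0 <= q by rewrite mulr_ge0 ?powR_ge0.
  have Y := young_powR p1 (normr_ge0 (f' t)) q0.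
  rewrite -(ler_pM2r tk0) in Y; move: Y.
  have qk : q `^ (p - 1) * t ^+ N.-1 = c.
    rewrite /q powRM ?powR_ge0// -powRrM -powR_mulrn ?ltW// -mulrA -powRD; last first.
      by apply/implyP => _; rewrite gt_eqF.
    rewrite hN1 (_ : (a - 1) * (p - 1) + _ = 0) ?powRr0 ?mulr1//.
    by rewrite /a; field; rewrite gt_eqF.
  have -> : p * (q `^ (p - 1) * `|f' t|) * t ^+ N.-1 = p * c * `|f' t|.
    by rewrite -qk; ring.
  move=> /le_trans; apply; rewrite mulrDl lerD2l.
  rewrite -(mulr_powRB1 q0 p0).
  have -> : (p - 1) * (q * q `^ (p - 1)) * t ^+ N.-1 = (p - 1) * (q * c).
    by rewrite -qk; ring.
  rewrite le_eqVlt; apply/orP; left; apply/eqP.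
  by rewrite /q /d /A; ring.
(* Once the two weightless integrals are replaced by |f 0| and T^a, the difference of the two
   multiples of c |f 0| is exactly c |f 0|, which is the constant claimed. *)
have s3 : ((p * c * `|f 0|)%:E <= X + ((p - 1) * c * `|f 0|)%:E)%E.
  rewrite EFinM.
  apply: (@le_trans _ _ ((p * c)%:E * \int[leb]_(t in `]0%R, T]) (`|f' t|)%:E)%E).
    by rewrite lee_wpmul2l.
  apply: (le_trans s2); rewrite leeD2l//.
  have -> : ((p - 1) * c * `|f 0|)%:E = (d%:E * (T `^ a)%:E)%E.
    by rewrite -EFinM; congr EFin; rewrite /d; field; rewrite gt_eqF.
  by rewrite lee_wpmul2l//; exact: integral_powR_le.
have -> : `|f 0| `^ p * a `^ (p - 1) * T `^ (- (p - N%:R)) = c * `|f 0|.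
  have h1 : 0 <= (T `^ a)^-1 by rewrite invr_ge0 ltW.
  have h2 : 0 <= a / T `^ a by rewrite mulr_ge0// ltW.
  have -> : c = (`|f 0| * (a / T `^ a)) `^ (p - 1) by rewrite /c /A [in RHS]mulrA.
  rewrite (powRM _ (normr_ge0 (f 0)) h2) (powRM _ (ltW a0) h1).
  rewrite -(mulr_powRB1 (normr_ge0 (f 0)) p0).
  have -> : (T `^ a)^-1 `^ (p - 1) = T `^ (- (p - N%:R)).
    rewrite -powRN -powRrM; congr powR; rewrite /a; field; exact: lt0r_neq0.
  by ring.
have : ((p * c * `|f 0|)%:E - ((p - 1) * c * `|f 0|)%:E <= X)%E by rewrite leeBlDr.
by rewrite -EFinB (_ : _ - _ = c * `|f 0|)//; ring.
Qed.

End ray_inequality.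

(** * Polar coordinates without a surface measure *)

Section polar.
Context {R : realType} {n : nat}.
Local Notation leb := (@lebesgue_measure R).
Local Notation mu := (@lebesgue_row R n).

Lemma lebesgue_row_set1 (x : 'rV[R]_n) : (0 < n)%N -> mu [set x] = 0%E.
Proof.
move=> n0; rewrite (_ : [set x] = row_box x x).
  rewrite lebesgue_row_box// (bigD1 (Ordinal n0))//= subrr mul0r.
  by [].
apply/seteqP; split => [y /= -> i|y /= H].
  by rewrite in_itv/= !lexx.
by apply/rowP => i; have := H i; rewrite in_itv/= => /andP[? ?]; apply/eqP; rewrite eq_le; apply/andP.
Qed.

Lemma measurable_scale_row :
  measurable_fun setT (fun z : measurableTypeR R * 'rV[R]_n => z.1 *: z.2).
Proof.
apply: measurable_fun_rowP => i.
rewrite (_ : _ \o _ = (fun z : measurableTypeR R * 'rV[R]_n => z.1 * row_coord i z.2)).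
  apply: (@measurable_realfun.measurable_funM _ (measurableTypeR R * 'rV[R]_n)%type R setT fst
    (fun z => row_coord i z.2)).
    exact: measurable_fst.
  exact: measurableT_comp (measurable_row_coord i) measurable_snd.
by apply/funext => z /=; rewrite /row_coord mxE.
Qed.

Local Notation pos := (`]0%R, +oo[%classic : set (measurableTypeR R)).

(** The half-line t > 0 is encoded by an indicator, so that Tonelli's theorem applies on the whole
    product space. *)
Definition ray_integral (g : 'rV[R]_n -> \bar R) (y : 'rV[R]_n) : \bar R :=
  (\int[leb]_t ((\1_pos t * t ^+ n.-1)%:E * g (t *: y)))%E.

Lemma ray_weight_ge0 (t : R) : 0 <= \1_pos t * t ^+ n.-1.
Proof.
rewrite indicE; case: (boolP (t \in pos)) => [|_]; last by rewrite mul0r.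
by rewrite inE/= in_itv/= andbT => /ltW t0; rewrite mul1r exprn_ge0.
Qed.

Lemma ray_integral_ge0 g y : (forall x, 0 <= g x)%E -> (0 <= ray_integral g y)%E.
Proof.
move=> g0; apply: integral_ge0 => t _.
by rewrite mule_ge0 ?lee_fin// ray_weight_ge0.
Qed.

Lemma measurable_ray_weight :
  measurable_fun setT (fun t : measurableTypeR R => \1_pos t * t ^+ n.-1 : R).
Proof.
apply: measurable_realfun.measurable_funM.
  by apply: measurable_indic; exact: measurable_itv.
exact: exprn_measurable.
Qed.

Lemma measurable_ray_integrand (g : 'rV[R]_n -> \bar R) : measurable_fun setT g ->
  measurable_fun setT (fun z : measurableTypeR R * 'rV[R]_n =>
    ((\1_pos z.1 * z.1 ^+ n.-1)%:E * g (z.1 *: z.2))%E).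
Proof.
move=> mg; apply: emeasurable_funM.
  apply/measurable_EFinP.
  exact: measurableT_comp measurable_ray_weight measurable_fst.
exact: measurableT_comp mg measurable_scale_row.
Qed.

Lemma measurable_ray_integral (g : 'rV[R]_n -> \bar R) : measurable_fun setT g ->
  (forall x, 0 <= g x)%E -> measurable_fun setT (ray_integral g).
Proof.
move=> mg g0; apply: (measurable_fun_fubini_tonelli_G _ (measurable_ray_integrand mg)).
by move=> z; rewrite mule_ge0 ?lee_fin// ray_weight_ge0.
Qed.

(* Integration in polar coordinates, with the sphere replaced by the ball weighted by
   |y|^n: substitute z = t y in the inner integral and integrate over t > |z|. *)
Lemma polar_integral (g : 'rV[R]_n -> \bar R) : (0 < n)%N ->
  measurable_fun setT g -> (forall x, 0 <= g x)%E ->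
  (\int[mu]_y ((\1_(eball 1) y * enorm y ^+ n)%:E * ray_integral g y) =
   n%:R^-1%:E * \int[mu]_x g x)%E.
Proof.
move=> n0 mg g0.
have nR : 0 < n%:R :> R by rewrite ltr0n.
pose b (y : 'rV[R]_n) : R := \1_(eball 1) y * enorm y ^+ n.
pose w (t : measurableTypeR R) : R := \1_pos t * t ^+ n.-1.
have b0 y : 0 <= b y by rewrite mulr_ge0 ?exprn_ge0 ?enorm_ge0.
have w0 t : 0 <= w t by exact: ray_weight_ge0.
have mb : measurable_fun setT b.
  apply: measurable_realfun.measurable_funM.
    by apply: measurable_indic; exact: measurable_eball.
  apply: (measurableT_comp (exprn_measurable _)).
  exact: measurable_enorm.
have mw : measurable_fun setT w by exact: measurable_ray_weight.
pose K (z : measurableTypeR R * 'rV[R]_n) : \bar R :=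
  ((b z.2)%:E * ((w z.1)%:E * g (z.1 *: z.2)))%E.
have K0 z : (0 <= K z)%E by rewrite /K !mule_ge0 ?lee_fin.
have mK : measurable_fun setT K.
  apply: emeasurable_funM.
    by apply/measurable_EFinP; exact: measurableT_comp mb measurable_snd.
  exact: measurable_ray_integrand.
transitivity (\int[mu]_y \int[leb]_t K (t, y))%E.
  apply: eq_integral => y _; rewrite /ray_integral -ge0_integralZl//.
  - exact: (measurableT_comp (measurable_ray_integrand mg) (measurable_pair2 y)).
  - by move=> t _; rewrite mule_ge0 ?lee_fin; [|exact: w0|].
  - by rewrite lee_fin; exact: b0.
rewrite -(fubini_tonelli K)//.
(* The kernel after the substitution z = t y: the Jacobian t^(-n) and the factors t^(n - 1) and |z /
   t|^n combine into |z|^n t^(-n - 1), on t > |z|. *)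
pose m (z : measurableTypeR R * 'rV[R]_n) : R :=
  \1_[set z : measurableTypeR R * 'rV[R]_n | enorm z.2 < z.1] z *
   (enorm z.2 ^+ n * z.1 `^ (- n%:R - 1)).
pose M (z : measurableTypeR R * 'rV[R]_n) : \bar R := ((m z)%:E * g z.2)%E.
have m0 z : 0 <= m z.
  rewrite /m indicE; case: (boolP (z \in _)) => [|_]; last by rewrite mul0r.
  rewrite inE/= => /ltW zt; have t0 : 0 <= z.1 := le_trans (enorm_ge0 _) zt.
  by rewrite mul1r mulr_ge0 ?powR_ge0 ?exprn_ge0 ?enorm_ge0.
have M0 z : (0 <= M z)%E by rewrite /M mule_ge0 ?lee_fin.
have me2 : measurable_fun setT (fun z : measurableTypeR R * 'rV[R]_n => enorm z.2).
  exact: measurableT_comp measurable_enorm measurable_snd.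
have mm : measurable_fun setT m.
  apply: measurable_realfun.measurable_funM.
    apply: measurable_indic; rewrite -[X in measurable X]setTI.
    have := measurable_fun_ltr me2 (@measurable_fst _ _ (measurableTypeR R) _).
    by move=> /(_ measurableT [set true]); apply.
  apply: measurable_realfun.measurable_funM.
    exact: (measurableT_comp (exprn_measurable _)).
  apply: measurable_powR_comp; exact: measurable_fst.
have mM : measurable_fun setT M.
  apply: emeasurable_funM; first exact/measurable_EFinP.
  exact: measurableT_comp mg measurable_snd.
transitivity (\int[leb]_t \int[mu]_z M (t, z))%E.
  apply: eq_integral => t _.
  have [t0|t0] := ltP 0 t; last first.
    rewrite !integral0_eq// => y _.
      rewrite /M /m indicE (_ : (_ \in _) = false) ?mul0r ?mul0e//.
      by apply/negbTE; rewrite notin_setE/=; apply/negP; rewrite -leNgt (le_trans t0)// enorm_ge0.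
    rewrite /K/= /w indicE (_ : (_ \in _) = false) ?mul0r ?mul0e ?mule0//.
    by apply/negbTE; rewrite notin_setE /= in_itv/= andbT; apply/negP; rewrite -leNgt.
  pose f (z : 'rV[R]_n) : \bar R := ((b (t^-1 *: z))%:E * ((w t)%:E * g z))%E.
  have t0' : t != 0 by rewrite gt_eqF.
  transitivity (\int[mu]_y f (0 + t *: y)%R)%E.
    by apply: eq_integral => y _; rewrite /f add0r scalerA mulVf// scale1r.
  have mf : measurable_fun setT f.
    apply: emeasurable_funM.
      apply/measurable_EFinP; apply: (measurableT_comp mb).
      rewrite (_ : *:%R _ = (fun x : 'rV[R]_n => 0 + t^-1 *: x)).
        exact: measurable_row_affine.
      by apply/funext => x; rewrite add0r.
    by apply: emeasurable_funM => //; exact: measurable_cst.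
  have f0 z : (0 <= f z)%E by rewrite /f !mule_ge0 ?lee_fin.
  rewrite ge0_integral_row_affine// -ge0_integralZl//.
  apply: eq_integral => z _; rewrite /f /M muleA muleA -!EFinM; congr ((_%:E) * _)%E.
  rewrite gtr0_norm// /b /w /m enormZ gtr0_norm ?invr_gt0//.
  have -> : \1_pos t = 1 :> R by rewrite indicE mem_set// /= in_itv/= t0.
  have -> : \1_(eball 1) (t^-1 *: z) =
     \1_[set z : measurableTypeR R * 'rV[R]_n | enorm z.2 < z.1] (t, z) :> R.
    rewrite !indicE; congr (nat_of_bool _)%:R; apply/idP/idP;
      by rewrite !inE/= /eball/= enormZ gtr0_norm ?invr_gt0// mulrC ltr_pdivrMr// mul1r.
  rewrite -opprD natr1 powR_invn ?(ltW t0)// mul1r exprMn exprVn.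
  have tn : t ^+ n = t * t ^+ n.-1 by rewrite -exprS prednK.
  rewrite /= exprS !tn; set I1 := \1__ _; field.
  by rewrite t0' expf_neq0.
rewrite (fubini_tonelli M)//.
rewrite -ge0_integralZl//.
apply: ge0_ae_eq_integral => //.
- exact: (measurable_fun_fubini_tonelli_G M).
- exact: measurable_funeM.
- by move=> x _; apply: integral_ge0.
- by move=> x _; apply: mule_ge0 => //; rewrite lee_fin invr_ge0 ltW.
(* At the origin the factor |z|^n makes the inner integral vanish, so the two integrands agree only
   off this null set. *)
exists [set 0]; split.
- apply: closed_row_measurable; apply: accessible_closed_set1.
  by apply: hausdorff_accessible; exact: norm_hausdorff.
- exact: lebesgue_row_set1.
move=> x /= H; apply: contrapT => x0; apply: H => _.
have ex0 : 0 < enorm x by apply: enorm_gt0; apply/eqP.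
transitivity (\int[leb]_t (g x * (\1_`]enorm x, +oo[ t * (enorm x ^+ n * t `^ (- n%:R - 1)))%:E))%E.
  apply: eq_integral => t _; rewrite /M/= muleC; congr (_ * (_ * _)%:E)%E.
  rewrite !indicE; congr (nat_of_bool _)%:R.
  by apply/idP/idP; rewrite !inE/= in_itv/= andbT.
have mI : measurable (`]enorm x, +oo[%classic : set (measurableTypeR R)).
  exact: measurable_itv.
have mt D : measurable_fun D (fun t : measurableTypeR R => t `^ (- n%:R - 1)).
  exact: measurable_powRl.
rewrite ge0_integralZl//; last 2 first.
- apply/measurable_EFinP; apply: measurable_realfun.measurable_funM.
    exact: measurable_indic.
  by apply: measurable_realfun.measurable_funM => //; exact: measurable_cst.
- move=> t _; rewrite lee_fin indicE; case: (boolP (t \in _)) => [|_]; last by rewrite mul0r.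
  by move=> _; rewrite mul1r mulr_ge0 ?powR_ge0 ?exprn_ge0// ltW.
rewrite muleC; congr (_ * _)%E.
transitivity (\int[leb]_(t in `]enorm x, +oo[) ((enorm x ^+ n)%:E * (t `^ (- n%:R - 1))%:E))%E.
  rewrite [RHS]integral_mkcond epatch_indic; apply: eq_integral => t _ /=.
  by rewrite -!EFinM mulrC.
rewrite ge0_integralZl//; last 3 first.
- by apply/measurable_EFinP.
- by move=> t _; rewrite lee_fin powR_ge0.
- by rewrite lee_fin exprn_ge0// ltW.
rewrite integral_powR_infty// -EFinM; congr EFin.
by field; rewrite !gt_eqF// exprn_gt0.
Qed.

End polar.

(** * The sharp inequality on the ball *)

Section volume.
Context {R : realType} {n : nat}.
Local Notation mu := (@lebesgue_row R n).

Lemma lebesgue_row_open_gt0 (U : set 'rV[R]_n) (x : 'rV[R]_n) :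
  open U -> U x -> (0 < mu U)%E.
Proof.
move=> oU Ux.
have [e /= e0 eU] : nbhs_ball x U by rewrite nbhs_ballE; exact: open_nbhs_nbhs.
pose c := const_mx (e / 2) : 'rV[R]_n.
have bU : row_box (x - c) (x + c) `<=` U.
  move=> y yb; apply: eU; apply: row_ballE => // i.
  have := yb i; rewrite in_itv/= !mxE => /andP[h1 h2].
  by rewrite ltr_norml; apply/andP; split; lra.
apply: lt_le_trans (le_measure mu _ _ bU); last 2 first.
- by rewrite inE; exact: measurable_row_box.
- by rewrite inE; exact: open_row_measurable.
suff : (0 < lebesgue_row n (row_box (x - c) (x + c)))%E by [].
rewrite lebesgue_row_box; last by move=> i; rewrite !mxE; lra.
by rewrite lte_fin; apply: prodr_gt0 => i _; rewrite !mxE; lra.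
Qed.

Lemma lebesgue_row_eball_lty (r : R) : (mu (eball r) < +oo)%E.
Proof.
have [r0|r0] := leP r 0.
  rewrite (_ : eball r = set0) ?measure0//; apply/seteqP; split => x //=.
  by rewrite /eball/= => /lt_le_trans/(_ r0); rewrite ltNge enorm_ge0.
pose c := const_mx r : 'rV[R]_n.
have sub : @eball R n r `<=` row_box (- c) c.
  move=> x /= xr i; rewrite in_itv/= !mxE -ler_norml.
  exact: le_trans (coord_le_enorm _ _) (ltW xr).
apply: le_lt_trans (le_measure mu _ _ sub) _.
- by rewrite inE; exact: measurable_eball.
- by rewrite inE; exact: measurable_row_box.
suff : (lebesgue_row n (row_box (- c) c) < +oo)%E by [].
rewrite lebesgue_row_box ?ltry// => i; rewrite !mxE; lra.
Qed.

Lemma lebesgue_row_eball_gt0 (r : R) : 0 < r -> (0 < mu (eball r))%E.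
Proof.
move=> r0; apply: (@lebesgue_row_open_gt0 _ 0); first exact: open_eball.
by rewrite /eball/= enorm0.
Qed.

(** Its value is never computed: it is finite and positive, and it enters the sharp inequality and
    the energy of u_p as the same factor. *)
Definition unit_volume : R := fine (mu (eball 1)).

Lemma unit_volumeE : mu (eball 1) = unit_volume%:E.
Proof.
rewrite /unit_volume fineK// ge0_fin_numE//; exact: lebesgue_row_eball_lty.
Qed.

Lemma unit_volume_gt0 : 0 < unit_volume.
Proof. by rewrite -lte_fin -unit_volumeE lebesgue_row_eball_gt0. Qed.

Lemma ge0_integral_translation (a : 'rV[R]_n) (f : 'rV[R]_n -> \bar R) :
  measurable_fun setT f -> (forall x, 0 <= f x)%E ->
  (\int[mu]_x f (a + x)%R = \int[mu]_x f x)%E.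
Proof.
move=> mf f0; have := @ge0_integral_row_affine R n a 1 f (oner_neq0 _) mf f0.
rewrite normr1 invr1 expr1n mul1e => <-.
by apply: eq_integral => x _; rewrite scale1r.
Qed.

Lemma ge0_integral_reflection (f : 'rV[R]_n -> \bar R) :
  measurable_fun setT f -> (forall x, 0 <= f x)%E ->
  (\int[mu]_x f (- x)%R = \int[mu]_x f x)%E.
Proof.
move=> mf f0.
have := @ge0_integral_row_affine R n 0 (-1) f _ mf f0.
rewrite normrN normr1 invr1 expr1n mul1e => <-; last by rewrite oppr_eq0 oner_eq0.
by apply: eq_integral => x _; rewrite scaleN1r add0r.
Qed.

End volume.
Arguments unit_volume R n : clear implicits.

(** * The inequality with an arbitrary pole *)

Section sharp_inequality.
Context {R : realType} {N : nat}.
Variables (p r : R).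
Hypotheses (N2 : (2 <= N)%N) (Np : N%:R < p) (r0 : 0 < r).
Local Notation leb := (@lebesgue_measure R).
Local Notation mu := (@lebesgue_row R N).
Local Notation pos := (`]0%R, +oo[%classic : set (measurableTypeR R)).
Local Notation a := ((p - N%:R) / (p - 1)).
Local Notation m := (p - N%:R).

(* At x = 0 this is the constant Lambda_p of the ball. *)
Definition pole_constant (x : 'rV[R]_N) : R :=
  N%:R * unit_volume R N * a `^ (p - 1) * (r ^+ 2 - enorm x ^+ 2) `^ (- (m / 2)).

Let N1 : 1 < N%:R :> R. Proof. by rewrite ltr1n. Qed.
Let m0 : 0 < m. Proof. by rewrite subr_gt0. Qed.
Let pm0 : 0 < p - 1. Proof. by rewrite subr_gt0 (lt_trans N1). Qed.
Let p0 : 0 < p. Proof. by rewrite (lt_trans _ Np)// (lt_trans _ N1). Qed.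
Let a0 : 0 < a. Proof. by rewrite divr_gt0. Qed.
Let N0 : (0 < N)%N. Proof. exact: ltnW. Qed.

Section one_pole.
Variables (phi : 'rV[R]_N -> R) (x0 : 'rV[R]_N).
Hypotheses (dphi : forall x, differentiable phi x)
  (cphi : forall i, continuous (partial i phi))
  (phi0 : forall x, r <= enorm x -> phi x = 0)
  (x0r : enorm x0 < r).

Let g (x : 'rV[R]_N) : \bar R := (enorm (grad phi x) `^ p)%:E.
Let gs (x : 'rV[R]_N) : \bar R := g (x0 + x).

Lemma measurable_grad : measurable_fun setT (grad phi).
Proof.
apply: measurable_fun_rowP => i.
rewrite (_ : _ \o _ = partial i phi); first exact: continuous_row_measurable.
by apply/funext => x; rewrite /= /row_coord mxE.
Qed.

Let mg : measurable_fun setT g.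
Proof.
apply/measurable_EFinP; apply: measurable_powR_comp.
exact: measurableT_comp measurable_enorm measurable_grad.
Qed.

Let mgs : measurable_fun setT gs.
Proof.
rewrite (_ : gs = g \o (fun x => x0 + 1 *: x)); last first.
  by apply/funext => x; rewrite /= scale1r.
exact: measurableT_comp mg (measurable_row_affine _ _).
Qed.

Let gs0 x : (0 <= gs x)%E. Proof. by rewrite lee_fin powR_ge0. Qed.

Let continuous_dot y : continuous (fun t : R => dot y (grad phi (x0 + t *: y))).
Proof.
rewrite (_ : (fun t => _) = (fun t : R => \sum_i y ord0 i * partial i phi (x0 + t *: y))).
  move=> t; apply: cvg_big => [|i _]; first exact: add_continuous.
  apply: cvgMr.
  apply: (@continuous_comp _ _ _ (fun t : R => x0 + t *: y) (partial i phi)); last exact: cphi.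
  by apply: cvgD; [exact: cvg_cst|apply: cvgZr_tmp; exact: cvg_id].
by apply/funext => t; apply: eq_bigr => i _; rewrite mxE.
Qed.

(** [ray_inequality] for t |-> phi (x0 + t y), whose derivative is at most |y| |grad phi| by
    Cauchy-Schwarz. Multiplication by |y|^(-(p - N)) turns the resulting factor |y|^p into the
    weight |y|^N of polar coordinates. *)
Lemma ray_lower_bound (y : 'rV[R]_N) (T : R) : y != 0 -> 0 < T ->
  r <= enorm (x0 + T *: y) ->
  ((`|phi x0| `^ p * a `^ (p - 1) * T `^ (- m) * enorm y `^ (- m))%:E <=
   (enorm y ^+ N)%:E * ray_integral gs y)%E.
Proof.
move=> y0 T0 Tr.
have ey : 0 < enorm y by exact: enorm_gt0.
have := @ray_inequality R N p T (fun t => phi (x0 + t *: y))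
  (fun t => dot y (grad phi (x0 + t *: y))) N2 Np T0 _ _ (phi0 Tr).
rewrite scale0r addr0 => H.
have {H} : ((`|phi x0| `^ p * a `^ (p - 1) * T `^ (- m))%:E <=
    (enorm y `^ p)%:E * ray_integral gs y)%E.
  apply: le_trans (H _ _) _.
  - by move=> t; exact: is_derive_line.
  - exact: continuous_dot.
  rewrite -ge0_integralZl//; last 3 first.
  - exact: (measurableT_comp (measurable_ray_integrand mgs) (measurable_pair2 y)).
  - by move=> t _; apply: mule_ge0; rewrite ?lee_fin; [exact: (@ray_weight_ge0 R N)|exact: gs0].
  - by rewrite lee_fin powR_ge0.
  have mK := measurable_funeM (enorm y `^ p)%:E
    (measurableT_comp (measurable_ray_integrand mgs) (measurable_pair2 y)).
  have K0 (t : R) : (0 <= (enorm y `^ p)%:E * ((\1_pos t * t ^+ N.-1)%:E * gs (t *: y)))%E.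
    by rewrite !mule_ge0 ?lee_fin ?powR_ge0//; exact: (@ray_weight_ge0 R N).
  have mT : measurable (`]0%R, T]%classic : set (measurableTypeR R)).
    exact: measurable_itv.
  apply: (@le_trans _ _ (\int[leb]_(t in `]0%R, T]) ((enorm y `^ p)%:E *
      ((\1_pos t * t ^+ N.-1)%:E * gs (t *: y))))%E); last first.
    by apply: ge0_subset_integral => //.
  apply: ge0_le_integral => //.
  - move=> t; rewrite /= in_itv/= => /andP[/ltW t0 _].
    by rewrite lee_fin mulr_ge0 ?powR_ge0 ?exprn_ge0.
  - apply/measurable_EFinP; apply: measurable_realfun.measurable_funM.
      apply: measurable_powR_comp; apply: measurableT_comp; first exact: normr_measurable.
      by apply: measurable_funTS; apply: continuous_measurable_fun; exact: continuous_dot.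
    exact: exprn_measurable.
  - exact: measurable_funTS mK.
  move=> t; rewrite /= in_itv/= => /andP[t0 _].
  rewrite indicE mem_set/= ?in_itv/= ?t0// mul1r -!EFinM lee_fin.
  rewrite mulrCA [leRHS]mulrC ler_wpM2r// ?exprn_ge0 ?(ltW t0)//.
  rewrite -powRM ?enorm_ge0//; apply: ge0_ler_powR; rewrite ?nnegrE ?(ltW p0)//.
    by rewrite mulr_ge0 ?enorm_ge0.
  exact: cauchy_schwarz.
have e0 : 0 <= enorm y `^ (- m) by exact: powR_ge0.
have le0 : (0 <= (enorm y `^ (- m))%:E)%E by rewrite lee_fin.
move=> /(lee_wpmul2l le0); rewrite -EFinM mulrC => /le_trans; apply.
rewrite muleA -EFinM -powRD; last by apply/implyP => _; rewrite gt_eqF.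
by rewrite opprB subrK powR_mulrn ?enorm_ge0.
Qed.

(* The two chord lengths T1, T2 through x0 in the directions y and -y satisfy
   T1 T2 |y|^2 = r^2 - |x0|^2 (power of a point). *)
Lemma chord_lower_bound (y : 'rV[R]_N) : y != 0 ->
  ((2 * (`|phi x0| `^ p * a `^ (p - 1) *
     (r ^+ 2 - enorm x0 ^+ 2) `^ (- (m / 2))))%:E <=
   (enorm y ^+ N)%:E * ray_integral gs y +
   (enorm (- y) ^+ N)%:E * ray_integral gs (- y))%E.
Proof.
move=> y0.
have ey : 0 < enorm y by exact: enorm_gt0.
pose A : R := enorm y ^+ 2; pose b : R := dot x0 y.
pose k : R := r ^+ 2 - enorm x0 ^+ 2.
have A0 : 0 < A by rewrite exprn_gt0.
have k0 : 0 < k.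
  by rewrite /k subr_gt0 ltr_pXn2r// nnegrE ?enorm_ge0 ?(ltW r0).
(* D^2 is the reduced discriminant of A T^2 + 2 b T = k, the equation of the points of the line on
   the sphere; its roots are T1 and - T2. *)
pose D := Num.sqrt (b ^+ 2 + A * k).
have D2 : D ^+ 2 = b ^+ 2 + A * k.
  by rewrite sqr_sqrtr// addr_ge0 ?sqr_ge0// mulr_ge0 ?ltW.
have D0 : 0 <= D by exact: sqrtr_ge0.
have bD : `|b| < D.
  rewrite -(ltr_pXn2r (n := 2))// ?nnegrE// D2 real_normK ?num_real//.
  by rewrite ltrDl mulr_gt0.
move: bD; rewrite ltr_norml => /andP[bD1 bD2].
pose T1 : R := (D - b) / A; pose T2 : R := (D + b) / A.
have T10 : 0 < T1 by rewrite divr_gt0// subr_gt0.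
have T20 : 0 < T2 by rewrite divr_gt0//; lra.
have An0 : A != 0 by rewrite gt_eqF.
have T12 : T1 * T2 = k / A.
  rewrite /T1 /T2 mulrACA -[_ * (D + b)]/((D - b) * (D + b)) -subr_sqr D2.
  by field.
(* The sign c = 1 or c = -1 treats the directions y and - y together. *)
have root (T c : R) : c ^+ 2 = 1 -> A * T ^+ 2 + 2 * (c * b) * T = k ->
    r <= enorm (x0 + T *: (c *: y)).
  move=> c2 hT; rewrite -(ler_pXn2r (n := 2)) ?nnegrE ?enorm_ge0 ?(ltW r0)//.
  rewrite enormD_sqr scalerA enormZ dotZr exprMn real_normK ?num_real//.
  rewrite -/A -/b exprMn c2 mulr1.
  rewrite (_ : _ + _ + _ = enorm x0 ^+ 2 + (A * T ^+ 2 + 2 * (c * b) * T)); last by ring.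
  by rewrite hT /k addrCA subrr addr0.
have r1 : r <= enorm (x0 + T1 *: y).
  rewrite -[y in T1 *: y]scale1r; apply: root; first by rewrite expr1n.
  rewrite mul1r /T1; transitivity ((D ^+ 2 - b ^+ 2) / A); first by field.
  by rewrite D2; field.
have r2 : r <= enorm (x0 + T2 *: (- y)).
  rewrite -scaleN1r; apply: root; first by rewrite sqrrN expr1n.
  rewrite /T2; transitivity ((D ^+ 2 - b ^+ 2) / A); first by field.
  by rewrite D2; field.
have Ny0 : - y != 0 by rewrite oppr_eq0.
apply: le_trans (leeD (ray_lower_bound y0 T10 r1) (ray_lower_bound Ny0 T20 r2)).
rewrite enormN -EFinD lee_fin -mulrDl -mulrDr.
set C := _ * a `^ (p - 1).
have C0 : 0 <= C by rewrite mulr_ge0 ?powR_ge0.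
rewrite mulrCA -mulrA ler_wpM2l//.
pose X := T1 `^ (- m); pose Y := T2 `^ (- m).
pose Z := k `^ (- (m / 2)); pose E := enorm y `^ (- m).
have E0 : 0 < E by rewrite powR_gt0.
have X0 : 0 < X by rewrite powR_gt0.
have Y0 : 0 < Y by rewrite powR_gt0.
have Z0 : 0 < Z by rewrite powR_gt0.
have XYE : (X * E) * (Y * E) = Z ^+ 2.
  rewrite /X /Y /Z /E mulrACA -powRM ?(ltW T10) ?(ltW T20)// T12.
  rewrite -powRM ?enorm_ge0// -powRM ?mulr_ge0 ?invr_ge0 ?(ltW k0) ?(ltW A0) ?enorm_ge0//.
  rewrite -[enorm y * enorm y]expr2 -/A divfK//.
  by rewrite -powR_mulrn ?powR_ge0// -powRrM; congr powR; field.
rewrite -/X -/Y -/Z -/E mulrDl.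
set X' := X * E in XYE *; set Y' := Y * E in XYE *.
clearbody X Y Z E.
have X'0 : 0 < X' by rewrite mulr_gt0.
have Y'0 : 0 < Y' by rewrite mulr_gt0.
have XY0 : 0 <= X' + Y' by rewrite addr_ge0// ltW.
have ZZ0 : 0 <= 2 * Z by rewrite mulr_ge0// ltW.
(* AM-GM in squared form: (X' + Y')^2 - 4 X' Y' = (X' - Y')^2. *)
rewrite -(ler_pXn2r (n := 2))// exprMn -XYE -subr_ge0.
rewrite (_ : _ - _ = (X' - Y') ^+ 2) ?sqr_ge0//.
by ring.
Qed.

(** The chord bound is integrated over the unit ball. By reflection the terms in y and - y have the
    same integral, so the factor 2 cancels, and [polar_integral] supplies the factor N. *)
Theorem sharp_inequality_at :
  ((pole_constant x0 * `|phi x0| `^ p)%:E <= \int[mu]_x (enorm (grad phi x) `^ p)%:E)%E.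
Proof.
have N0R : 0 < N%:R :> R by rewrite ltr0n.
pose H (y : 'rV[R]_N) : \bar R := ((\1_(eball 1) y * enorm y ^+ N)%:E * ray_integral gs y)%E.
have H0 y : (0 <= H y)%E.
  rewrite mule_ge0 ?lee_fin ?mulr_ge0 ?exprn_ge0 ?enorm_ge0//.
  exact: ray_integral_ge0.
have mH : measurable_fun setT H.
  apply: emeasurable_funM; last exact: measurable_ray_integral.
  apply/measurable_EFinP; apply: measurable_realfun.measurable_funM.
    by apply: measurable_indic; exact: measurable_eball.
  exact: (measurableT_comp (exprn_measurable _) measurable_enorm).
have mHN : measurable_fun setT (fun y : 'rV[R]_N => H (- y)).
  rewrite (_ : (fun y => _) = H \o (fun x => 0 + (-1) *: x)).
    exact: measurableT_comp mH (measurable_row_affine _ _).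
  by apply/funext => x /=; rewrite scaleN1r add0r.
have E : (\int[mu]_y H y = N%:R^-1%:E * \int[mu]_x g x)%E.
  rewrite -(ge0_integral_translation x0 mg); last by move=> x; rewrite lee_fin powR_ge0.
  exact: polar_integral.
pose c := `|phi x0| `^ p * a `^ (p - 1) * (r ^+ 2 - enorm x0 ^+ 2) `^ (- (m / 2)).
have c0 : 0 <= c by rewrite !mulr_ge0 ?powR_ge0.
have L : ((2 * c)%:E * mu (eball 1) <= \int[mu]_y (H y + H (- y)%R))%E.
  have -> : ((2 * c)%:E * mu (eball 1) = \int[mu]_y ((2 * c)%:E * (\1_(eball 1) y)%:E))%E.
    rewrite ge0_integralZl//; last 2 first.
    - by apply/measurable_EFinP; apply: measurable_indic; exact: measurable_eball.
    - by rewrite lee_fin mulr_ge0.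
    by rewrite integral_indic ?setIT//; exact: measurable_eball.
  apply: ae_ge0_le_integral => //.
  - by move=> y _; rewrite -EFinM lee_fin; apply: mulr_ge0 => //; exact: mulr_ge0.
  - apply: measurable_funeM; apply/measurable_EFinP.
    by apply: measurable_indic; exact: measurable_eball.
  - by move=> y _; rewrite adde_ge0.
  - exact: (emeasurable_funD mH mHN).
  (* The origin gives no direction; it is discarded as a null set. *)
  exists [set 0]; split.
  - apply: closed_row_measurable; apply: accessible_closed_set1.
    by apply: hausdorff_accessible; exact: norm_hausdorff.
  - exact: lebesgue_row_set1.
  move=> y /= Hy; apply: contrapT => y0; apply: Hy => _.
  have [yB|yB] := boolP (y \in eball 1); last first.
    by rewrite indicE (negbTE yB) mule0 adde_ge0.
  rewrite indicE yB mule1 /H !indicE yB.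
  have -> : (- y) \in eball 1 by move: yB; rewrite !inE /eball/= enormN.
  rewrite !mul1r; apply: chord_lower_bound; exact/eqP.
clearbody H.
move: L; rewrite ge0_integralD// (ge0_integral_reflection mH H0) E.
rewrite unit_volumeE -EFinM => L.
have /(lee_wpmul2l) : (0 <= (N%:R / 2)%:E :> \bar R)%E by rewrite lee_fin divr_ge0.
move=> /(_ _ _ L); rewrite -EFinM.
rewrite -ge0_muleDl ?lee_fin ?invr_ge0// muleA -EFinD -EFinM.
rewrite (_ : N%:R / 2 * (N%:R^-1 + N%:R^-1) = 1); last by field; rewrite gt_eqF.
rewrite mul1e (_ : N%:R / 2 * _ = pole_constant x0 * `|phi x0| `^ p)//.
by rewrite /pole_constant /c; field.
Qed.

End one_pole.
End sharp_inequality.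

(** * The energy of u_p *)

Section extremal_energy.
Context {R : realType} {N : nat}.
Variables (p r : R).
Hypotheses (N2 : (2 <= N)%N) (Np : N%:R < p) (r0 : 0 < r).
Local Notation leb := (@lebesgue_measure R).
Local Notation mu := (@lebesgue_row R N).
Local Notation pos := (`]0%R, +oo[%classic : set (measurableTypeR R)).
Local Notation a := ((p - N%:R) / (p - 1)).
Local Notation m := (p - N%:R).
Local Notation c := (a / r `^ a).

Let N1 : 1 < N%:R :> R. Proof. by rewrite ltr1n. Qed.
Let m0 : 0 < m. Proof. by rewrite subr_gt0. Qed.
Let pm0 : 0 < p - 1. Proof. by rewrite subr_gt0 (lt_trans N1). Qed.
Let p0 : 0 < p. Proof. by rewrite (lt_trans _ Np)// (lt_trans _ N1). Qed.
Let a0 : 0 < a. Proof. by rewrite divr_gt0. Qed.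
Let a1 : a < 1. Proof. by rewrite ltr_pdivrMr// mul1r ltrD2l ltrN2. Qed.
Let N0 : (0 < N)%N. Proof. exact: ltnW. Qed.
Let c0 : 0 < c. Proof. by rewrite divr_gt0// powR_gt0. Qed.

(** The classical gradient of u_p away from the origin; at the origin the formula gives 0. *)
Definition extremal_grad (x : 'rV[R]_N) : 'rV[R]_N :=
  - (c * enorm x `^ (a - 2)) *: x.

Lemma enorm_extremal_grad x : enorm (extremal_grad x) = c * enorm x `^ (a - 1).
Proof.
(* [powR] sends 0 to 0 also for the negative exponent a - 1, so the identity persists at the
   origin. *)
have [->|x0] := eqVneq x 0.
  rewrite /extremal_grad scaler0 enorm0 powR0 ?mulr0// subr_eq0.
  by rewrite lt_eqF.
have ex : 0 < enorm x by exact: enorm_gt0.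
rewrite enormZ normrN ger0_norm; last by rewrite mulr_ge0 ?powR_ge0// ltW.
rewrite -[LHS]mulrA; congr (_ * _).
rewrite -[X in _ * X = _]powRr1 ?(ltW ex)// -powRD; last first.
  by apply/implyP => _; rewrite gt_eqF.
by congr powR; ring.
Qed.

(** Only this direction is computed; the reverse inequality comes from the sharp inequality at the
    pole 0, see [gint_extremal_grad]. *)
Lemma extremal_energy_le :
  (\int[mu]_(x in eball r) (enorm (extremal_grad x) `^ p)%:E <=
    (pole_constant p r (0 : 'rV[R]_N))%:E)%E.
Proof.
have N0R : 0 < N%:R :> R by rewrite ltr0n.
pose h (x : 'rV[R]_N) : R := \1_(eball r) x * (c * enorm x `^ (a - 1)) `^ p.
pose g (x : 'rV[R]_N) : \bar R := (h x)%:E.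
have h0 x : 0 <= h x by rewrite mulr_ge0 ?powR_ge0.
have g0 x : (0 <= g x)%E by rewrite lee_fin.
have mg : measurable_fun setT g.
  apply/measurable_EFinP; apply: measurable_realfun.measurable_funM.
    by apply: measurable_indic; exact: measurable_eball.
  apply: measurable_powR_comp; apply: measurable_realfun.measurable_funM.
    exact: measurable_cst.
  by apply: measurable_powR_comp; exact: measurable_enorm.
have -> : (\int[mu]_(x in eball r) (enorm (extremal_grad x) `^ p)%:E =
    \int[mu]_x g x)%E.
  rewrite integral_mkcond epatch_indic; apply: eq_integral => x _ /=.
  by rewrite -EFinM mulrC enorm_extremal_grad.
(* The bound of [ray_inequality] for f 0 = 1 and T = r. *)
pose C : R := a `^ (p - 1) * r `^ (- m).
have C0 : 0 <= C by rewrite mulr_ge0 ?powR_ge0.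
have ray_le y : ((enorm y ^+ N)%:E * ray_integral g y <= C%:E)%E.
  have [->|y0] := eqVneq y 0.
    by rewrite enorm0 expr0n gtn_eqF// mul0e lee_fin.
  have ey : 0 < enorm y by exact: enorm_gt0.
  pose T := r / enorm y.
  have T0 : 0 < T by rewrite divr_gt0.
  (* Along the ray the weighted energy density is K a t^(a - 1), because (a - 1) p + N - 1 = a -
     1. *)
  pose K := c `^ p * enorm y `^ ((a - 1) * p) / a.
  have K0 : 0 <= K by rewrite !mulr_ge0 ?powR_ge0// invr_ge0 ltW.
  have mT : measurable (`]0%R, T]%classic : set (measurableTypeR R)).
    exact: measurable_itv.
  have mq : measurable_fun `]0%R, T] (fun t => (a * t `^ (a - 1))%:E).
    apply/measurable_EFinP; apply: measurable_realfun.measurable_funM.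
      exact: measurable_cst.
    exact: measurable_powRl.
  have le1 : (ray_integral g y <= \int[leb]_(t in `]0%R, T]) (K%:E * (a * t `^ (a - 1))%:E))%E.
    rewrite [leRHS]integral_mkcond epatch_indic; apply: ge0_le_integral => //.
    - move=> t _; rewrite mule_ge0 ?lee_fin//; exact: (@ray_weight_ge0 R N).
    - exact: (measurableT_comp (measurable_ray_integrand mg) (measurable_pair2 y)).
    - apply: emeasurable_funM; last first.
        by apply/measurable_EFinP; apply: measurable_indic.
      apply: measurable_funeM; apply/measurable_EFinP.
      apply: measurable_realfun.measurable_funM; first exact: measurable_cst.
      exact: measurable_powRl.
    move=> t _; rewrite /g -!EFinM lee_fin /= !indicE.
    have q0 : 0 <= a * t `^ (a - 1) by rewrite mulr_ge0 ?powR_ge0// ltW.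
    have Kq0 : 0 <= K * (a * t `^ (a - 1)) by exact: mulr_ge0.
    have [tp|tp] := boolP (t \in pos); last first.
      by rewrite !mul0r mulr_ge0.
    have t0 : 0 < t by move: tp; rewrite inE/= in_itv/= andbT.
    rewrite mul1r /h indicE.
    have [tB|tB] := boolP (t *: y \in eball r); last first.
      by rewrite mul0r mulr0 mulr_ge0.
    have tT : t <= T.
      move: tB; rewrite inE /eball/= enormZ gtr0_norm// => /ltW.
      by rewrite ler_pdivlMr.
    rewrite (_ : (t \in `]0, T]%classic) = true); last first.
      by rewrite mem_set//= in_itv/= t0.
    rewrite mul1r mulr1 enormZ gtr0_norm//.
    rewrite (powRM _ (ltW t0) (enorm_ge0 y)) (powRM _ (ltW c0)) ?mulr_ge0 ?powR_ge0//.
    rewrite (powRM _ (powR_ge0 _ _) (powR_ge0 _ _)) -!powRrM -powR_mulrn ?(ltW t0)//.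
    have e : t `^ N.-1%:R * t `^ ((a - 1) * p) = t `^ (a - 1).
      rewrite -powRD; last by apply/implyP => _; rewrite gt_eqF.
      congr powR; rewrite -subn1 natrB//; field; exact: lt0r_neq0.
    rewrite le_eqVlt; apply/orP; left; apply/eqP.
    rewrite -e /K; field; apply/andP; split; exact: lt0r_neq0.
  have eN : (0 <= (enorm y ^+ N)%:E :> \bar R)%E by rewrite lee_fin exprn_ge0// ltW.
  apply: (le_trans (lee_wpmul2l eN le1)).
  rewrite ge0_integralZl//; last by move=> t _; rewrite lee_fin mulr_ge0 ?powR_ge0// ltW.
  have KE : (0 <= K%:E :> \bar R)%E by rewrite lee_fin.
  apply: (@le_trans _ _ ((enorm y ^+ N)%:E * (K%:E * (T `^ a)%:E))%E).
    by apply: lee_wpmul2l => //; apply: lee_wpmul2l => //; exact: integral_powR_le.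
  rewrite -!EFinM lee_fin.
  have hr : 0 <= r by exact: ltW.
  have hei : 0 <= (enorm y)^-1 by rewrite invr_ge0 ltW.
  rewrite le_eqVlt; apply/orP; left; apply/eqP.
  rewrite /K /T /C (powRM _ hr hei) -(powR_inv1 (ltW ey)) -(powRrM (enorm y)) -(powR_mulrn _ (ltW ey)).
  have E1 : enorm y `^ N%:R * enorm y `^ ((a - 1) * p) * enorm y `^ (-1 * a) = 1.
    rewrite -!powRD; try by apply/implyP => _; rewrite gt_eqF.
    rewrite (_ : _ + _ = 0) ?powRr0//; field; exact: lt0r_neq0.
  have E2 : c `^ p * r `^ a / a = a `^ (p - 1) * r `^ (- m).
    rewrite powRM ?(ltW a0) ?invr_ge0 ?powR_ge0// -powRN -powRrM.
    rewrite -(mulr_powRB1 (ltW a0) p0).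
    transitivity (a `^ (p - 1) * (r `^ (- a * p) * r `^ a)).
      field; apply/andP; split; exact: lt0r_neq0.
    congr (_ * _); rewrite -powRD; last by apply/implyP => _; rewrite gt_eqF.
    congr powR; field; exact: lt0r_neq0.
  transitivity ((c `^ p * r `^ a / a) *
    (enorm y `^ N%:R * enorm y `^ ((a - 1) * p) * enorm y `^ (-1 * a))); first by ring.
  by rewrite E1 mulr1 E2.
have E : (\int[mu]_x g x = N%:R%:E *
    \int[mu]_y ((\1_(eball 1) y * enorm y ^+ N)%:E * ray_integral g y))%E.
  rewrite polar_integral// muleA -EFinM mulfV ?gt_eqF// mul1e//.
rewrite E.
have -> : pole_constant p r (0 : 'rV[R]_N) = N%:R * (C * unit_volume R N).
  rewrite /pole_constant enorm0 expr0n subr0 -powR_mulrn ?(ltW r0)// -powRrM.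
  rewrite (_ : 2%:R * _ = - m); last by field.
  by rewrite /C; ring.
rewrite EFinM; apply: lee_wpmul2l; first by rewrite lee_fin ltW.
rewrite EFinM -unit_volumeE.
have -> : (C%:E * mu (eball 1) = \int[mu]_y (C%:E * (\1_(eball 1) y)%:E))%E.
  rewrite ge0_integralZl//; last first.
    by apply/measurable_EFinP; apply: measurable_indic; exact: measurable_eball.
  by rewrite integral_indic ?setIT//; exact: measurable_eball.
apply: ge0_le_integral => //.
- move=> y _; rewrite mule_ge0 ?lee_fin ?mulr_ge0 ?exprn_ge0 ?enorm_ge0//.
  exact: ray_integral_ge0.
- apply: emeasurable_funM; last exact: measurable_ray_integral.
  apply/measurable_EFinP; apply: measurable_realfun.measurable_funM.
    by apply: measurable_indic; exact: measurable_eball.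
  exact: (measurableT_comp (exprn_measurable _) measurable_enorm).
- apply: measurable_funeM; apply/measurable_EFinP.
  by apply: measurable_indic; exact: measurable_eball.
move=> y _; rewrite indicE; case: (y \in _); last first.
  by rewrite mul0r mul0e mule0.
by rewrite mul1r mule1; exact: ray_le.
Qed.

End extremal_energy.

(** * Smooth functions and weak gradients *)

Section smooth_functions.
Context {R : realType} {n : nat}.
Implicit Types (u w : 'rV[R]_n -> R).

(** Coinduction principle for [smooth]: rather than computing iterated derivatives one exhibits an
    invariant class of differentiable functions. *)
Lemma smooth_closed (S : ('rV[R]_n -> R) -> Prop) :
  (forall u, S u -> forall x, differentiable u x) ->
  (forall u i, S u -> S (partial i u)) -> forall u, S u -> smooth u.
Proof.
move=> dS pS u Su s x; apply: dS; elim: s => //= i s IH; exact: pS.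
Qed.

(** Used as an invariant class for [smooth_closed]: by the Leibniz rule the algebra generated by G
    is stable under partial derivatives as soon as the derivatives of the generators belong to
    it. *)
Inductive fun_algebra (G : ('rV[R]_n -> R) -> Prop) : ('rV[R]_n -> R) -> Prop :=
| fun_algebra_base u : G u -> fun_algebra G u
| fun_algebraD u w : fun_algebra G u -> fun_algebra G w -> fun_algebra G (u \+ w)
| fun_algebraM u w : fun_algebra G u -> fun_algebra G w -> fun_algebra G (u \* w).

Lemma partialD i u w : (forall x, differentiable u x) ->
  (forall x, differentiable w x) -> partial i (u \+ w) = partial i u \+ partial i w.
Proof.
by move=> du dw; apply/funext => x; apply: deriveD; exact: diff_derivable.
Qed.

Lemma partialM i u w : (forall x, differentiable u x) ->
  (forall x, differentiable w x) ->
  partial i (u \* w) = (u \* partial i w) \+ (w \* partial i u).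
Proof.
by move=> du dw; apply/funext => x; apply: deriveM; exact: diff_derivable.
Qed.

Lemma smooth_algebra (G : ('rV[R]_n -> R) -> Prop) :
  (forall u, G u -> forall x, differentiable u x) ->
  (forall u i, G u -> fun_algebra G (partial i u)) ->
  forall u, fun_algebra G u -> smooth u.
Proof.
move=> dG pG.
have dA u : fun_algebra G u -> forall x, differentiable u x.
  elim=> {u} [u /dG//|u w _ du _ dw x|u w _ du _ dw x].
  - exact: differentiableD.
  - exact: differentiableM.
apply: smooth_closed => // u i; elim=> {u} [u /pG//|u w Au IHu Aw IHw|u w Au IHu Aw IHw].
- rewrite partialD; [exact: fun_algebraD|exact: dA|exact: dA].
- rewrite partialM; [|exact: dA|exact: dA].
  by apply: fun_algebraD; exact: fun_algebraM.
Qed.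

Lemma smooth_fun_algebra u : fun_algebra smooth u -> smooth u.
Proof.
apply: smooth_algebra => [w sw x|w i sw]; first exact: smooth_differentiable.
by apply: fun_algebra_base; exact: smooth_partial.
Qed.

Lemma smoothD u w : smooth u -> smooth w -> smooth (u \+ w).
Proof.
by move=> su sw; apply/smooth_fun_algebra/fun_algebraD; exact: fun_algebra_base.
Qed.

Lemma smoothM u w : smooth u -> smooth w -> smooth (u \* w).
Proof.
by move=> su sw; apply/smooth_fun_algebra/fun_algebraM; exact: fun_algebra_base.
Qed.

Lemma partial_cst i (c : R) : partial i (cst c : 'rV[R]_n -> R) = cst 0.
Proof. by apply/funext => x; exact: derive_cst. Qed.

Lemma smooth_cst (c : R) : smooth (cst c : 'rV[R]_n -> R).
Proof.
apply: (@smooth_closed (fun u => exists c, u = cst c)); last by exists c.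
- by move=> u [d ->] x; exact: differentiable_cst.
- by move=> u i [d ->]; exists 0; exact: partial_cst.
Qed.

Lemma smoothZ (c : R) u : smooth u -> smooth (fun x => c * u x).
Proof. by move=> su; exact: (smoothM (smooth_cst c) su). Qed.

Lemma smoothN u : smooth u -> smooth (\- u).
Proof.
move=> su; rewrite (_ : \- u = fun x => -1 * u x); first exact: smoothZ.
by apply/funext => x; rewrite mulN1r.
Qed.

Lemma smoothB u w : smooth u -> smooth w -> smooth (u \- w).
Proof. by move=> su sw; apply: smoothD => //; exact: smoothN. Qed.

Lemma partial_coord i k (x : 'rV[R]_n) :
  partial i (fun y : 'rV[R]_n => y ord0 k) x = (i == k)%:R.
Proof.
have d := differentiable_coord x ord0 k.
rewrite /partial /derive.
apply: cvg_lim => //; apply: cvg_near_cst.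
near=> h; have h0 : h != 0 by near: h; exact: nbhs_dnbhs_neq.
by rewrite /= !mxE eqxx /= addrK /GRing.scale/= mulrA mulVf// mul1r eq_sym.
Unshelve. all: by end_near. Qed.

Lemma smooth_coord k : smooth (fun x : 'rV[R]_n => x ord0 k).
Proof.
apply: (@smooth_closed (fun u => u = (fun x : 'rV[R]_n => x ord0 k) \/ exists c, u = cst c)).
- move=> u [-> x|[d ->] x]; last exact: differentiable_cst.
  exact: differentiable_coord.
- move=> u i [->|[d ->]]; right.
    by exists (i == k)%:R; apply/funext => x; exact: partial_coord.
  by exists 0; exact: partial_cst.
- by left.
Qed.

Lemma smooth_sum (I : Type) (s : seq I) (u : I -> 'rV[R]_n -> R) :
  (forall i, smooth (u i)) -> smooth (fun x => \sum_(i <- s) u i x).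
Proof.
move=> su; elim: s => [|i s IH].
  rewrite (_ : (fun x => _) = cst 0); first exact: smooth_cst.
  by apply/funext => x; rewrite big_nil.
rewrite (_ : (fun x => _) = u i \+ (fun x => \sum_(j <- s) u j x)).
  exact: smoothD.
by apply/funext => x; rewrite big_cons.
Qed.

Lemma smooth_prod (I : Type) (s : seq I) (u : I -> 'rV[R]_n -> R) :
  (forall i, smooth (u i)) -> smooth (fun x => \prod_(i <- s) u i x).
Proof.
move=> su; elim: s => [|i s IH].
  rewrite (_ : (fun x => _) = cst 1); first exact: smooth_cst.
  by apply/funext => x; rewrite big_nil.
rewrite (_ : (fun x => _) = u i \* (fun x => \prod_(j <- s) u j x)).
  exact: smoothM.
by apply/funext => x; rewrite big_cons.
Qed.

Lemma derive_comp1 (f : R -> R) (df : R) u (x v : 'rV[R]_n) : differentiable u x ->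
  is_derive (u x) (1 : R) f df ->
  differentiable (f \o u) x /\ 'D_v (f \o u) x = df * 'D_v u x.
Proof.
move=> du [d1 d2].
have d1' : differentiable f (u x) by apply/derivable1_diffP.
have dc : differentiable (f \o u) x by exact: differentiable_comp.
split=> //; rewrite !deriveE// diff_comp//= deriv1E// derive1E d2.
by rewrite /GRing.scale/= mulrC.
Qed.

(** For families of functions of one variable whose derivatives are combinations of two members of
    the family, such as the real powers and [flat]. The derivative formula is required only on a set
    D containing the values of u, which admits powers of positive functions. *)
Lemma smooth_comp (I : Type) (F : I -> R -> R) (D : set R) (c d : I -> R)
    (j k : I -> I) u :
  (forall i t, D t ->
    is_derive t (1 : R) (F i) (c i * F (j i) t + d i * F (k i) t)) ->
  smooth u -> (forall x, D (u x)) -> forall i, smooth (F i \o u).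
Proof.
move=> dF su Du i0.
pose G w := smooth w \/ exists i, w = F i \o u.
have du x : differentiable u x by exact: smooth_differentiable.
have Gc c' : fun_algebra G (cst c').
  by apply: fun_algebra_base; left; exact: smooth_cst.
have GF i : fun_algebra G (F i \o u) by apply: fun_algebra_base; right; exists i.
apply: (@smooth_algebra G); last exact: GF.
- move=> w [sw x|[i -> x]]; first exact: smooth_differentiable.
  by have [] := derive_comp1 0 (du x) (dF i _ (Du x)).
- move=> w l [sw|[i ->]].
    by apply: fun_algebra_base; left; exact: smooth_partial.
  rewrite (_ : partial l _ = (((cst (c i) \* (F (j i) \o u)) \+
      (cst (d i) \* (F (k i) \o u))) \* partial l u)).
    apply: fun_algebraM; last by apply: fun_algebra_base; left; exact: smooth_partial.
    by apply: fun_algebraD; apply: fun_algebraM.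
  apply/funext => x; rewrite /partial.
  by have [_ ->] := derive_comp1 (delta_mx ord0 l) (du x) (dF i _ (Du x)).
Qed.

Lemma smooth_powR (b : R) u : smooth u -> (forall x, 0 < u x) ->
  smooth (fun x => u x `^ b).
Proof.
move=> su u0; apply: (@smooth_comp R (fun b t => t `^ b) [set t | 0 < t] id (cst 0)
  (fun b => b - 1) id _ _ su u0) => b' t t0.
by rewrite mul0r addr0; exact: is_derive_powR.
Qed.

End smooth_functions.

(** * Flat functions *)

Section flat_functions.
Context {R : realType}.

(* The family closed under differentiation that contains exp(-1/t). *)
Definition flat (m : nat) (t : R) : R :=
  if 0 < t then t `^ (- m%:R) * expR (- (t `^ (-1))) else 0.

Lemma flat_le0 m t : t <= 0 -> flat m t = 0.
Proof. by move=> t0; rewrite /flat ltNge t0. Qed.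

Lemma flat_gt0 m t : 0 < t -> 0 < flat m t.
Proof. by move=> t0; rewrite /flat t0 mulr_gt0 ?powR_gt0 ?expR_gt0. Qed.

Lemma flat_ge0 m t : 0 <= flat m t.
Proof. by have [/flat_le0->//|/(flat_gt0 m)/ltW] := leP t 0. Qed.

(** From (x / k)^k <= exp x with x = 1 / t and k = m + 2: two powers more than t^(-m), so that t^2
    is left over. *)
Lemma flat_bound m t : `|flat m t| <= m.+2%:R ^+ m.+2 * t ^+ 2.
Proof.
rewrite ger0_norm ?flat_ge0//.
have [/flat_le0->|t0] := leP t 0; first by apply: mulr_ge0; [exact: exprn_ge0|exact: sqr_ge0].
have K0 : 0 < m.+2%:R :> R by rewrite ltr0n.
rewrite /flat t0 powR_inv1 ?(ltW t0)// powR_invn ?(ltW t0)//.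
have ti0 : 0 <= t^-1 by rewrite invr_ge0 ltW.
have h : (t^-1 / m.+2%:R) ^+ m.+2 <= expR t^-1.
  have e : t^-1 = m.+2%:R * (t^-1 / m.+2%:R).
    by rewrite mulrC divfK// gt_eqF.
  rewrite [X in _ <= expR X]e expRM_natl.
  apply: lerXn2r; rewrite ?nnegrE ?expR_ge0 ?divr_ge0//.
  by apply: le_trans (expR_ge1Dx _); rewrite lerDr.
rewrite expRN -(ler_pM2r (expR_gt0 t^-1)) -mulrA mulVf ?mulr1 ?gt_eqF ?expR_gt0//.
apply: le_trans (ler_wpM2l _ h); last by apply: mulr_ge0; [exact: exprn_ge0|exact: sqr_ge0].
rewrite exprMn !exprVn le_eqVlt; apply/orP; left; apply/eqP.
rewrite !exprS; field.
have tn : t != 0 by rewrite gt_eqF.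
have K2 : 2 + m%:R != 0 :> R by rewrite -natrD pnatr_eq0.
by rewrite K2 tn !expf_neq0// gt_eqF.
Qed.

(** The product rule for t > 0, a locally constant function for t < 0, and at 0 a difference
    quotient of order |h| by [flat_bound]. The coefficient 1 is written out to match
    [smooth_comp]. *)
Lemma is_derive_flat m t :
  is_derive t (1 : R) (flat m) (- m%:R * flat m.+1 t + 1 * flat m.+2 t).
Proof.
rewrite mul1r; case: (ltgtP t 0) => [t0|t0|->].
- rewrite !flat_le0 ?ltW// mulr0 addr0.
  apply: (@near_eq_is_derive _ _ _ (cst 0)).
    near=> s; rewrite flat_le0// ltW//; near: s; exact: lt_nbhsl.
- apply: (@near_eq_is_derive _ _ _ (fun s => s `^ (- m%:R) * expR (- (s `^ (-1))))).
    near=> s; rewrite /flat ifT//; near: s; exact: lt_nbhsr.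
  have H1 := is_derive_powR (- m%:R) t0.
  have H2 := is_deriveN (is_derive_powR (-1) t0).
  have H3 := @is_derive1_comp _ (@expR R) _ t _ _ (is_derive_expR _) H2.
  apply: is_derive_eq (is_deriveM H1 H3) _; rewrite /GRing.scale/= /flat t0.
  have e1 : t `^ (- m.+1%:R) = t `^ (- m%:R - 1) by rewrite -opprD natr1.
  have e2 : t `^ (- m.+2%:R) = t `^ (- m%:R) * t `^ (-1 - 1).
    rewrite -powRD; last by apply/implyP => _; rewrite gt_eqF.
    by congr powR; rewrite -addn2 natrD; ring.
  by rewrite e1 e2; ring.
- rewrite !flat_le0// mulr0 addr0.
  have N0 : `|h| @[h --> (0 : R)^'] --> (0 : R).
    rewrite -[X in _ --> X](@normr0 _ R).
    apply: cvg_norm; exact: nbhs_dnbhs.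
  have H : (fun h : R => h^-1 *: ((flat m \o shift 0) (h *: (1 : R)) - flat m 0)) @ 0^' --> (0 : R).
    apply: (@squeeze_cvgr _ _ _ _ (fun h => - (m.+2%:R ^+ m.+2 * `|h|)) (fun h => m.+2%:R ^+ m.+2 * `|h|)).
    - near=> h; rewrite -ler_norml /= (flat_le0 m (lexx 0)) subr0 addr0 /GRing.scale/= mulr1.
      have h0 : h != 0 by near: h; exact: nbhs_dnbhs_neq.
      rewrite normrM normfV ler_pdivrMl ?normr_gt0//.
      apply: le_trans (flat_bound _ _) _.
      by rewrite -(real_normK (num_real h)) expr2; lra.
    - rewrite -[X in _ --> X]oppr0; apply: cvgN.
      by rewrite -[X in _ --> X](mulr0 (m.+2%:R ^+ m.+2)); apply: cvgMr.
    - by rewrite -[X in _ --> X](mulr0 (m.+2%:R ^+ m.+2)); apply: cvgMr.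
  split; first exact: cvgP H.
  exact: cvg_lim H.
Unshelve. all: by end_near. Qed.

Lemma smooth_flat {n} m (u : 'rV[R]_n -> R) : smooth u -> smooth (flat m \o u).
Proof.
move=> su; apply: (@smooth_comp _ _ nat flat setT (fun m => - m%:R) (cst 1) S (fun m => m.+2)) => //.
by move=> i t _; exact: is_derive_flat.
Qed.

Lemma flat0_le1 t : flat 0 t <= 1.
Proof.
have [/flat_le0->//|t0] := leP t 0.
by rewrite /flat t0 oppr0 powRr0 mul1r -expR0 ler_expR oppr_le0 powR_ge0.
Qed.

Lemma cvg_flat0 (s : R) : 0 < s -> flat 0 (k.+1%:R * s) @[k --> \oo] --> (1 : R).
Proof.
move=> s0.
rewrite (_ : (fun k => _) = fun k : nat => expR (- (s^-1 * k.+1%:R^-1))); last first.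
  apply/funext => k; rewrite /flat mulr_gt0// oppr0 powRr0 mul1r powR_inv1 ?mulr_ge0 ?(ltW s0)//.
  by rewrite invfM mulrC.
rewrite -[X in _ --> X]expR0; apply: continuous_cvg; first exact: continuous_expR.
rewrite -[X in _ --> X]oppr0; apply: cvgN; rewrite -[X in _ --> X](mulr0 s^-1); apply: cvgMr.
exact: (@cvg_harmonic R).
Qed.

End flat_functions.

(** * Boxes and the fundamental lemma of the calculus of variations *)

Section boxes.
Context {R : realType} {n : nat}.
Local Notation mu := (@lebesgue_row R n).
Implicit Types (a b c d x : 'rV[R]_n).

Definition obox a b : set 'rV[R]_n :=
  [set x | forall i, x ord0 i \in `]a ord0 i, b ord0 i[].

Lemma measurable_obox a b : measurable (obox a b).
Proof.
rewrite (_ : obox a b =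
    \bigcap_(i in [set: 'I_n]) (row_coord i @^-1` `]a ord0 i, b ord0 i[)).
  apply: fin_bigcap_measurable; first exact: finite_finset.
  move=> i _; rewrite -[X in measurable X]setTI.
  exact: measurable_row_coord.
by apply/seteqP; split => x /= H i => [_|]; exact: H.
Qed.

Lemma obox_sub a b : obox a b `<=` row_box a b.
Proof. by move=> x /= H i; move: (H i); exact: subset_itv_oo_cc. Qed.

Lemma compact_row_box a b : compact (row_box a b).
Proof.
rewrite (_ : row_box a b = [set x | forall i, `[a ord0 i, b ord0 i]%classic (x ord0 i)]).
  by apply: (@rV_compact _ _ (fun i => `[a ord0 i, b ord0 i]%classic)) => i; exact: segment_compact.
by apply/seteqP; split => x /= H i; exact: H.
Qed.

Lemma oboxI a b c d : obox a b `&` obox c d =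
  obox (\row_i Num.max (a ord0 i) (c ord0 i)) (\row_i Num.min (b ord0 i) (d ord0 i)).
Proof.
apply/seteqP; split => [x [H1 H2] i|x H]; rewrite /obox/=.
  rewrite !mxE; have := H1 i; have := H2 i; rewrite !in_itv/= => /andP[? ?] /andP[? ?].
  by rewrite gt_max lt_min; apply/andP; split; apply/andP.
by split => i; have := H i; rewrite !mxE !in_itv/= gt_max lt_min
  => /andP[/andP[h1 h2] /andP[h3 h4]]; apply/andP.
Qed.

Definition oboxes : set (set 'rV[R]_n) := [set A | exists a b, A = obox a b].

(** It suffices to treat the coordinate preimage of an open interval; this slab is the union of the
    boxes whose other sides are ]-k, k[. *)
Lemma measurable_oboxes (A : set 'rV[R]_n) : measurable A -> <<s oboxes >> A.
Proof.
move=> mA.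
pose T := g_sigma_algebraType oboxes.
have mid : measurable_fun [set: T] (id : T -> 'rV[R]_n).
  apply: measurable_fun_rowP => i.
  apply: (measurability _ (RGenOpens.measurableE R)).
  move=> _ [_ [a [b ->] <-]]; rewrite setTI.
  rewrite (_ : _ @^-1` _ = \bigcup_k obox
     (\row_j if j == i then a else - k%:R) (\row_j if j == i then b else k%:R)).
    apply: bigcupT_measurable => k; apply: sub_sigma_algebra.
    by exists (\row_j if j == i then a else - k%:R), (\row_j if j == i then b else k%:R).
  apply/seteqP; split => [x /= xab|x [k _ /(_ i)]]; last by rewrite !mxE eqxx.
  near \oo => k; exists k => // j; rewrite !mxE; case: eqP => [->//|_].
  rewrite in_itv/= -ltr_norml; apply: le_lt_trans (coord_le_norm _ _) _.
  near: k; exact: nbhs_infty_gtr.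
by have := mid measurableT A mA; rewrite setTI.
Unshelve. all: by end_near. Qed.

(** Dynkin's argument: the sets whose trace on the box has zero integral form a Dynkin system, and
    open boxes are stable under intersection. Working with traces keeps every integral finite. *)
Lemma integral_obox_eq0 a b (g : 'rV[R]_n -> \bar R) :
  mu.-integrable (obox a b) g ->
  (forall c d, obox c d `<=` obox a b -> \int[mu]_(x in obox c d) g x = 0)%E ->
  forall A, measurable A -> (\int[mu]_(x in A `&` obox a b) g x = 0)%E.
Proof.
move=> ig g0 A mA.
pose Q := obox a b; have mQ : measurable Q by exact: measurable_obox.
pose D : set (set 'rV[R]_n) :=
  [set A | measurable A /\ (\int[mu]_(x in A `&` Q) g x = 0)%E].
have GI : setI_closed oboxes.
  by move=> _ _ [c1 [d1 ->]] [c2 [d2 ->]]; rewrite oboxI; do 2 eexists.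
suff DD : dynkin D.
  have : <<d oboxes >> A.
    by rewrite setI_closed_g_dynkin_g_sigma_algebra//; exact: measurable_oboxes.
  move=> /(_ D); case=> //; split => // _ [c [d ->]]; split.
    exact: measurable_obox.
  by rewrite /Q oboxI; apply: g0; rewrite -oboxI; exact: subIsetr.
split.
- by split; [exact: measurableT|rewrite setTI; exact: g0].
- move=> B [mB B0]; split; first exact: measurableC.
  have : (\int[mu]_(x in Q) g x = 0)%E by exact: g0.
  have mBQ : measurable (B `&` Q) by exact: measurableI.
  have mCQ : measurable (~` B `&` Q) by apply: measurableI => //; exact: measurableC.
  rewrite -[in X in X -> _](setTI Q) -(setUv B) setIUl integral_setU//=.
  + by rewrite B0 add0e.
  + by apply: measurable_funS mQ _ (measurable_int _ ig) => ? [[]|[]].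
  + by apply/disj_setPS => x [[Bx _] [nBx _]]; exact: nBx.
- move=> F tF DF; split; first by apply: bigcupT_measurable => k; have [] := DF k.
  rewrite setI_bigcupl integral_bigcup.
  + by apply: eseries0 => k _ _; have [] := DF k.
  + exact: trivIset_setIr.
  + by move=> k; apply: measurableI => //; have [] := DF k.
  + apply: (integrableS mQ) ig => //; last by move=> ? [? _ []].
    by apply: bigcupT_measurable => k; apply: measurableI => //; have [] := DF k.
Qed.

Lemma obox_ae_eq0 a b (g : 'rV[R]_n -> \bar R) :
  mu.-integrable (obox a b) g ->
  (forall c d, obox c d `<=` obox a b -> \int[mu]_(x in obox c d) g x = 0)%E ->
  ae_eq mu (obox a b) g (cst 0%E).
Proof.
move=> ig g0; apply: integral_ae_eq => //; first exact: measurable_obox.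
move=> E Eab mE; rewrite integral0.
by have := integral_obox_eq0 ig g0 mE; rewrite (setIidl Eab).
Qed.

(** Smooth substitutes for the indicator of the open box: for large k a factor
    [flat 0 (k.+1%:R * s)] is close to 1 if s > 0, and it is 0 if s <= 0. *)
Definition box_bump a b (k : nat) (x : 'rV[R]_n) : R :=
  \prod_(i < n) (flat 0 (k.+1%:R * (x ord0 i - a ord0 i)) *
                 flat 0 (k.+1%:R * (b ord0 i - x ord0 i))).

Lemma smooth_box_bump a b k : smooth (box_bump a b k).
Proof.
apply: smooth_prod => i; apply: smoothM.
  apply: (@smooth_flat _ _ 0 (fun x : 'rV[R]_n => k.+1%:R * (x ord0 i - a ord0 i))).
  by apply: smoothZ; apply: smoothB; [exact: smooth_coord|exact: smooth_cst].
apply: (@smooth_flat _ _ 0 (fun x : 'rV[R]_n => k.+1%:R * (b ord0 i - x ord0 i))).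
by apply: smoothZ; apply: smoothB; [exact: smooth_cst|exact: smooth_coord].
Qed.

Lemma box_bump_out a b k x : ~ obox a b x -> box_bump a b k x = 0.
Proof.
move=> /existsNP[i]; rewrite in_itv/= => /negP; rewrite negb_and -!leNgt => H.
rewrite /box_bump (bigD1 i)//=.
have k0 : 0 <= k.+1%:R :> R by [].
case/orP: H => H.
  by rewrite (@flat_le0 _ 0 (_ * (x ord0 i - _))) ?mul0r// mulr_ge0_le0// subr_le0.
by rewrite (@flat_le0 _ 0 (_ * (b ord0 i - _))) ?mulr0 ?mul0r// mulr_ge0_le0// subr_le0.
Qed.

Lemma box_bump01 a b k x : 0 <= box_bump a b k x <= 1.
Proof.
apply/andP; split; first by apply: prodr_ge0 => i _; rewrite mulr_ge0 ?flat_ge0.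
apply: prodr_ile1 => i _; rewrite mulr_ge0 ?flat_ge0//=.
by rewrite mulr_ile1 ?flat_ge0 ?flat0_le1.
Qed.

Lemma cvg_box_bump a b x : box_bump a b k x @[k --> \oo] --> (\1_(obox a b) x : R).
Proof.
have [xab|xab] := pselect (obox a b x); last first.
  rewrite indicE memNset//; under eq_cvg do rewrite box_bump_out//.
  exact: cvg_cst.
rewrite indicE mem_set// [X in _ --> X](_ : _ = \prod_(i < n) (1 : R)); last by rewrite big1.
apply: cvg_big => [|i _]; first exact: mul_continuous.
rewrite -[X in _ --> X]mulr1.
have := xab i; rewrite in_itv/= => /andP[h1 h2].
by apply: cvgM; apply: cvg_flat0; rewrite subr_gt0.
Qed.

Lemma test_box_bump (Om : set 'rV[R]_n) a b c d k :
  row_box a b `<=` Om -> obox c d `<=` obox a b ->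
  test_function Om (box_bump c d k).
Proof.
move=> abO cd; split; first exact: smooth_box_bump.
exists (row_box a b); first by split => //; exact: compact_row_box.
move=> x xab; apply: box_bump_out => xcd; apply: xab.
by apply: obox_sub; exact: cd.
Qed.

(** Testing against bumps and passing to the limit by dominated convergence, g has zero integral on
    the small boxes inside any closed box contained in Om, hence vanishes almost everywhere in that
    box. Countably many rational cubes cover Om. *)
Lemma fundamental_lemma (Om : set 'rV[R]_n) (g : 'rV[R]_n -> R) : open Om ->
  Defs.locally_integrable Om g ->
  (forall phi, test_function Om phi -> \int[mu]_(x in Om) (g x * phi x)%:E = 0)%E ->
  {ae mu, forall x, Om x -> g x = 0}.
Proof.
move=> oOm [mg lg] g0.
have mOm : measurable Om by exact: open_row_measurable.
have box0 a b : row_box a b `<=` Om -> ae_eq mu (obox a b) (EFin \o g) (cst 0%E).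
  move=> abO.
  have ioR : mu.-integrable (row_box a b) (EFin \o g).
    by apply: lg => //; exact: compact_row_box.
  have abO' : obox a b `<=` Om by apply: subset_trans abO; exact: obox_sub.
  have io : mu.-integrable (obox a b) (EFin \o g).
    apply: (integrableS _ _ _ ioR); [exact: measurable_row_box|exact: measurable_obox|exact: obox_sub].
  apply: obox_ae_eq0 => // c d cd.
  have cdO : obox c d `<=` Om by exact: subset_trans abO'.
  have iocd : mu.-integrable (obox c d) (EFin \o g).
    by apply: (integrableS _ _ cd io); exact: measurable_obox.
  have ig : mu.-integrable Om (fun x => (`|g x| * \1_(obox c d) x)%:E).
    have := integrable_abse iocd => /integrable_mkcond.
    move=> /(_ (measurable_obox _ _)); rewrite epatch_indic => /integrableS; apply => //.
  have mgb k : measurable_fun Om (fun x => (g x * box_bump c d k x)%:E).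
    apply/measurable_EFinP; apply: measurable_realfun.measurable_funM => //.
    apply: measurable_funTS; apply: continuous_row_measurable.
    apply: smooth_continuous; exact: smooth_box_bump.
  have mgi : measurable_fun Om (fun x => (g x * \1_(obox c d) x)%:E).
    apply/measurable_EFinP; apply: measurable_realfun.measurable_funM => //.
    by apply: measurable_indic; exact: measurable_obox.
  have ff : {ae mu, forall x, Om x -> (g x * box_bump c d k x)%:E @[k --> \oo] -->
      (g x * \1_(obox c d) x)%:E}.
    apply: aeW => x Ox; apply/fine_cvgP; split; first exact: nearW.
    by apply: cvgMr; exact: cvg_box_bump.
  have fg : {ae mu, forall x k, Om x -> `|(g x * box_bump c d k x)%:E| <=
      (`|g x| * \1_(obox c d) x)%:E}%E.
    apply: aeW => x k Ox; rewrite /= lee_fin normrM ler_wpM2l//.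
    have /andP[b0 b1] := box_bump01 c d k x; rewrite ger0_norm//.
    have [xcd|xcd] := pselect (obox c d x); first by rewrite indicE mem_set.
    by rewrite box_bump_out// indicE memNset.
  have [_ _ H] := dominated_convergence mOm mgb mgi ff ig fg.
  have l0 : (\int[mu]_(x in Om) (g x * \1_(obox c d) x)%:E = 0)%E.
    rewrite -(cvg_lim _ H)//; apply: cvg_lim => //.
    rewrite [X in X @ _ --> _](_ : _ = cst 0%E); first exact: cvg_cst.
    apply/funext => k /=; apply: g0; exact: test_box_bump abO cd.
  transitivity (\int[mu]_(x in Om `&` obox c d) (EFin \o g) x)%E.
    by rewrite (setIidr cdO).
  rewrite -l0 integral_mkcondr epatch_indic.
  by apply: eq_integral => x _; rewrite /= EFinM.
have aux1 (s e y : R) : `|s - y| < e -> s - e < y < s + e.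
  by rewrite ltr_norml => /andP[h1 h2]; apply/andP; split; lra.
have aux2 (s e y : R) : s - e <= y <= s + e -> `|s - y| <= e.
  by move=> /andP[h1 h2]; rewrite ler_norml; apply/andP; split; lra.
pose Q := ('rV[rat]_n * nat)%type.
pose A (q : Q) : 'rV[R]_n := \row_i (ratr (q.1 ord0 i) - q.2.+1%:R^-1).
pose B (q : Q) : 'rV[R]_n := \row_i (ratr (q.1 ord0 i) + q.2.+1%:R^-1).
(* The exceptional points of the open cube when the closed cube lies in Om; the other cubes
   contribute nothing. *)
pose Z (q : Q) : set 'rV[R]_n :=
  if `[< row_box (A q) (B q) `<=` Om >] then [set x | obox (A q) (B q) x /\ g x <> 0] else set0.
pose F (k : nat) := if (unpickle k : option Q) is Some q then Z q else set0.
have Z0 q : mu.-negligible (Z q).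
  rewrite /Z; case: asboolP => [/box0|_]; last exact: negligible_set0.
  apply: negligibleS => x /= [xq gx] /(_ xq) [].
  exact: gx.
apply: (negligibleS _ (negligible_bigcup (fun k => _ : mu.-negligible (F k)))) => [x /= H|]; last first.
  by move=> k; rewrite /F; case: unpickle => [q|]; [exact: Z0|exact: negligible_set0].
have [Ox gx] : Om x /\ g x <> 0 by exact/not_implyP.
have [q xq qO] := open_row_rational_box oOm Ox.
exists (pickle (q : Q)) => //; rewrite /F pickleK /Z asboolT.
  by split=> // i; rewrite in_itv/= !mxE; exact/aux1/xq.
move=> y yq; apply: qO => i; have := yq i; rewrite in_itv/= !mxE; exact: aux2.
Qed.

End boxes.

(** * Integration of compactly supported functions *)

Section compactly_supported.
Context {R : realType} {n : nat}.
Local Notation mu := (@lebesgue_row R n).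
Implicit Types (f w : 'rV[R]_n -> R) (K : set 'rV[R]_n).

Lemma integral_translation (a : 'rV[R]_n) (f : 'rV[R]_n -> \bar R) :
  measurable_fun setT f -> (\int[mu]_x f (a + x)%R = \int[mu]_x f x)%E.
Proof.
move=> mf; rewrite integralE [RHS]integralE; congr (_ - _)%E.
  rewrite -(ge0_integral_translation a (measurable_funepos mf) (fun x => funepos_ge0 f x)).
  by apply: eq_integral => x _; rewrite !funeposE.
rewrite -(ge0_integral_translation a (measurable_funeneg mf) (fun x => funeneg_ge0 f x)).
by apply: eq_integral => x _; rewrite !funenegE.
Qed.

Lemma compact_enorm_le K : compact K ->
  exists2 M : R, 0 < M & forall x, K x -> enorm x <= M.
Proof.
move=> /compact_bounded[M [_ HM]].
exists (n%:R * (`|M| + 1) + 1).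
  by rewrite ltr_wpDl// mulr_ge0// addr_ge0.
move=> x Kx; apply: le_trans (enorm_le_norm _) _.
apply: (@le_trans _ _ (n%:R * (`|M| + 1))); last by rewrite lerDl.
by rewrite ler_wpM2l// HM// ltr_pwDr// ler_norm.
Qed.

Lemma cc_bounded f K : continuous f -> compact K -> (forall x, ~ K x -> f x = 0) ->
  exists2 M : R, 0 < M & forall x, `|f x| <= M.
Proof.
move=> cf cK f0.
have : compact (f @` K) by apply: continuous_compact => //; exact: continuous_subspaceT.
move=> /compact_bounded[M [_ HM]]; exists (`|M| + 1); first by rewrite ltr_wpDl.
move=> x; have [Kx|Kx] := pselect (K x); last by rewrite f0// normr0 addr_ge0.
by apply: HM; [rewrite ltr_pwDr// ler_norm|exists x].
Qed.

Lemma compact_lty K : compact K -> (mu K < +oo)%E.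
Proof.
move=> cK; have [M M0 HM] := compact_enorm_le cK.
apply: le_lt_trans (lebesgue_row_eball_lty (M + 1)); apply: le_measure.
- by rewrite inE; exact: compact_row_measurable.
- by rewrite inE; exact: measurable_eball.
by move=> x Kx; rewrite /eball/=; apply: le_lt_trans (HM _ Kx) _; rewrite ltrDl.
Qed.

Lemma cc_integrable f K : continuous f -> compact K -> (forall x, ~ K x -> f x = 0) ->
  mu.-integrable setT (EFin \o f).
Proof.
move=> cf cK f0.
have mK := compact_row_measurable cK.
have [M M0 HM] := cc_bounded cf cK f0.
have : mu.-integrable K (EFin \o f).
  apply: measurable_bounded_integrable => //; first exact: compact_lty.
    by apply: measurable_funTS; exact: continuous_row_measurable.
  by exists M; split; [exact: num_real|move=> x Mx y Ky; exact: le_trans (HM y) (ltW Mx)].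
move=> /(integrable_mkcond _ mK); apply: eq_integrable => // x _.
by rewrite patchE; case: ifPn => // /negP; rewrite inE => Kx; rewrite /= f0.
Qed.

Lemma partial_out i w K x : closed K -> (forall y, ~ K y -> w y = 0) -> ~ K x ->
  partial i w x = 0.
Proof.
move=> cK w0 Kx; rewrite /partial -(derive_cst (0 : R) x (delta_mx ord0 i)).
apply: near_eq_derive; near=> y; apply: w0; near: y.
by have /open_nbhs_nbhs : open_nbhs x (~` K) by split => //; rewrite openC.
Unshelve. all: by end_near. Qed.

(** Dominated convergence is sequential, so derivatives are taken along the steps 1/(k + 1), which
    avoid 0. *)
Lemma harmonic_dnbhs : (@harmonic R) @ \oo --> (0 : R)^'.
Proof.
move=> A /= HA; have := @cvg_harmonic R _ HA.
by rewrite /nbhs/=; apply: filterS => k /=; apply; rewrite /harmonic invr_neq0.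
Qed.

Lemma dot_delta i (v : 'rV[R]_n) : dot (delta_mx ord0 i) v = v ord0 i.
Proof.
rewrite /dot (bigD1 i)//= big1 => [|j ji]; first by rewrite mxE !eqxx mul1r addr0.
by rewrite mxE eqxx/= (negbTE ji) mul0r.
Qed.

(* Difference quotients have zero integral by translation invariance. *)
Lemma integral_partial_eq0 i w K : (forall x, differentiable w x) ->
  continuous (partial i w) -> compact K -> (forall x, ~ K x -> w x = 0) ->
  (\int[mu]_x (partial i w x)%:E = 0)%E.
Proof.
move=> dw cpw cK w0.
have hK : closed K by apply: compact_closed cK; exact: norm_hausdorff.
pose e : 'rV[R]_n := delta_mx ord0 i.
have ee : enorm e = 1.
  apply/eqP; rewrite -(@eqrXn2 _ 2)// ?enorm_ge0// enorm_sqr expr1n.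
  by rewrite (bigD1 i)//= big1 => [|j ji]; rewrite mxE eqxx/= ?eqxx ?expr1n ?addr0// (negbTE ji) expr0n.
have cw : continuous w by move=> x; exact: differentiable_continuous.
have [M M0 HM] := compact_enorm_le cK.
have pw0 x : ~ K x -> partial i w x = 0 by exact: partial_out.
have [C C0 HC] := cc_bounded cpw cK pw0.
pose h (k : nat) : R := harmonic k.
have h0 k : 0 < h k by rewrite /h /harmonic invr_gt0.
have h1 k : h k <= 1 by rewrite /h /harmonic invf_le1// ler1n.
pose D k x := (h k)^-1 * (w (h k *: e + x) - w x).
(* The steps are at most 1, so this ball contains the supports of w and of all the translates used;
   on it the mean value theorem bounds the difference quotients by C. *)
pose T : set 'rV[R]_n := [set x | enorm x <= M + 1].
have mT : measurable T by apply: closed_row_measurable; exact: closed_cball.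
have D_le k x : `|D k x| <= C * \1_T x.
  have [xT|xT] := pselect (T x); last first.
    have e1 : w x = 0.
      apply: w0 => Kx; apply: xT; rewrite /T/=; apply: le_trans (HM _ Kx) _.
      by rewrite lerDl.
    have e2 : w (h k *: e + x) = 0.
      apply: w0 => /HM Kx; apply: xT; rewrite /T/=.
      have := enormB x (- (h k *: e)); rewrite opprK enormN enormZ ee mulr1 gtr0_norm// (addrC x).
      move: (h1 k) Kx; lra.
    by rewrite /D e1 e2 subrr mulr0 normr0 mulr_ge0// ltW.
  rewrite indicE mem_set// mulr1 /D normrM gtr0_norm ?invr_gt0// ler_pdivrMl//.
  pose f (t : R) := w (x + t *: e).
  have df t : is_derive t (1 : R) f (partial i w (x + t *: e)).
    have := @is_derive_line R n w x e t (dw _).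
    by rewrite dot_delta mxE.
  have [c _] := @MVT R f _ 0 (h k) (h0 k) (fun t _ => df t) (continuous_subspaceT
    (fun t => differentiable_continuous (iffLR (derivable1_diffP f t) (@ex_derive _ _ _ _ _ _ _ (df t))))).
  rewrite subr0 /f scale0r addr0 (addrC (h k *: e)) => ->.
  by rewrite normrM mulrC gtr0_norm// ler_pM2l.
have wi : mu.-integrable setT (EFin \o w) by exact: cc_integrable cK w0.
have mw : measurable_fun setT w by exact: continuous_row_measurable.
have mwt k : measurable_fun setT (fun x : 'rV[R]_n => w (h k *: e + x)).
  rewrite (_ : (fun x => _) = w \o (fun x => h k *: e + 1 *: x)).
    exact: measurableT_comp mw (measurable_row_affine _ _).
  by apply/funext => x /=; rewrite scale1r.
have wti k : mu.-integrable setT (fun x => (w (h k *: e + x))%:E).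
  apply/integrableP; split; first exact/measurable_EFinP.
  have /integrableP[_] := wi.
  rewrite -(@integral_translation (h k *: e) (fun x => `|(w x)%:E|%E))//.
  by apply: measurableT_comp => //; exact/measurable_EFinP.
have ID k : (\int[mu]_x (D k x)%:E = 0)%E.
  transitivity (\int[mu]_x ((h k)^-1%:E * ((w (h k *: e + x))%:E - (w x)%:E)))%E.
    by apply: eq_integral => x _; rewrite -EFinB -EFinM.
  rewrite integralZl//; last exact: integrableB.
  rewrite integralB// (@integral_translation (h k *: e) (EFin \o w))//; last first.
    exact/measurable_EFinP.
  by rewrite subee ?mule0//; exact: integrable_fin_num.
have mD k : measurable_fun setT (fun x => (D k x)%:E).
  apply/measurable_EFinP; apply: measurable_realfun.measurable_funM => //.
  exact: measurable_realfun.measurable_funB.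
have mp : measurable_fun setT (fun x => (partial i w x)%:E).
  by apply/measurable_EFinP; exact: continuous_row_measurable.
have Ti : mu.-integrable setT (fun x => (C * \1_T x)%:E).
  rewrite (_ : (fun x => _) = (fun x => C%:E * (\1_T x)%:E)%E)//.
  apply: integrableZl => //; apply/integrableP; split.
    by apply/measurable_EFinP; exact: measurable_indic.
  under eq_integral do rewrite gee0_abs ?lee_fin//.
  by rewrite integral_indic// setIT; apply: compact_lty; exact: compact_cball.
have Dcv : {ae mu, forall x, setT x -> (D k x)%:E @[k --> \oo] --> (partial i w x)%:E}.
  apply: aeW => x _; apply/fine_cvgP; split; first exact: nearW.
  have dx : derivable w x e by exact: diff_derivable.
  exact: (cvg_comp _ _ harmonic_dnbhs dx).
have Dle : {ae mu, forall x k, setT x -> `|(D k x)%:E| <= (C * \1_T x)%:E}%E.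
  by apply: aeW => x k _; rewrite lee_fin.
have [_ _ H] := dominated_convergence measurableT mD mp Dcv Ti Dle.
rewrite -(cvg_lim _ H)//; apply: cvg_lim => //.
rewrite [X in X @ _ --> _](_ : _ = cst 0%E); first exact: cvg_cst.
by apply/funext => k /=.
Qed.

End compactly_supported.

(** * Weak gradients on an open set *)

Section weak_gradients.
Context {R : realType} {n : nat}.
Local Notation mu := (@lebesgue_row R n).
Variable Om : set 'rV[R]_n.
Hypothesis oOm : open Om.
Implicit Types (u w phi psi g : 'rV[R]_n -> R) (G H : 'rV[R]_n -> 'rV[R]_n).

Let mOm : measurable Om. Proof. exact: open_row_measurable. Qed.

Lemma test_continuous phi : test_function Om phi -> continuous phi.
Proof. by move=> [+ _]; exact: smooth_continuous. Qed.

Lemma test_out phi x : test_function Om phi -> ~ Om x -> phi x = 0.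
Proof. by move=> [_ [K [cK KO] +]] Ox; apply => /KO. Qed.

Lemma test_partial phi i : test_function Om phi -> test_function Om (partial i phi).
Proof.
move=> [sphi [K [cK KO] phi0]]; split; first exact: smooth_partial.
exists K => // x Kx; apply: partial_out phi0 Kx.
by apply: compact_closed cK; exact: norm_hausdorff.
Qed.

Lemma test_differentiable phi x : test_function Om phi -> differentiable phi x.
Proof. by move=> [+ _]; exact: smooth_differentiable. Qed.

Lemma testB phi psi : test_function Om phi -> test_function Om psi ->
  test_function Om (phi \- psi).
Proof.
move=> [s1 [K1 [cK1 K1O] h1]] [s2 [K2 [cK2 K2O] h2]].
split; first exact: smoothB.
exists (K1 `|` K2); first by split; [exact: compactU|move=> x []; [exact: K1O|exact: K2O]].
by move=> x /not_orP[Kx1 Kx2] /=; rewrite h1// h2// subrr.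
Qed.

Lemma testZ (c : R) phi : test_function Om phi -> test_function Om (fun x => c * phi x).
Proof.
move=> [s1 [K1 cK1 h1]]; split; first exact: smoothZ.
by exists K1 => // x Kx; rewrite h1// mulr0.
Qed.

Lemma locally_integrableMtest g phi : Defs.locally_integrable Om g ->
  test_function Om phi -> mu.-integrable Om (fun x => (g x * phi x)%:E).
Proof.
move=> [mg ig] [sphi [K [cK KO] phi0]].
have cphi := smooth_continuous sphi.
have mK := compact_row_measurable cK.
have [M M0 HM] := cc_bounded cphi cK phi0.
have iK : mu.-integrable K (fun x => (g x * phi x)%:E).
  have igK := ig K cK KO.
  have iM : mu.-integrable K (fun x => M%:E * (g x)%:E)%E by exact: integrableZl.
  apply: le_integrable iM => //.
    apply/measurable_EFinP; apply: measurable_realfun.measurable_funM.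
      exact: measurable_funS KO mg.
    by apply: measurable_funTS; exact: continuous_row_measurable.
  move=> x Kx; rewrite /= lee_fin !normrM mulrC (gtr0_norm M0).
  by rewrite ler_wpM2r.
move: iK; rewrite (integrable_mkcond _ mK) => iT.
have : mu.-integrable Om ((fun x => (g x * phi x)%:E) \_ K).
  exact: integrableS iT.
apply: eq_integrable => // x _; rewrite patchE; case: ifPn => // /negP.
by rewrite inE => Kx; rewrite phi0// mulr0.
Qed.

Lemma continuous_locally_integrable g : continuous g -> Defs.locally_integrable Om g.
Proof.
move=> cg; have mg := continuous_row_measurable cg.
split; first exact: measurable_funTS.
move=> K cK KO; apply: measurable_bounded_integrable.
- exact: compact_row_measurable.
- exact: compact_lty.
- exact: measurable_funTS.
have : compact (g @` K) by apply: continuous_compact => //; exact: continuous_subspaceT.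
move=> /compact_bounded[M [rM HM]]; exists M; split => // y My x Kx.
by apply: HM => //; exists x.
Qed.

(** [is_weak_gradient] is stated with real-valued integrals; for these integrable products nothing
    is lost in passing to extended values, where the convergence theorems are available. *)
Lemma RintegralE_loc g phi : Defs.locally_integrable Om g -> test_function Om phi ->
  ((\int[mu]_(x in Om) (g x * phi x))%:E = \int[mu]_(x in Om) (g x * phi x)%:E)%E.
Proof.
move=> lg tphi; rewrite /Rintegral fineK//; apply: integrable_fin_num => //.
exact: locally_integrableMtest.
Qed.

(** Integration by parts is [integral_partial_eq0] for the product phi psi, which has compact
    support. *)
Lemma test_weak_gradient phi : test_function Om phi -> is_weak_gradient Om phi (grad phi).
Proof.
move=> tphi i; have cphi := test_continuous tphi.
have lp : Defs.locally_integrable Om (fun x => grad phi x ord0 i).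
  rewrite (_ : (fun x => _) = partial i phi); last by apply/funext => x; rewrite mxE.
  by apply: continuous_locally_integrable; apply: test_continuous; exact: test_partial.
split=> // psi tpsi; apply/eqP; rewrite -addr_eq0 -eqe EFinD.
rewrite !RintegralE_loc//; last 2 first.
- exact: continuous_locally_integrable.
- exact: test_partial.
rewrite -integralD//; last 2 first.
- apply: locally_integrableMtest; first exact: continuous_locally_integrable.
  exact: test_partial.
- exact: locally_integrableMtest.
have [K [cK KO] psi0] := tpsi.2.
apply/eqP; transitivity (\int[mu]_x (partial i (phi \* psi) x)%:E)%E; last first.
  apply: (@integral_partial_eq0 R n i (phi \* psi) K) => //.
  - by move=> x; apply: differentiableM; exact: test_differentiable.
  - rewrite partialM; [|by move=> y; exact: test_differentiable..].
    move=> x; apply: continuousD; apply: continuousM.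
    + exact: cphi.
    + exact: (test_continuous (test_partial _ tpsi)).
    + exact: (test_continuous tpsi).
    + exact: (test_continuous (test_partial _ tphi)).
  - by move=> x Kx /=; rewrite psi0// mulr0.
rewrite integral_mkcond; apply: eq_integral => x _; rewrite patchE.
have pE : partial i (phi \* psi) x = phi x * partial i psi x + partial i phi x * psi x.
  rewrite partialM; [|by move=> y; exact: test_differentiable..].
  by rewrite /= [X in _ + X]mulrC.
rewrite pE; case: ifPn => [_|/negP]; first by rewrite mxE.
rewrite inE => Ox; rewrite (test_out tphi Ox) (test_out tpsi Ox).
by rewrite mul0r mulr0 addr0.
Qed.

Lemma locally_integrableD g h : Defs.locally_integrable Om g ->
  Defs.locally_integrable Om h -> Defs.locally_integrable Om (g \+ h).
Proof.
move=> [mg ig] [mh ih]; split; first exact: measurable_realfun.measurable_funD.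
move=> K cK KO; have mK := compact_row_measurable cK.
exact: (integrableD mK (ig K cK KO) (ih K cK KO)).
Qed.

Lemma locally_integrableZ (c : R) g : Defs.locally_integrable Om g ->
  Defs.locally_integrable Om (fun x => c * g x).
Proof.
move=> [mg ig]; split; first exact: measurable_realfun.measurable_funM.
move=> K cK KO; have mK := compact_row_measurable cK.
exact: (integrableZl mK c (ig K cK KO)).
Qed.

Lemma weak_gradientD u w G H : Defs.locally_integrable Om u ->
  Defs.locally_integrable Om w -> is_weak_gradient Om u G ->
  is_weak_gradient Om w H -> is_weak_gradient Om (u \+ w) (fun x => G x + H x).
Proof.
move=> lu lw wG wH i; have [lG hG] := wG i; have [lH hH] := wH i.
have lGH := locally_integrableD lG lH.
split.
  rewrite (_ : (fun x => _) = (fun x => G x ord0 i) \+ (fun x => H x ord0 i))//.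
  by apply/funext => x; rewrite mxE.
move=> psi tpsi; have tp := test_partial i tpsi.
have -> : \int[mu]_(x in Om) ((u \+ w) x * partial i psi x) =
    \int[mu]_(x in Om) (u x * partial i psi x) + \int[mu]_(x in Om) (w x * partial i psi x).
  rewrite -RintegralD//; [|exact: locally_integrableMtest..].
  by apply: eq_Rintegral => x _; rewrite /= mulrDl.
rewrite hG// hH// -opprD -RintegralD//; [|exact: locally_integrableMtest..].
by congr (- _); apply: eq_Rintegral => x _; rewrite /= mxE mulrDl.
Qed.

Lemma weak_gradientZ (c : R) u G : Defs.locally_integrable Om u ->
  is_weak_gradient Om u G ->
  is_weak_gradient Om (fun x => c * u x) (fun x => c *: G x).
Proof.
move=> lu wG i; have [lG hG] := wG i; split.
  rewrite (_ : (fun x => _) = (fun x => c * G x ord0 i)).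
    exact: locally_integrableZ.
  by apply/funext => x; rewrite mxE.
move=> psi tpsi; have tp := test_partial i tpsi.
have -> : \int[mu]_(x in Om) (c * u x * partial i psi x) =
    c * \int[mu]_(x in Om) (u x * partial i psi x).
  rewrite -RintegralZl//; last exact: locally_integrableMtest.
  by apply: eq_Rintegral => x _; rewrite mulrA.
rewrite hG// mulrN -RintegralZl//; last exact: locally_integrableMtest.
by congr (- _); apply: eq_Rintegral => x _; rewrite mxE mulrA.
Qed.

(** Coordinatewise, the difference is orthogonal to all test functions, so [fundamental_lemma]
    applies. The finitely many exceptional sets are combined by induction on the list of
    coordinates. *)
Lemma weak_gradient_unique u G H : is_weak_gradient Om u G ->
  is_weak_gradient Om u H -> {ae mu, forall x, Om x -> G x = H x}.
Proof.
move=> wG wH.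
have Hi i : {ae mu, forall x, Om x -> G x ord0 i - H x ord0 i = 0}.
  have [lG hG] := wG i; have [lH hH] := wH i.
  have lN := locally_integrableZ (-1) lH.
  apply: (fundamental_lemma oOm).
    rewrite (_ : (fun x => _) = (fun x => G x ord0 i) \+ (fun x => -1 * H x ord0 i)).
      exact: locally_integrableD.
    by apply/funext => x; rewrite /= mulN1r.
  move=> phi tphi.
  transitivity (\int[mu]_(x in Om) ((G x ord0 i * phi x)%:E - (H x ord0 i * phi x)%:E))%E.
    by apply: eq_integral => x _; rewrite -EFinB mulrBl.
  rewrite integralB//; [|exact: locally_integrableMtest..].
  rewrite -!RintegralE_loc//.
  have := hG phi tphi; rewrite hH// => /oppr_inj ->.
  by rewrite subee.
have : {ae mu, forall x, forall i, Om x -> G x ord0 i - H x ord0 i = 0}.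
  have E : \forall x \ae mu, forall i, i \in enum 'I_n -> Om x -> G x ord0 i - H x ord0 i = 0.
    elim: (enum 'I_n) => [|i s IH]; first exact: aeW.
    apply: filterS2 IH (Hi i) => x IH Hx j; rewrite in_cons => /orP[/eqP ->//|]; exact: IH.
  by apply: filterS E => x + i; apply; rewrite mem_enum.
apply: filterS => x Hx Ox; apply/rowP => i; apply/eqP; rewrite -subr_eq0.
by rewrite Hx.
Qed.

Lemma weak_gradientP u G : is_weak_gradient Om u G ->
  is_weak_gradient Om u (weak_gradient Om u).
Proof. by move=> wG; rewrite /weak_gradient; apply: getPex; exists G. Qed.

(** Makes the choice inside [weak_gradient] harmless: gradient norms can be computed from any
    explicit weak gradient. *)
Lemma weak_gradient_ae u G : is_weak_gradient Om u G ->
  {ae mu, forall x, Om x -> weak_gradient Om u x = G x}.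
Proof.
move=> wG; apply: weak_gradient_unique (wG); exact: weak_gradientP wG.
Qed.

End weak_gradients.

(** * Approximation by test functions *)

Section convexity.
Context {R : realType}.

(** Convexity at A + B = (1 - t) (A / (1 - t)) + t (B / t), obtained by combining the two tangent
    inequalities at A + B. With t = 1/2 it gives a quasi-triangle inequality; for small t the factor
    of A^p is close to 1. *)
Lemma powRD_le_convex (p t A B : R) : 1 < p -> 0 < t < 1 -> 0 <= A -> 0 <= B ->
  (A + B) `^ p <= (1 - t) * (A / (1 - t)) `^ p + t * (B / t) `^ p.
Proof.
move=> p1 /andP[t0 t1] A0 B0.
have s0 : 0 < 1 - t by rewrite subr_gt0.
have p0 : 0 < p by exact: lt_trans p1.
have S0 : 0 <= A + B by rewrite addr_ge0.
have A'0 : 0 <= A / (1 - t) by rewrite divr_ge0// ltW.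
have B'0 : 0 <= B / t by rewrite divr_ge0// ltW.
have := young_powR p1 A'0 S0; rewrite -(ler_pM2l s0) => h1.
have := young_powR p1 B'0 S0; rewrite -(ler_pM2l t0) => h2.
have := lerD h1 h2; set X := (A / (1 - t)) `^ p; set Y := (B / t) `^ p.
rewrite -(mulr_powRB1 S0 p0); set Z := (A + B) `^ (p - 1).
have -> : (1 - t) * (p * (Z * (A / (1 - t)))) + t * (p * (Z * (B / t))) = p * ((A + B) * Z).
  by field; rewrite !gt_eqF.
move=> H; rewrite -subr_ge0.
have -> : (1 - t) * X + t * Y - (A + B) * Z =
    (1 - t) * (X + (p - 1) * ((A + B) * Z)) + t * (Y + (p - 1) * ((A + B) * Z)) -
    p * ((A + B) * Z) by ring.
by rewrite subr_ge0.
Qed.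

(** A^s = A A^(s - 1) <= A (A + B)^(s - 1), and likewise for B. *)
Lemma powRD_superadditive (s A B : R) : 1 <= s -> 0 <= A -> 0 <= B ->
  A `^ s + B `^ s <= (A + B) `^ s.
Proof.
move=> s1 A0 B0; have s0 : 0 < s by exact: lt_le_trans s1.
have sm0 : 0 <= s - 1 by rewrite subr_ge0.
have S0 : 0 <= A + B by rewrite addr_ge0.
rewrite -(mulr_powRB1 A0 s0) -(mulr_powRB1 B0 s0) -(mulr_powRB1 S0 s0) mulrDl.
by apply: lerD; rewrite ler_wpM2l//; apply: ge0_ler_powR; rewrite ?nnegrE// ?lerDl ?lerDr.
Qed.

(** For s = p/2 > 1: superadditivity of the power s, the parallelogram identity, then convexity of
    the power s. *)
Lemma enorm_clarkson n (p : R) (x y : 'rV[R]_n) : 2 < p ->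
  enorm (2^-1 *: (x + y)) `^ p + enorm (2^-1 *: (x - y)) `^ p <=
  2^-1 * enorm x `^ p + 2^-1 * enorm y `^ p.
Proof.
move=> p2.
have s1 : 1 < p / 2 by lra.
have sq z : enorm (z : 'rV[R]_n) `^ p = (enorm z ^+ 2) `^ (p / 2).
  by rewrite -powR_mulrn ?enorm_ge0// -powRrM; congr powR; field.
rewrite !sq; apply: le_trans (powRD_superadditive (ltW s1) _ _) _; rewrite ?sqr_ge0//.
have -> : enorm (2^-1 *: (x + y)) ^+ 2 + enorm (2^-1 *: (x - y)) ^+ 2 =
    enorm x ^+ 2 / 2 + enorm y ^+ 2 / 2.
  rewrite !enormZ !exprMn -mulrDr enorm_parallelogram real_normK ?num_real//.
  by field.
have h : (0 < 2^-1 :> R) && (2^-1 < 1 :> R) by apply/andP; split; lra.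
apply: le_trans (powRD_le_convex s1 h _ _) _; rewrite ?divr_ge0 ?sqr_ge0//.
by rewrite (_ : 1 - 2^-1 = 2^-1 :> R) ?invrK ?divfK//; field.
Qed.

End convexity.

(** * Convergence of extended real quantities *)

Section ereal_limits.
Context {R : realType}.

Lemma cvg_EFinP {T} {F : set_system T} {FF : ProperFilter F} (f : T -> \bar R) (l : R) :
  (forall e : R, 0 < e -> \forall x \near F, ((l - e)%:E <= f x <= (l + e)%:E)%E) ->
  f @ F --> l%:E.
Proof.
move=> H; apply/fine_cvgP; split.
  apply: filterS (H 1 ltr01) => x /andP[h1 h2].
  by rewrite fin_numE; apply/andP; split; apply/eqP => e; rewrite e in h1 h2.
apply/cvgrPdist_le => e e0; apply: filterS (H e e0) => x /=.
case: (f x) => [s||] /andP[]; rewrite ?lee_fin//= ?leeNy_eq ?leye_eq//.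
move=> h1 h2; rewrite ler_norml; apply/andP; split; lra.
Qed.

Lemma cvg_ge0_EFin0P (f : nat -> \bar R) : (forall n, 0 <= f n)%E ->
  f @ \oo --> 0%E <-> (forall e : R, 0 < e -> \forall n \near \oo, (f n <= e%:E)%E).
Proof.
move=> f0; split=> [cf e e0|H].
  have /fine_cvgP[fin /cvgrPdist_le/(_ e e0)] := cf.
  apply: filterS2 fin => n fn; rewrite /= sub0r normrN => fe.
  by rewrite -(fineK fn) lee_fin; apply: le_trans fe; exact: ler_norm.
apply: (@cvg_EFinP _ _ _ f 0) => e e0; apply: filterS (H e e0) => n fe.
rewrite sub0r add0r fe andbT; apply: le_trans (f0 n).
  by rewrite lee_fin oppr_le0 ltW.
Qed.

Lemma cvg_poweR0 (s : R) (f : nat -> \bar R) : 0 < s -> (forall n, 0 <= f n)%E ->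
  f @ \oo --> 0%E -> (fun n => f n `^ s)%E @ \oo --> 0%E.
Proof.
move=> s0 f0 /(cvg_ge0_EFin0P f0) H; apply/cvg_ge0_EFin0P => [n|e e0].
  exact: poweR_ge0.
have es : 0 < e `^ s^-1 by rewrite powR_gt0.
apply: filterS (H _ es) => n fe.
have -> : e = (e `^ s^-1) `^ s by rewrite -powRrM mulVf ?gt_eqF// powRr1// ltW.
rewrite -poweR_EFin; apply: gt0_ler_poweR => //; first exact: ltW.
  by rewrite in_itv/= f0 leey.
by rewrite in_itv/= leey lee_fin ltW.
Qed.

End ereal_limits.

(* Locked because conversion problems that unfold these integrals diverge. *)
HB.lock Definition pint {R : realType} {n : nat} (Om : set 'rV[R]_n) (p : R)
    (u : 'rV[R]_n -> R) : \bar R :=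
  (\int[@lebesgue_row R n]_(x in Om) (`|u x| `^ p)%:E)%E.

Definition gint {R : realType} {n : nat} (Om : set 'rV[R]_n) (p : R)
    (G : 'rV[R]_n -> 'rV[R]_n) : \bar R := pint Om p (enorm \o G).

(** * Integrals of p-th powers *)

Section Lp_integrals.
Context {R : realType} {n : nat}.
Local Notation mu := (@lebesgue_row R n).
Variables (Om : set 'rV[R]_n) (p : R).
Hypotheses (oOm : open Om) (p1 : 1 < p).
Implicit Types (u w : 'rV[R]_n -> R) (G H : 'rV[R]_n -> 'rV[R]_n).

Let mOm : measurable Om. Proof. exact: open_row_measurable. Qed.
Let p0 : 0 < p. Proof. exact: lt_trans p1. Qed.

Local Notation pint := (pint Om p).
Local Notation gint := (gint Om p).

Lemma pintE u : pint u = (\int[mu]_(x in Om) (`|u x| `^ p)%:E)%E.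
Proof. by rewrite pint.unlock. Qed.

Lemma gintE G : gint G = (\int[mu]_(x in Om) (enorm (G x) `^ p)%:E)%E.
Proof.
by rewrite /gint pintE; apply: eq_integral => x _; rewrite /= ger0_norm ?enorm_ge0.
Qed.

Lemma pint_ge0 u : (0 <= pint u)%E.
Proof. by rewrite pintE; apply: integral_ge0 => x _; rewrite lee_fin powR_ge0. Qed.

Lemma gint_pint G : gint G = pint (enorm \o G). Proof. by []. Qed.

Lemma gint_ge0 G : (0 <= gint G)%E.
Proof. exact: pint_ge0. Qed.

Lemma eq_pint u w : (forall x, Om x -> u x = w x) -> pint u = pint w.
Proof. by move=> uw; rewrite !pintE; apply: eq_integral => x; rewrite inE => /uw ->. Qed.

Lemma eq_gint G H : (forall x, Om x -> G x = H x) -> gint G = gint H.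
Proof. by move=> GH; apply: eq_pint => x /GH /= ->. Qed.

Lemma poweR_Lnorm_on (s : R) u : s != 0 ->
  (Lnorm_on Om s%:E u `^ s = \int[mu]_(x in Om) (`|u x| `^ s)%:E)%E.
Proof.
move=> s0; rewrite /Lnorm_on poweR_Lnorm// [RHS]integral_mkcond.
apply: eq_integral => x _; rewrite !patchE; case: ifP => _ //=.
by rewrite normr0 powR0.
Qed.

Lemma Lnorm_on_poweR (s : R) u : s != 0 ->
  Lnorm_on Om s%:E u = ((\int[mu]_(x in Om) (`|u x| `^ s)%:E) `^ s^-1)%E.
Proof.
by move=> s0; rewrite -poweR_Lnorm_on// -poweRrM mulfV// poweRe1// Lnorm_ge0.
Qed.

Lemma Lnorm_on_pint u : Lnorm_on Om p%:E u = (pint u `^ p^-1)%E.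
Proof. by rewrite pintE Lnorm_on_poweR// gt_eqF. Qed.

Lemma Lnorm_on_lty u : (Lnorm_on Om p%:E u < +oo)%E <-> (pint u < +oo)%E.
Proof.
rewrite Lnorm_on_pint; split=> [h|h]; last exact: poweR_lty.
by apply: lty_poweRy h; rewrite invr_neq0// gt_eqF.
Qed.

Lemma measurable_pint u : measurable_fun Om u ->
  measurable_fun Om (fun x => (`|u x| `^ p)%:E).
Proof.
move=> mu_; apply/measurable_EFinP; apply: measurable_powR_comp.
exact: (measurableT_comp (@normr_measurable R setT) mu_).
Qed.

Lemma measurable_enorm_comp G : (forall i, measurable_fun Om (fun x => G x ord0 i)) ->
  measurable_fun Om (enorm \o G).
Proof.
move=> mG; rewrite (_ : _ \o _ = fun x => (\sum_i G x ord0 i ^+ 2) `^ 2^-1).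
  apply: measurable_powR_comp; apply: measurable_sum => i.
  exact: measurable_funX.
by apply/funext => x; rewrite /= powR12_sqrt// sumr_ge0// => i _; exact: sqr_ge0.
Qed.

Lemma measurable_gint G : (forall i, measurable_fun Om (fun x => G x ord0 i)) ->
  measurable_fun Om (fun x => (enorm (G x) `^ p)%:E).
Proof.
by move=> mG; apply/measurable_EFinP/measurable_powR_comp; exact: measurable_enorm_comp.
Qed.

Lemma weak_gradient_measurable u G : is_weak_gradient Om u G ->
  forall i, measurable_fun Om (fun x => G x ord0 i).
Proof. by move=> wG i; have [[]] := wG i. Qed.

Lemma gint_ae G H : (forall i, measurable_fun Om (fun x => G x ord0 i)) ->
  (forall i, measurable_fun Om (fun x => H x ord0 i)) ->
  {ae mu, forall x, Om x -> G x = H x} -> gint G = gint H.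
Proof.
move=> mG mH GH; rewrite !gintE; apply: ae_eq_integral => //; try exact: measurable_gint.
by apply: filterS GH => x /[apply] ->.
Qed.

Lemma grad_norm_poweR u G : is_weak_gradient Om u G ->
  (grad_norm Om p u `^ p = gint G)%E.
Proof.
move=> wG; rewrite /grad_norm poweR_Lnorm_on ?gt_eqF//.
rewrite (@gint_ae G (weak_gradient Om u)).
- by rewrite gint_pint pintE.
- exact: weak_gradient_measurable wG.
- exact: weak_gradient_measurable (weak_gradientP wG).
- by apply: filterS (weak_gradient_ae oOm wG) => x /[apply].
Qed.

Lemma grad_norm_gint u G : is_weak_gradient Om u G ->
  (grad_norm Om p u = gint G `^ p^-1)%E.
Proof.
move=> wG; rewrite -(grad_norm_poweR wG) -poweRrM mulfV ?gt_eqF// poweRe1//.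
exact: Lnorm_ge0.
Qed.

Lemma gintZ (c : R) G : (forall i, measurable_fun Om (fun x => G x ord0 i)) ->
  gint (fun x => c *: G x) = ((`|c| `^ p)%:E * gint G)%E.
Proof.
move=> mG; have mg := measurable_gint mG.
rewrite !gintE -ge0_integralZl//.
- by apply: eq_integral => x _; rewrite enormZ powRM ?enorm_ge0.
- by move=> x _; rewrite lee_fin powR_ge0.
Qed.

Lemma pintZ (c : R) u : measurable_fun Om u ->
  pint (fun x => c * u x) = ((`|c| `^ p)%:E * pint u)%E.
Proof.
move=> mu_; have mg := measurable_pint mu_.
rewrite !pintE -ge0_integralZl//.
by apply: eq_integral => x _; rewrite normrM powRM.
Qed.

(** Replaces Minkowski's inequality at the level of p-th powers: no roots occur, and the factor of w
    tends to 1 with t. *)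
Lemma pint_le_convex (t : R) u w (z : 'rV[R]_n -> R) : 0 < t < 1 ->
  measurable_fun Om u -> measurable_fun Om w -> measurable_fun Om z ->
  (forall x, Om x -> `|u x| <= `|w x| + `|z x|) ->
  (pint u <= ((1 - t) * (1 - t)^-1 `^ p)%:E * pint w + (t * t^-1 `^ p)%:E * pint z)%E.
Proof.
move=> t01 mu_ mw mz uwz; have /andP[t0 t1] := t01.
have s0 : 0 < 1 - t by rewrite subr_gt0.
have c1 : 0 <= (1 - t) * (1 - t)^-1 `^ p by rewrite mulr_ge0 ?powR_ge0// ltW.
have c2 : 0 <= t * t^-1 `^ p by rewrite mulr_ge0 ?powR_ge0// ltW.
have m1 := measurable_pint mw; have m2 := measurable_pint mz.
have h1 x : Om x -> (0 <= (`|w x| `^ p)%:E :> \bar R)%E by rewrite lee_fin powR_ge0.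
have h2 x : Om x -> (0 <= (`|z x| `^ p)%:E :> \bar R)%E by rewrite lee_fin powR_ge0.
rewrite !pintE -ge0_integralZl// -ge0_integralZl// -ge0_integralD//; first last.
- exact: measurable_funeM.
- by move=> x Ox; rewrite mule_ge0 ?h2.
- exact: measurable_funeM.
- by move=> x Ox; rewrite mule_ge0 ?h1.
apply: ge0_le_integral => //.
- exact: measurable_pint.
- by apply: emeasurable_funD; exact: measurable_funeM.
move=> x Ox; rewrite -!EFinM -EFinD lee_fin.
apply: (@le_trans _ _ ((`|w x| + `|z x|) `^ p)).
  by apply: ge0_ler_powR; rewrite ?nnegrE ?addr_ge0 ?(ltW p0)//; exact: uwz.
apply: le_trans (powRD_le_convex p1 t01 _ _) _ => //.
by rewrite !powRM ?invr_ge0 ?(ltW s0) ?(ltW t0)// -!mulrA ![_^-1 `^ p * _]mulrC.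
Qed.

End Lp_integrals.

(** * Elements of W_0^{1,p} as limits of test functions *)

Section approximation.
Context {R : realType} {N : nat}.
Variables (p r : R).
Hypotheses (N2 : (2 <= N)%N) (Np : N%:R < p) (r0 : 0 < r).
Local Notation mu := (@lebesgue_row R N).
Local Notation B := (@eball R N r).
Local Notation pint := (pint B p).
Local Notation gint := (gint B p).
Implicit Types (u w V : 'rV[R]_N -> R) (G H : 'rV[R]_N -> 'rV[R]_N).
Implicit Types (phi psi : nat -> 'rV[R]_N -> R).

Let N1 : 1 < N%:R :> R. Proof. by rewrite ltr1n. Qed.
Let p1 : 1 < p. Proof. exact: lt_trans Np. Qed.
Let p0 : 0 < p. Proof. exact: lt_trans p1. Qed.
Let pn0 : p != 0. Proof. by rewrite gt_eqF. Qed.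
Let oB : open B. Proof. exact: open_eball. Qed.
Let mB : measurable B. Proof. exact: measurable_eball. Qed.
Let half01 : (0 < 2^-1 :> R) && (2^-1 < 1 :> R). Proof. by apply/andP; split; lra. Qed.

(** Working form of membership in W_0^{1,p}: the weak gradient and the approximating sequence are
    explicit, and norms are replaced by integrals of p-th powers. *)
Definition approx u G phi :=
  [/\ measurable_fun B u, (pint u < +oo)%E, is_weak_gradient B u G, (gint G < +oo)%E &
    [/\ forall n, test_function B (phi n),
        pint (phi n \- u) @[n --> \oo] --> 0%E &
        gint (fun x => grad (phi n) x - G x) @[n --> \oo] --> 0%E]].

(** |u| <= 1 + |u|^p, and the ball has finite measure. *)
Lemma pint_locally_integrable u : measurable_fun B u -> (pint u < +oo)%E ->
  Defs.locally_integrable B u.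
Proof.
move=> mu_ pu; split=> // K cK KB; apply: (integrableS mB) => //.
  exact: compact_row_measurable.
have i1 : mu.-integrable B (fun x => 1 + (`|u x| `^ p)%:E)%E.
  apply: integrableD => //.
    apply: (@measurable_bounded_integrable _ _ _ mu (cst 1)) => //.
      exact: lebesgue_row_eball_lty.
    exists (1 : R); split; first exact: num_real.
    by move=> M M1 x _; rewrite /= normr1 ltW.
  apply/integrableP; split; first exact: measurable_pint.
  rewrite (_ : integral _ _ _ = pint u)// pintE.
  by apply: eq_integral => x _; rewrite gee0_abs// lee_fin powR_ge0.
apply: le_integrable i1 => //; first exact/measurable_EFinP.
move=> x Bx; rewrite /= lee_fin [leRHS]ger0_norm ?addr_ge0 ?powR_ge0//.
have [u1|u1] := leP `|u x| 1; first by apply: le_trans u1 _; rewrite lerDl powR_ge0.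
by apply: le_trans (le1r_powR (ltW u1) (ltW p1)) _; rewrite lerDr.
Qed.

Lemma test_measurable f : test_function B f -> measurable_fun B f.
Proof.
move=> tf; apply: measurable_funTS; apply: continuous_row_measurable.
exact: test_continuous tf.
Qed.

Lemma test_grad_measurable f : test_function B f ->
  forall i, measurable_fun B (fun x => grad f x ord0 i).
Proof.
by move=> tf; apply: weak_gradient_measurable; exact: test_weak_gradient.
Qed.

Lemma test_locally_integrable f : test_function B f -> Defs.locally_integrable B f.
Proof. by move=> tf; apply: continuous_locally_integrable; exact: test_continuous tf. Qed.

Lemma weak_gradientB u w G H : Defs.locally_integrable B u ->
  Defs.locally_integrable B w -> is_weak_gradient B u G ->
  is_weak_gradient B w H -> is_weak_gradient B (u \- w) (fun x => G x - H x).
Proof.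
move=> lu lw wG wH.
rewrite (_ : u \- w = u \+ (fun x => -1 * w x)); last first.
  by apply/funext => x; rewrite /= mulN1r.
rewrite (_ : (fun x => G x - H x) = (fun x => G x + (-1) *: H x)); last first.
  by apply/funext => x; rewrite scaleN1r.
apply: weak_gradientD => //; first exact: locally_integrableZ.
exact: weak_gradientZ.
Qed.

Lemma in_W01pP u : in_W01p B p u <-> exists G phi, approx u G phi.
Proof.
split.
- move=> [[[mu_ Lu] [G wG [mG LG]]] [phi tphi cphi]].
  have pu : (pint u < +oo)%E by apply/Lnorm_on_lty.
  have lu := pint_locally_integrable mu_ pu.
  exists G, phi; split => //.
    by rewrite gint_pint; apply/Lnorm_on_lty.
  have W0 n : (0 <= W1p_norm B p (phi n \- u)%R)%E by rewrite /W1p_norm adde_ge0// Lnorm_ge0.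
  move/(cvg_ge0_EFin0P W0) : cphi => H.
  split=> //.
  + rewrite (_ : (fun n => _) = fun n => (Lnorm_on B p%:E (phi n \- u)%R `^ p)%E).
      apply: cvg_poweR0 => //; first by move=> n; exact: Lnorm_ge0.
      apply/cvg_ge0_EFin0P => [n|e e0]; first exact: Lnorm_ge0.
      by apply: filterS (H e e0) => n; apply: le_trans; rewrite leeDl// Lnorm_ge0.
    by apply/funext => n; rewrite pintE poweR_Lnorm_on.
  + rewrite (_ : (fun n => _) = fun n => (grad_norm B p (phi n \- u)%R `^ p)%E).
      apply: cvg_poweR0 => //; first by move=> n; exact: Lnorm_ge0.
      apply/cvg_ge0_EFin0P => [n|e e0]; first exact: Lnorm_ge0.
      by apply: filterS (H e e0) => n; apply: le_trans; rewrite leeDr// Lnorm_ge0.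
    apply/funext => n; apply/esym/grad_norm_poweR => //.
    by apply: weak_gradientB => //; [exact: test_locally_integrable|exact: test_weak_gradient].
- move=> [G [phi [mu_ pu wG gG [tphi c1 c2]]]].
  have lu := pint_locally_integrable mu_ pu.
  split; first split.
  + by split=> //; apply/Lnorm_on_lty.
  + exists G => //; split.
      by apply: measurable_enorm_comp; exact: weak_gradient_measurable wG.
    by apply/Lnorm_on_lty => //; rewrite -gint_pint.
  exists phi => //; rewrite -[X in _ --> X](adde0 0%E) /W1p_norm.
  apply: cvgeD => //.
  + rewrite (_ : (fun n => _) = fun n => (pint (phi n \- u)%R `^ p^-1)%E).
      by apply: cvg_poweR0 => //; [rewrite invr_gt0|move=> n; exact: pint_ge0].
    by apply/funext => n; rewrite Lnorm_on_pint.
  + rewrite (_ : (fun n => _) = fun n => (gint (fun x => grad (phi n) x - G x)%R `^ p^-1)%E).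
      by apply: cvg_poweR0 => //; [rewrite invr_gt0|move=> n; exact: gint_ge0].
    apply/funext => n; apply: grad_norm_gint => //.
    by apply: weak_gradientB => //; [exact: test_locally_integrable|exact: test_weak_gradient].
Qed.

Lemma approx_grad_norm u G phi : approx u G phi -> (grad_norm B p u `^ p = gint G)%E.
Proof. by move=> [_ _ wG _ _]; exact: grad_norm_poweR. Qed.

Lemma gint_le_convex (t : R) G H (K : 'rV[R]_N -> 'rV[R]_N) : 0 < t < 1 ->
  (forall i, measurable_fun B (fun x => G x ord0 i)) ->
  (forall i, measurable_fun B (fun x => H x ord0 i)) ->
  (forall i, measurable_fun B (fun x => K x ord0 i)) ->
  (forall x, G x = H x + K x) ->
  (gint G <= ((1 - t) * (1 - t)^-1 `^ p)%:E * gint H + (t * t^-1 `^ p)%:E * gint K)%E.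
Proof.
move=> t01 mG mH mK E; rewrite !gint_pint; apply: pint_le_convex => //; try exact: measurable_enorm_comp.
by move=> x _; rewrite /= !ger0_norm ?enorm_ge0// E enormD.
Qed.

(** The common value 2^(p - 1) of the two convexity coefficients at t = 1/2. *)
Let c2 : R := 2^-1 * (2^-1)^-1 `^ p.
Let c2_gt0 : 0 < c2. Proof. by rewrite mulr_gt0 ?powR_gt0 ?invr_gt0. Qed.
Let c2E : ((1 - 2^-1) * (1 - 2^-1)^-1 `^ p = c2).
Proof. by rewrite (_ : 1 - 2^-1 = 2^-1 :> R)//; field. Qed.

Lemma pint_sum_le u w (z : 'rV[R]_N -> R) : measurable_fun B u -> measurable_fun B w ->
  measurable_fun B z -> (forall x, B x -> `|u x| <= `|w x| + `|z x|) ->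
  (pint u <= c2%:E * pint w + c2%:E * pint z)%E.
Proof.
move=> mu_ mw mz h; have := pint_le_convex oB p1 half01 mu_ mw mz h.
by rewrite c2E.
Qed.

Lemma gint_sum_le G H (K : 'rV[R]_N -> 'rV[R]_N) :
  (forall i, measurable_fun B (fun x => G x ord0 i)) ->
  (forall i, measurable_fun B (fun x => H x ord0 i)) ->
  (forall i, measurable_fun B (fun x => K x ord0 i)) ->
  (forall x, G x = H x + K x) ->
  (gint G <= c2%:E * gint H + c2%:E * gint K)%E.
Proof.
move=> mG mH mK h; have := gint_le_convex half01 mG mH mK h.
by rewrite c2E.
Qed.

Lemma cvg0_sum_le (f a b : nat -> \bar R) : (forall n, 0 <= f n)%E ->
  (forall n, 0 <= a n)%E -> (forall n, 0 <= b n)%E ->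
  (forall n, f n <= c2%:E * a n + c2%:E * b n)%E ->
  a @ \oo --> 0%E -> b @ \oo --> 0%E -> f @ \oo --> 0%E.
Proof.
move=> f0 a0 b0 fab /(cvg_ge0_EFin0P a0) ca /(cvg_ge0_EFin0P b0) cb.
apply/cvg_ge0_EFin0P => // e e0.
have d0 : 0 < e / 2 / c2 by rewrite !divr_gt0.
apply: filterS2 (ca _ d0) (cb _ d0) => n an bn.
apply: le_trans (fab n) _.
have c0 : (0 <= c2%:E :> \bar R)%E by rewrite lee_fin ltW.
apply: le_trans (leeD (lee_wpmul2l c0 an) (lee_wpmul2l c0 bn)) _.
rewrite -!EFinM -EFinD lee_fin le_eqVlt; apply/orP; left; apply/eqP.
by field; rewrite gt_eqF.
Qed.

Lemma approxZ (c : R) u G phi : approx u G phi ->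
  approx (fun x => c * u x) (fun x => c *: G x) (fun n x => c * phi n x).
Proof.
move=> [mu_ pu wG gG [tphi h1 h2]]; have lu := pint_locally_integrable mu_ pu.
have mG := weak_gradient_measurable wG.
have cp0 : 0 <= `|c| `^ p by exact: powR_ge0.
have lim0 (f : nat -> \bar R) : (forall n, 0 <= f n)%E -> f @ \oo --> 0%E ->
    (fun n => (`|c| `^ p)%:E * f n)%E @ \oo --> 0%E.
  move=> f0 cf; rewrite -[X in _ --> X](mule0 (`|c| `^ p)%:E).
  by apply: cvgeZl.
split.
- by apply: measurable_realfun.measurable_funM.
- by rewrite pintZ// lte_mul_pinfty// pint_ge0.
- exact: weak_gradientZ.
- by rewrite gintZ// lte_mul_pinfty// gint_ge0.
split.
- by move=> n; exact: testZ.
- rewrite (_ : (fun n => _) = fun n => ((`|c| `^ p)%:E * pint (phi n \- u)%R)%E).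
    by apply: lim0 => // n; exact: pint_ge0.
  apply/funext => n; rewrite -(pintZ p oB).
    by apply: eq_pint => x _ /=; rewrite mulrBr.
  by apply: measurable_realfun.measurable_funB => //; exact: test_measurable.
- apply: cvg_trans (lim0 _ _ h2); last by move=> n; exact: gint_ge0.
  apply: near_eq_cvg; apply: nearW => n; rewrite -(gintZ p oB)//.
    apply: eq_gint => x _; rewrite scalerBr; congr (_ - _); apply/rowP => i; rewrite !mxE.
    have /smooth_differentiable d := (tphi n).1.
    by rewrite /partial (_ : (fun x => c * phi n x) = c *: phi n)// deriveZ//; exact: diff_derivable.
  move=> i; rewrite (_ : (fun x => _) = (fun x => grad (phi n) x ord0 i) \- (fun x => G x ord0 i)).
    by apply: measurable_realfun.measurable_funB => //; exact: test_grad_measurable.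
  by apply/funext => x; rewrite /= !mxE.
Qed.

Lemma testD (f g : 'rV[R]_N -> R) : test_function B f -> test_function B g ->
  test_function B (f \+ g).
Proof.
move=> tf tg; have := testB tf (testZ (-1) tg).
by rewrite (_ : _ \- _ = f \+ g)//; apply/funext => x; rewrite /= mulN1r opprK.
Qed.

Lemma gradD (f g : 'rV[R]_N -> R) x : test_function B f -> test_function B g ->
  grad (f \+ g) x = grad f x + grad g x.
Proof.
move=> [sf _] [sg _]; apply/rowP => i; rewrite !mxE partialD//.
  by move=> y; exact: smooth_differentiable.
by move=> y; exact: smooth_differentiable.
Qed.

Lemma measurable_gradB (f : 'rV[R]_N -> R) G : test_function B f ->
  (forall i, measurable_fun B (fun x => G x ord0 i)) ->
  forall i, measurable_fun B (fun x => (grad f x - G x) ord0 i).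
Proof.
move=> tf mG i; rewrite (_ : (fun x => _) = (fun x => grad f x ord0 i) \- (fun x => G x ord0 i)).
  by apply: measurable_realfun.measurable_funB => //; exact: test_grad_measurable.
by apply/funext => x; rewrite /= !mxE.
Qed.

Lemma approxD u w G H phi psi : approx u G phi -> approx w H psi ->
  approx (u \+ w) (fun x => G x + H x) (fun n => phi n \+ psi n).
Proof.
move=> [mu_ pu wG gG [tphi h1 h2]] [mw pw wH gH [tpsi h3 h4]].
have lu := pint_locally_integrable mu_ pu; have lw := pint_locally_integrable mw pw.
have mG := weak_gradient_measurable wG; have mH := weak_gradient_measurable wH.
have c0 : (0 <= c2%:E :> \bar R)%E by rewrite lee_fin ltW.
have wGH := weak_gradientD oB lu lw wG wH.
have mGH := weak_gradient_measurable wGH.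
split.
- exact: measurable_realfun.measurable_funD.
- apply: le_lt_trans (pint_sum_le _ mu_ mw _) _.
  + exact: measurable_realfun.measurable_funD.
  + by move=> x _; exact: ler_normD.
  + by rewrite lte_add_pinfty// lte_mul_pinfty// pint_ge0.
- exact: wGH.
- apply: le_lt_trans (gint_sum_le mGH mG mH _) _ => //.
  by rewrite lte_add_pinfty// lte_mul_pinfty// gint_ge0.
split.
- by move=> n; exact: testD.
- apply: cvg0_sum_le h1 h3; try by move=> n; exact: pint_ge0.
  move=> n; apply: pint_sum_le.
  + apply: measurable_realfun.measurable_funB; last exact: measurable_realfun.measurable_funD.
    by apply: test_measurable; exact: testD.
  + by apply: measurable_realfun.measurable_funB => //; exact: test_measurable.
  + by apply: measurable_realfun.measurable_funB => //; exact: test_measurable.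
  + move=> x _ /=; rewrite (_ : _ - _ = (phi n x - u x) + (psi n x - w x)); last by ring.
    exact: ler_normD.
- apply: cvg0_sum_le h2 h4; try by move=> n; exact: gint_ge0.
  move=> n; apply: gint_sum_le; try exact: measurable_gradB.
    by apply: measurable_gradB mGH; exact: testD.
  by move=> x; rewrite gradD// opprD addrACA.
Qed.

End approximation.

(** * Continuous representatives and the sharp inequality in W_0^{1,p} *)

Section representation.
Context {R : realType} {N : nat}.
Variables (p r : R).
Hypotheses (N2 : (2 <= N)%N) (Np : N%:R < p) (r0 : 0 < r).
Local Notation mu := (@lebesgue_row R N).
Local Notation B := (@eball R N r).
Local Notation pint := (pint B p).
Local Notation gint := (gint B p).
Local Notation Lam := (pole_constant p r (0 : 'rV[R]_N)).
Implicit Types (u w V : 'rV[R]_N -> R) (G H : 'rV[R]_N -> 'rV[R]_N).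
Implicit Types (phi psi : nat -> 'rV[R]_N -> R).

Let N1 : 1 < N%:R :> R. Proof. by rewrite ltr1n. Qed.
Let p1 : 1 < p. Proof. exact: lt_trans Np. Qed.
Let p0 : 0 < p. Proof. exact: lt_trans p1. Qed.
Let pn0 : p != 0. Proof. by rewrite gt_eqF. Qed.
Let oB : open B. Proof. exact: open_eball. Qed.
Let mB : measurable B. Proof. exact: measurable_eball. Qed.
Let b0 : 0 < (p - N%:R) / 2. Proof. by rewrite divr_gt0// subr_gt0. Qed.

Lemma pole_factor_gt0 : 0 < N%:R * unit_volume R N * ((p - N%:R) / (p - 1)) `^ (p - 1).
Proof.
rewrite !mulr_gt0 ?unit_volume_gt0// ?(lt_trans _ N1)//.
by rewrite powR_gt0 ?divr_gt0 ?subr_gt0.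
Qed.

Lemma ball_gap_gt0 (x : 'rV[R]_N) : enorm x < r -> 0 < r ^+ 2 - enorm x ^+ 2.
Proof. by move=> xr; rewrite subr_gt0 ltr_pXn2r ?nnegrE ?enorm_ge0 ?(ltW r0). Qed.

Lemma pole_constant_gt0 (x : 'rV[R]_N) : enorm x < r -> 0 < pole_constant p r x.
Proof.
by move=> xr; rewrite /pole_constant mulr_gt0 ?pole_factor_gt0 ?powR_gt0 ?ball_gap_gt0.
Qed.

Lemma Lam_gt0 : 0 < Lam.
Proof. by apply: pole_constant_gt0; rewrite enorm0. Qed.

(** The exponent - (p - N)/2 is negative, so the constant grows with |x|. The strictness is what
    pins the maximum point of an extremal to the centre. *)
Lemma pole_constant_lt (x : 'rV[R]_N) : enorm x < r -> x != 0 -> Lam < pole_constant p r x.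
Proof.
move=> xr x0; rewrite /pole_constant ltr_pM2l ?pole_factor_gt0//.
rewrite enorm0 expr0n subr0 !powRN ltf_pV2 ?posrE ?powR_gt0 ?exprn_gt0 ?ball_gap_gt0//.
apply: gt0_ltr_powR; rewrite ?nnegrE ?(ltW (ball_gap_gt0 xr)) ?sqr_ge0//.
by rewrite ltrBlDr ltrDl exprn_gt0// enorm_gt0.
Qed.

Lemma pole_constant_le (x : 'rV[R]_N) : enorm x < r -> Lam <= pole_constant p r x.
Proof.
move=> xr; have [->//|x0] := eqVneq x 0; apply: ltW; exact: pole_constant_lt.
Qed.

Lemma test_sharp f (x0 : 'rV[R]_N) : test_function B f -> enorm x0 < r ->
  ((pole_constant p r x0 * `|f x0| `^ p)%:E <= gint (grad f))%E.
Proof.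
move=> tf x0r; apply: le_trans (sharp_inequality_at N2 Np r0 _ _ _ x0r) _.
- by move=> x; exact: test_differentiable tf.
- by move=> i; apply: (@test_continuous _ _ B); exact: test_partial.
- by move=> x rx; apply: (test_out tf); rewrite /eball/= => xr; rewrite ltNge rx in xr.
rewrite gintE [leRHS]integral_mkcond le_eqVlt; apply/orP; left; apply/eqP.
apply: eq_integral => x _; rewrite patchE; case: ifPn => // /negP; rewrite inE => Bx.
rewrite (_ : grad f x = 0) ?enorm0 ?powR0//.
by apply/rowP => i; rewrite !mxE; apply: (test_out _ Bx); exact: test_partial.
Qed.

(** Since f vanishes off the ball, the bound holds at every point of the space, with one
    constant. *)
Lemma test_sup f (x : 'rV[R]_N) : test_function B f ->
  ((Lam * `|f x| `^ p)%:E <= gint (grad f))%E.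
Proof.
move=> tf; have [xr|rx] := ltP (enorm x) r.
  apply: le_trans (test_sharp tf xr); rewrite lee_fin ler_wpM2r ?powR_ge0//.
  exact: pole_constant_le.
rewrite (test_out tf); first by rewrite normr0 powR0// mulr0 gint_ge0.
by rewrite /eball/= => xr; rewrite ltNge rx in xr.
Qed.

Local Notation c2 := ((2^-1 * (2^-1)^-1 `^ p) : R).
Let c2_gt0 : 0 < c2. Proof. by rewrite mulr_gt0 ?powR_gt0 ?invr_gt0. Qed.

Lemma gintN G : gint (fun x => - G x) = gint G.
Proof. by rewrite !gintE; apply: eq_integral => x _; rewrite enormN. Qed.

Lemma gradB (f g : 'rV[R]_N -> R) x : test_function B f -> test_function B g ->
  grad (f \- g) x = grad f x - grad g x.
Proof.
move=> tf tg; apply/rowP => i; rewrite !mxE /partial deriveB//.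
  by apply: diff_derivable; exact: test_differentiable tf.
by apply: diff_derivable; exact: test_differentiable tg.
Qed.

(** [test_sup] is applied to the difference of two test functions, whose gradients are both close to
    G. *)
Lemma approx_cauchy u G phi (e : R) : approx p r u G phi -> 0 < e ->
  exists n0, forall n m x, (n0 <= n)%N -> (n0 <= m)%N -> `|phi n x - phi m x| <= e.
Proof.
move=> [mu_ pu wG gG [tphi c1 cg]] e0.
have mG := weak_gradient_measurable wG.
(* For this d the sum c2 d + c2 d is exactly Lam e^p. *)
have d0 : 0 < Lam * e `^ p / 2 / c2.
  by rewrite divr_gt0// divr_gt0// mulr_gt0 ?Lam_gt0// powR_gt0.
move/cvg_ge0_EFin0P : cg => /(_ (fun n => gint_ge0 _ _ _)) /(_ _ d0) [n0 _ Hn0].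
exists n0 => n m x nn mm; rewrite leNgt; apply/negP => le.
have := test_sup x (testB (tphi n) (tphi m)); apply/negP; rewrite -ltNge.
have H : (gint (grad (phi n \- phi m)%R) <= (Lam * e `^ p)%:E)%E.
  apply: (le_trans (@gint_sum_le R N p r N2 Np _ (fun x => grad (phi n) x - G x)
    (fun x => - (grad (phi m) x - G x)) _ _ _ _)).
  - by apply: test_grad_measurable; exact: testB.
  - exact: measurable_gradB.
  - move=> i; rewrite (_ : (fun x => _) = \- (fun x => (grad (phi m) x - G x) ord0 i)).
      by apply: measurableT_comp => //; exact: measurable_gradB.
    by apply/funext => y; rewrite /= !mxE.
  - by move=> y; rewrite gradB// opprB addrA subrK.
  rewrite gintN; have c0 : (0 <= c2%:E :> \bar R)%E by rewrite lee_fin ltW.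
  apply: le_trans (leeD (lee_wpmul2l c0 (Hn0 n nn)) (lee_wpmul2l c0 (Hn0 m mm))) _.
  rewrite -!EFinM -EFinD lee_fin le_eqVlt; apply/orP; left; apply/eqP.
  by move: c2_gt0; generalize c2 => c c0'; field; rewrite gt_eqF.
apply: le_lt_trans H _; rewrite lte_fin ltr_pM2l ?Lam_gt0//.
by apply: gt0_ltr_powR; rewrite ?nnegrE// ltW.
Qed.

(** The uniform limit V is continuous and vanishes off the ball like the test functions. It agrees
    with u almost everywhere because on a set of finite measure uniform convergence implies
    convergence in L^p. *)
Lemma approx_uniform_limit u G phi : approx p r u G phi -> exists V,
  [/\ forall e : R, 0 < e -> exists n0, forall n x, (n0 <= n)%N -> `|phi n x - V x| <= e,
      continuous V, {ae mu, forall x, B x -> u x = V x} &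
      forall x, r <= enorm x -> V x = 0].
Proof.
move=> ap; have [mu_ pu wG gG [tphi c1 cg]] := ap.
have cphi x : cvg (phi n x @[n --> \oo]).
  apply: cauchy_cvg; apply: cauchy_exP => e e0.
  have e20 : 0 < e / 2 by rewrite divr_gt0.
  have [n0 Hn] := approx_cauchy ap e20.
  exists (phi n0 x); exists n0 => // n /= nn; rewrite /ball/=.
  by apply: le_lt_trans (Hn _ _ x (leqnn _) nn) _; rewrite ltr_pdivrMr// ltr_pMr// ltr1n.
pose V x := lim (phi n x @[n --> \oo]).
have unif (e : R) : 0 < e -> exists n0, forall n x, (n0 <= n)%N -> `|phi n x - V x| <= e.
  move=> e0; have [n0 Hn] := approx_cauchy ap e0; exists n0 => n x nn.
  have cv : `|phi n x - phi m x| @[m --> \oo] --> `|phi n x - V x|.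
    by apply: cvg_norm; apply: cvgB; [exact: cvg_cst|exact: cphi].
  apply: (cvgr_to_le cv); exists n0 => // m /= mm; exact: Hn.
exists V; split => //.
- move=> x; apply/(@cvgrPdist_le R R 'rV[R]_N (nbhs x) (nbhs_filter x)) => e e0.
  have e30 : 0 < e / 3 by rewrite divr_gt0.
  have [n0 Hn] := unif _ e30.
  have cx : phi n0 y @[y --> x] --> phi n0 x by have := test_continuous (tphi n0); apply.
  have /(@cvgrPdist_le R R 'rV[R]_N (nbhs x) (nbhs_filter x))/(_ _ e30) := cx.
  apply: filterS => y xy.
  have h1 := Hn n0 x (leqnn _); have h2 := Hn n0 y (leqnn _).
  rewrite distrC in h1.
  rewrite (_ : V x - V y = (V x - phi n0 x) + (phi n0 x - phi n0 y) + (phi n0 y - V y)); last by ring.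
  apply: le_trans (ler_normD _ _) _.
  apply: le_trans (lerD (ler_normD _ _) (lexx _)) _.
  have -> : e = e / 3 + e / 3 + e / 3 by field.
  by rewrite !lerD.
- have mphi n : measurable_fun B (phi n) by exact: test_measurable.
  have mV : measurable_fun B V.
    apply: (measurable_fun_cvg mphi) => x Bx; exact: cphi.
  have mB_fin : exists m : R, 0 < m /\ mu B = m%:E.
    exists (fine (mu B)); split.
      by rewrite fine_gt0// lebesgue_row_eball_gt0//= lebesgue_row_eball_lty.
    by rewrite fineK// ge0_fin_numE// lebesgue_row_eball_lty.
  have [m [m0 mE]] := mB_fin.
  have p0V : pint (u \- V) = 0%E.
    apply/eqP; rewrite eq_le pint_ge0 andbT; apply/lee_addgt0Pr => e e0; rewrite add0e.
    have e10 : 0 < e / 2 / c2 by rewrite !divr_gt0.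
    (* This uniform error makes the integral of its p-th power over the ball, of measure m, at most
       e / 2 / c2. *)
    have e20 : 0 < (e / 2 / c2 / m) `^ p^-1 by rewrite powR_gt0// divr_gt0.
    move/cvg_ge0_EFin0P : c1 => /(_ (fun n => pint_ge0 _ _ _)) /(_ _ e10) [n1 _ Hn1].
    have [n2 Hn2] := unif _ e20.
    pose n := maxn n1 n2.
    have h1 : (pint (phi n \- u)%R <= (e / 2 / c2)%:E)%E by apply: Hn1; rewrite /= leq_maxl.
    have h2 : (pint (phi n \- V)%R <= (e / 2 / c2)%:E)%E.
      rewrite pintE; apply: (@le_trans _ _ (\int[mu]_(x in B) (cst (e / 2 / c2 / m)%:E x))%E).
        apply: ge0_le_integral => //.
        - by apply: measurable_pint; exact: measurable_realfun.measurable_funB.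
        move=> x Bx; rewrite lee_fin.
        have -> : e / 2 / c2 / m = ((e / 2 / c2 / m) `^ p^-1) `^ p.
          by rewrite -powRrM mulVf// powRr1// divr_ge0 ?(ltW e10) ?(ltW m0).
        apply: ge0_ler_powR; rewrite ?nnegrE ?(ltW p0)// ?powR_ge0//.
        by apply: Hn2; rewrite leq_maxr.
      rewrite integral_cst// [X in (_ * X)%E](mE) -EFinM lee_fin divfK// gt_eqF//.
    have c0 : (0 <= c2%:E :> \bar R)%E by rewrite lee_fin ltW.
    apply: (le_trans (@pint_sum_le R N p r N2 Np _ (phi n \- u) (phi n \- V) _ _ _ _)).
    - exact: measurable_realfun.measurable_funB.
    - exact: measurable_realfun.measurable_funB.
    - exact: measurable_realfun.measurable_funB.
    - move=> x _ /=; rewrite (_ : u x - V x = - (phi n x - u x) + (phi n x - V x)); last by ring.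
      by apply: le_trans (ler_normD _ _) _; rewrite normrN.
    apply: le_trans (leeD (lee_wpmul2l c0 h1) (lee_wpmul2l c0 h2)) _.
    rewrite -!EFinM -EFinD lee_fin le_eqVlt; apply/orP; left; apply/eqP.
    by move: c2_gt0; generalize c2 => c c0'; field; rewrite gt_eqF.
  have muV : measurable_fun B (u \- V) by exact: measurable_realfun.measurable_funB.
  have /ae_eq_integral_abs : measurable_fun B (fun x => (`|(u \- V) x| `^ p)%:E : \bar R).
    exact: measurable_pint.
  move=> /(_ mu mB)[H _].
  have : (\int[mu]_(x in B) `|(`|(u \- V) x| `^ p)%:E| = 0)%E.
    rewrite -[RHS]p0V pintE; apply: eq_integral => x _.
    by rewrite gee0_abs// lee_fin powR_ge0.
  move=> /H; apply: filterS => x /[apply] /eqP; rewrite eqe powR_eq0 normr_eq0 /=.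
  by move=> /andP[/eqP/subr0_eq ? _].
- move=> x rx; rewrite /V; apply: cvg_lim => //.
  rewrite (_ : (fun n => _) = cst 0); first exact: cvg_cst.
  apply/funext => n; apply: (test_out (tphi n)).
  by rewrite /eball/= => xr; rewrite ltNge rx in xr.
Qed.

Lemma approx_sharp u G phi V (x : 'rV[R]_N) : approx p r u G phi ->
  (forall e : R, 0 < e -> exists n0, forall n x, (n0 <= n)%N -> `|phi n x - V x| <= e) ->
  enorm x < r -> ((pole_constant p r x * `|V x| `^ p)%:E <= gint G)%E.
Proof.
move=> ap unif xr; have [mu_ pu wG gG [tphi c1 cg]] := ap.
have mG := weak_gradient_measurable wG.
(* The power function is used as a continuous function only at positive arguments. *)
have [Vx0|Vx0] := eqVneq (V x) 0.
  by rewrite Vx0 normr0 powR0// mulr0 gint_ge0.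
have cv : pole_constant p r x * `|phi n x| `^ p @[n --> \oo] -->
    pole_constant p r x * `|V x| `^ p.
  apply: cvgMr; apply: (@cvg_comp _ _ _ (fun n => `|phi n x|) (fun s => s `^ p) _ (nbhs `|V x|)).
    apply: cvg_norm; apply/cvgrPdist_le => e e0; have [n0 Hn] := unif _ e0.
    by exists n0 => // n /= nn; rewrite distrC; exact: Hn.
  by apply: powR_continuous; rewrite normr_gt0.
have [g gE] : exists g : R, gint G = g%:E.
  by exists (fine (gint G)); rewrite fineK// ge0_fin_numE// gint_ge0.
have g0 : 0 <= g by rewrite -lee_fin -gE gint_ge0.
rewrite gE lee_fin.
have step (d : R) : 0 < d -> pole_constant p r x * `|V x| `^ p <= (1 + d) * g.
  (* For t = 1 - 1/q the coefficient (1 - t)^(1 - p) = q^(p - 1) is 1 + d. *)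
  move=> d0; pose q := (1 + d) `^ (p - 1)^-1.
  have pm0 : 0 < p - 1 by rewrite subr_gt0.
  have q1 : 1 < q.
    have e1 : 1 = 1 `^ (p - 1)^-1 :> R by rewrite powR1.
    rewrite /q [ltLHS]e1; apply: gt0_ltr_powR; rewrite ?nnegrE ?invr_gt0//.
      by rewrite addr_ge0// ltW.
    by rewrite ltrDl.
  have q0 : 0 < q by exact: lt_trans q1.
  have qV0 : 0 < q^-1 by rewrite invr_gt0.
  have qV1 : q^-1 < 1 by rewrite invf_lt1.
  pose t := 1 - q^-1.
  have t01 : 0 < t < 1 by rewrite /t subr_gt0 qV1 ltrBlDr ltrDl.
  have ct : (1 - t) * (1 - t)^-1 `^ p = 1 + d.
    rewrite /t opprB addrC subrK invrK -(mulr_powRB1 (ltW q0) p0) mulrA mulVf ?gt_eqF// mul1r.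
    by rewrite /q -powRrM mulVf ?gt_eqF// powRr1// addr_ge0// ltW.
  apply/ler_addgt0Pr => e e0; apply: (cvgr_to_le cv).
  have c0 : 0 < t * t^-1 `^ p by case/andP: t01 => t0 _; rewrite mulr_gt0 ?powR_gt0 ?invr_gt0.
  have e10 : 0 < e / (t * t^-1 `^ p) by rewrite divr_gt0.
  move/cvg_ge0_EFin0P : cg => /(_ (fun n => gint_ge0 _ _ _)) /(_ _ e10).
  apply: filterS => n Hn; rewrite -lee_fin.
  apply: le_trans (test_sharp (tphi n) xr) _.
  apply: (le_trans (@gint_le_convex R N p r N2 Np t _ G (fun x => grad (phi n) x - G x) t01 _ _ _ _)) => //.
  - exact: test_grad_measurable.
  - exact: measurable_gradB.
  - by move=> y; rewrite addrC subrK.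
  rewrite ct gE (EFinD ((1 + d) * g) e) (EFinM (1 + d) g) leeD2l//.
  apply: le_trans (lee_wpmul2l _ Hn) _; first by rewrite lee_fin ltW.
  by rewrite -EFinM lee_fin mulrC divfK// gt_eqF.
apply/ler_addgt0Pr => e e0.
(* The energy g may be 0, hence g + 1; the excess d g is still at most e. *)
have d0 : 0 < e / (g + 1) by rewrite divr_gt0// ltr_wpDl.
apply: le_trans (step _ d0) _; rewrite mulrDl mul1r lerD2l.
by rewrite mulrAC ler_pdivrMr ?ltr_wpDl// ler_pM2l// lerDl.
Qed.

End representation.

(** * The function u_p *)

Section extremal_approximation.
Context {R : realType} {N : nat}.
Variables (p r : R).
Hypotheses (N2 : (2 <= N)%N) (Np : N%:R < p) (r0 : 0 < r).
Local Notation mu := (@lebesgue_row R N).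
Local Notation B := (@eball R N r).
Local Notation pint := (pint B p).
Local Notation gint := (gint B p).
Local Notation Lam := (pole_constant p r (0 : 'rV[R]_N)).
Local Notation a := ((p - N%:R) / (p - 1)).
Local Notation c := (a / r `^ a).
Local Notation u := (@radial_extremal R N r p).
Local Notation K := (@extremal_grad R N p r).

Let N1 : 1 < N%:R :> R. Proof. by rewrite ltr1n. Qed.
Let m0 : 0 < p - N%:R. Proof. by rewrite subr_gt0. Qed.
Let p1 : 1 < p. Proof. exact: lt_trans Np. Qed.
Let pm0 : 0 < p - 1. Proof. by rewrite subr_gt0. Qed.
Let p0 : 0 < p. Proof. exact: lt_trans p1. Qed.
Let a0 : 0 < a. Proof. by rewrite divr_gt0. Qed.
Let a1 : a < 1. Proof. by rewrite ltr_pdivrMr// mul1r ltrD2l ltrN2. Qed.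
Let ra0 : 0 < r `^ a. Proof. by rewrite powR_gt0. Qed.
Let c0 : 0 < c. Proof. by rewrite divr_gt0. Qed.
Let oB : open B. Proof. exact: open_eball. Qed.
Let mB : measurable B. Proof. exact: measurable_eball. Qed.

Lemma cvg_powR0 (b : R) (f : nat -> R) : 0 < b -> (forall n, 0 <= f n) ->
  f n @[n --> \oo] --> 0 -> f n `^ b @[n --> \oo] --> 0.
Proof.
move=> b0 f0 /cvgrPdist_le cf; apply/cvgrPdist_le => e e0.
have eb : 0 < e `^ b^-1 by rewrite powR_gt0.
apply: filterS (cf _ eb) => n; rewrite !sub0r !normrN !ger0_norm ?powR_ge0// => fe.
have -> : e = (e `^ b^-1) `^ b by rewrite -powRrM mulVf ?gt_eqF// powRr1// ltW.
by apply: ge0_ler_powR; rewrite ?nnegrE ?f0 ?(ltW b0) ?(ltW eb).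
Qed.

Lemma radial_extremalE (x : 'rV[R]_N) : u x = 1 - enorm x `^ a / r `^ a.
Proof.
rewrite /radial_extremal powRM ?enorm_ge0 ?invr_ge0 ?(ltW r0)//; congr (1 - _ * _).
by rewrite -[r^-1]powR_inv1 ?(ltW r0)// -powRrM mulN1r powRN.
Qed.

Lemma radial_extremal_le1 x : u x <= 1.
Proof. by rewrite radial_extremalE gerBl divr_ge0 ?powR_ge0. Qed.

Lemma radial_extremal_gt0 x : B x -> 0 < u x.
Proof.
move=> xr; rewrite radial_extremalE subr_gt0 ltr_pdivrMr// mul1r.
by apply: gt0_ltr_powR; rewrite ?nnegrE ?enorm_ge0// ltW.
Qed.

Lemma radial_extremal0 : u 0 = 1.
Proof. by rewrite radial_extremalE enorm0 powR0 ?gt_eqF// mul0r subr0. Qed.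

Lemma measurable_radial_extremal : measurable_fun B u.
Proof.
rewrite (_ : u = fun x => 1 - enorm x `^ a / r `^ a); last first.
  by apply/funext => x; exact: radial_extremalE.
apply: measurable_realfun.measurable_funB; first exact: measurable_cst.
apply: measurable_realfun.measurable_funM; last exact: measurable_cst.
by apply: measurable_powR_comp; apply: measurable_funTS; exact: measurable_enorm.
Qed.

Let eps (n : nat) : R := n.+1%:R^-1.
Let eps_gt0 n : 0 < eps n. Proof. by rewrite invr_gt0. Qed.
Let eps_le1 n : eps n <= 1. Proof. by rewrite invf_le1// ler1n. Qed.
Let cvg_eps : eps n @[n --> \oo] --> 0. Proof. exact: cvg_harmonic. Qed.

(** Strictly positive everywhere, so that its real powers are smooth at the origin as well. *)
Definition smoothed_sqnorm (n : nat) (x : 'rV[R]_N) : R :=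
  \sum_k x ord0 k * x ord0 k + n.+1%:R^-1.
Local Notation sq := smoothed_sqnorm.

Lemma smoothed_sqnormE n x : sq n x = enorm x ^+ 2 + eps n.
Proof. by rewrite /sq enorm_sqr; congr (_ + _); apply: eq_bigr => i _; rewrite expr2. Qed.

Lemma smoothed_sqnorm_gt0 n x : 0 < sq n x.
Proof. by rewrite smoothed_sqnormE ltr_wpDl// sqr_ge0. Qed.

Lemma smooth_smoothed_sqnorm n : smooth (sq n).
Proof.
apply: (@smoothD R N (fun x => \sum_k x ord0 k * x ord0 k) (cst (n.+1%:R^-1))).
  by apply: smooth_sum => k; apply: smoothM; exact: smooth_coord.
exact: smooth_cst.
Qed.

Lemma partial_smoothed_sqnorm n i x : partial i (sq n) x = 2 * x ord0 i.
Proof.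
have dk (k : 'I_N) : is_derive x (delta_mx ord0 i : 'rV[R]_N)
    (fun y : 'rV[R]_N => y ord0 k) (i == k)%:R.
  apply: DeriveDef; last exact: partial_coord.
  by apply: diff_derivable; exact: differentiable_coord.
have ds := @is_derive_sum R 'rV[R]_N R N _ x (delta_mx ord0 i) _
  (fun k => is_deriveM (dk k) (dk k)).
have [_ Ds] := is_deriveD ds (is_derive_cst (n.+1%:R^-1 : R) x (delta_mx ord0 i)).
have E : sq n = \sum_(k < N) (fun y : 'rV[R]_N => y ord0 k) * (fun y : 'rV[R]_N => y ord0 k) +
    cst (n.+1%:R^-1).
  apply/funext => y.
  transitivity ((\sum_(k < N) (fun z : 'rV[R]_N => z ord0 k) * (fun z : 'rV[R]_N => z ord0 k)) y +
    n.+1%:R^-1); last by [].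
  by rewrite fct_sumE.
rewrite /partial E Ds addr0 (bigD1 i)//= eqxx big1 ?addr0.
  by rewrite /GRing.scale/= mulr1 mulr_natl mulr2n.
by move=> k ki; rewrite eq_sym (negbTE ki) scaler0 addr0.
Qed.

(* u_p with |x|^2 replaced by |x|^2 + 1/(n+1), shifted down by 1/(n+1) so that its
   positive part is supported in a smaller ball. *)
Definition truncated_profile (n : nat) (x : 'rV[R]_N) : R :=
  1 - n.+1%:R^-1 - (r `^ a)^-1 * sq n x `^ (a / 2).
Local Notation w := truncated_profile.

Lemma smooth_truncated_profile n : smooth (w n).
Proof.
apply: (@smoothB R N (cst (1 - n.+1%:R^-1)) (fun x => (r `^ a)^-1 * sq n x `^ (a / 2))).
  exact: smooth_cst.
apply: smoothZ; apply: smooth_powR; first exact: smooth_smoothed_sqnorm.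
by move=> x; exact: smoothed_sqnorm_gt0.
Qed.

Lemma partial_truncated_profile n i x :
  partial i (w n) x = - (c * sq n x `^ (a / 2 - 1)) * x ord0 i.
Proof.
have ds : differentiable (sq n) x.
  by apply: smooth_differentiable; exact: smooth_smoothed_sqnorm.
have dp := is_derive_powR (a / 2) (smoothed_sqnorm_gt0 n x).
have df := is_deriveB (is_derive_cst (1 - n.+1%:R^-1 : R) (sq n x) (1 : R))
  (is_deriveZ (r `^ a)^-1 dp).
have [_ D] := derive_comp1 (delta_mx ord0 i) ds df.
have E : w n = (cst (1 - n.+1%:R^-1) - (r `^ a)^-1 \*: (fun s => s `^ (a / 2))) \o sq n by [].
rewrite /partial E D.
have -> : 'D_(delta_mx ord0 i) (sq n) x = 2 * x ord0 i by exact: partial_smoothed_sqnorm.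
have key (A S X q : R) : q != 0 -> (0 - q^-1 * (A / 2 * S)) * (2 * X) = - (A / q * S) * X.
  by move=> q0; field.
by apply: key; rewrite gt_eqF.
Qed.

Lemma truncated_profile_le1 n x : w n x <= 1.
Proof.
rewrite /w -addrA gerDl -opprD oppr_le0 addr_ge0 ?(ltW (eps_gt0 n))//.
by rewrite mulr_ge0 ?powR_ge0// invr_ge0 ltW.
Qed.

Lemma cvg_smoothed_sqnorm x : sq n x @[n --> \oo] --> enorm x ^+ 2.
Proof.
rewrite -[X in _ --> X]addr0; under eq_fun do rewrite smoothed_sqnormE.
by apply: cvgD; [exact: cvg_cst|exact: cvg_eps].
Qed.

Lemma cvg_truncated_profile x : w n x @[n --> \oo] --> u x.
Proof.
rewrite radial_extremalE -[X in X - _]subr0; apply: cvgB.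
  by apply: cvgB; [exact: cvg_cst|exact: cvg_eps].
rewrite [X in _ --> X]mulrC; apply: cvgMr.
have -> : enorm x `^ a = (enorm x ^+ 2) `^ (a / 2).
  by rewrite -powR_mulrn ?enorm_ge0// -powRrM; congr powR; field; rewrite gt_eqF.
have cs := @cvg_smoothed_sqnorm x.
have [x0|x0] := eqVneq x 0.
  rewrite x0 enorm0 expr0n/= powR0; last by rewrite gt_eqF// divr_gt0.
  apply: cvg_powR0; first by rewrite divr_gt0.
    by move=> n; rewrite ltW// smoothed_sqnorm_gt0.
  by move: cs; rewrite x0 enorm0 expr0n.
apply: (@cvg_comp _ _ _ (fun n => sq n x) (fun s => s `^ (a / 2)) _ (nbhs (enorm x ^+ 2))) => //.
by apply: powR_continuous; rewrite exprn_gt0// enorm_gt0.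
Qed.

(* [t * exp (- 1 / ((n + 1) t))] is a smooth substitute for the positive part of t whose
   derivative, [damping], takes its values in [0, 1]. *)
Definition extremal_approx (n : nat) : 'rV[R]_N -> R :=
  w n \* (flat 0 \o (fun x => n.+1%:R * w n x)).
Local Notation phi := extremal_approx.

Lemma extremal_approx_out n x : w n x <= 0 -> phi n x = 0.
Proof. by move=> w0; rewrite /phi /= flat_le0 ?mulr0// mulr_ge0_le0. Qed.

Lemma extremal_approx_test n : test_function B (phi n).
Proof.
split.
  apply: smoothM; first exact: smooth_truncated_profile.
  apply: smooth_flat; apply: smoothZ; exact: smooth_truncated_profile.
(* The radius at which |x|^a reaches (1 - 1/(n+1)) r^a: from there on the profile is at most 0. For
   n = 0 it is 0. *)
pose rho := r * (1 - eps n) `^ a^-1.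
have e1 : 0 <= 1 - eps n by rewrite subr_ge0.
exists [set x | enorm x <= rho]; first split.
- exact: compact_cball.
- move=> x /= xr; rewrite /eball/=; apply: le_lt_trans xr _.
  rewrite /rho gtr_pMr//.
  have e2 : 1 = 1 `^ a^-1 :> R by rewrite powR1.
  rewrite [ltRHS]e2; apply: gt0_ltr_powR; rewrite ?nnegrE ?invr_gt0//.
  by rewrite gtrBl.
move=> x /negP; rewrite -ltNge => rx; apply: extremal_approx_out.
rewrite /w subr_le0 mulrC ler_pdivlMr//.
have rho0 : 0 <= rho by rewrite mulr_ge0 ?powR_ge0// ltW.
have -> : (1 - n.+1%:R^-1) * r `^ a = rho `^ a.
  rewrite /rho powRM ?powR_ge0 ?(ltW r0)// -powRrM mulVf ?gt_eqF// powRr1// mulrC//.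
apply: (@le_trans _ _ (enorm x `^ a)).
  by apply: ge0_ler_powR; rewrite ?nnegrE ?enorm_ge0 ?(ltW a0) ?(ltW rx).
have -> : enorm x `^ a = (enorm x ^+ 2) `^ (a / 2).
  by rewrite -powR_mulrn ?enorm_ge0// -powRrM; congr powR; field; rewrite gt_eqF.
apply: ge0_ler_powR; rewrite ?nnegrE ?sqr_ge0 ?(ltW (smoothed_sqnorm_gt0 n x))//.
  by rewrite ltW// divr_gt0.
by rewrite smoothed_sqnormE lerDl ltW.
Qed.

(** The derivative of s |-> s [flat 0 s], because [flat 0] has derivative [flat 2]. As phi n is this
    function at (n+1) w n, divided by n + 1, its gradient is that of w n times the damping
    factor. *)
Definition damping (s : R) : R := s * flat 2 s + flat 0 s.

Lemma dampingE s : 0 < s -> damping s = (1 + s^-1) * expR (- s^-1).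
Proof.
move=> s0; rewrite /damping /flat s0 powR_inv1 ?(ltW s0)// oppr0 powRr0 mul1r.
rewrite powRN powR_mulrn ?(ltW s0)// mulrA (_ : s * (s ^+ 2)^-1 = s^-1); first by ring.
by rewrite expr2 invfM mulrA mulfV ?gt_eqF// mul1r.
Qed.

Lemma damping_ge0 s : 0 <= damping s.
Proof.
have [s0|s0] := leP s 0; first by rewrite /damping !flat_le0// mulr0 addr0.
by rewrite dampingE// mulr_ge0 ?expR_ge0// addr_ge0// invr_ge0 ltW.
Qed.

(** This is 1 + x <= exp x at x = 1 / s. *)
Lemma damping_le1 s : damping s <= 1.
Proof.
have [s0|s0] := leP s 0; first by rewrite /damping !flat_le0// mulr0 addr0.
by rewrite dampingE// expRN ler_pdivrMr ?expR_gt0// mul1r expR_ge1Dx.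
Qed.

Lemma partial_extremal_approx n i x :
  partial i (phi n) x = damping (n.+1%:R * w n x) * partial i (w n) x.
Proof.
have dw y : differentiable (w n) y.
  by apply: smooth_differentiable; exact: smooth_truncated_profile.
have sw : smooth (fun y => n.+1%:R * w n y).
  by apply: smoothZ; exact: smooth_truncated_profile.
have dsw y : differentiable (fun z => n.+1%:R * w n z) y by exact: smooth_differentiable.
have Dsw : 'D_(delta_mx ord0 i) (fun z => n.+1%:R * w n z) x = n.+1%:R * partial i (w n) x.
  by rewrite (_ : (fun z => _) = n.+1%:R \*: w n)// deriveZ//; exact: diff_derivable.
have H y := derive_comp1 (delta_mx ord0 i) (dsw y) (is_derive_flat 0 _).
rewrite /phi partialM//; last by move=> y; have [] := H y.
rewrite /= /partial in Dsw *; have [_ ->] := H x; rewrite Dsw /damping; ring.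
Qed.

Lemma grad_extremal_approx n x :
  grad (phi n) x = - (damping (n.+1%:R * w n x) * (c * sq n x `^ (a / 2 - 1))) *: x.
Proof.
apply/rowP => i; rewrite !mxE partial_extremal_approx partial_truncated_profile.
by rewrite !mulNr mulrN mulrA.
Qed.

Let norm_pow x : enorm (x : 'rV[R]_N) `^ (a - 2) = (enorm x ^+ 2) `^ (a / 2 - 1).
Proof.
rewrite -powR_mulrn ?enorm_ge0// -powRrM; congr powR.
by move: a => b; field.
Qed.

(** The exponent a/2 - 1 is negative, so enlarging |x|^2 only decreases the gradient, and damping
    decreases it further. This provides the majorant for the convergence of the gradients. *)
Lemma enorm_grad_extremal_approx_le n x : enorm (grad (phi n) x) <= enorm (K x).
Proof.
have [->|x0] := eqVneq x 0.
  by rewrite grad_extremal_approx /extremal_grad !scaler0.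
rewrite grad_extremal_approx /extremal_grad !enormZ !normrN ler_wpM2r ?enorm_ge0//.
have s0 := smoothed_sqnorm_gt0 n x.
have h1 : 0 <= c * sq n x `^ (a / 2 - 1) by rewrite (mulr_ge0 (ltW c0)) ?powR_ge0.
have h2 : 0 <= c * enorm x `^ (a - 2) by rewrite (mulr_ge0 (ltW c0)) ?powR_ge0.
rewrite (ger0_norm h2) (ger0_norm (mulr_ge0 (damping_ge0 _) h1)).
apply: (@le_trans _ _ (c * sq n x `^ (a / 2 - 1))).
  by rewrite ler_piMl// damping_le1.
rewrite (ler_wpM2l (ltW c0))// norm_pow.
have -> : a / 2 - 1 = - (1 - a / 2) by rewrite opprB.
have e0 : 0 < enorm x ^+ 2 by rewrite exprn_gt0// enorm_gt0.
rewrite !powRN lef_pV2 ?posrE ?powR_gt0//.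
apply: ge0_ler_powR; rewrite ?nnegrE ?(ltW e0) ?(ltW s0)//.
  by rewrite subr_ge0 ler_pdivrMr//; apply: (le_trans (ltW a1)); rewrite mul1r ler1n.
by rewrite smoothed_sqnormE lerDl ltW.
Qed.

Lemma cvg_scaled_profile x : B x ->
  (n.+1%:R * w n x)^-1 @[n --> \oo] --> 0.
Proof.
move=> Bx; have u0 := radial_extremal_gt0 Bx.
rewrite (_ : (fun n => _) = (fun n => eps n * (w n x)^-1)); last first.
  by apply/funext => n; rewrite invfM.
rewrite -[X in _ --> X](mul0r (u x)^-1); apply: cvgM; first exact: cvg_eps.
by apply: cvgV; [rewrite gt_eqF|exact: cvg_truncated_profile].
Qed.

Lemma near_truncated_profile_gt0 x : B x -> \forall n \near \oo, 0 < n.+1%:R * w n x.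
Proof.
move=> Bx; have u0 := radial_extremal_gt0 Bx.
apply: filterS (cvgr_gt _ (@cvg_truncated_profile x) _ u0) => n wn.
by rewrite mulr_gt0.
Qed.

Lemma cvg_exp_scaled_profile x : B x ->
  expR (- (n.+1%:R * w n x)^-1) @[n --> \oo] --> (1 : R).
Proof.
move=> Bx; rewrite -[X in _ --> X]expR0; apply: continuous_cvg; first exact: continuous_expR.
by rewrite -[X in _ --> X]oppr0; apply: cvgN; exact: cvg_scaled_profile.
Qed.

Lemma cvg_damping x : B x -> damping (n.+1%:R * w n x) @[n --> \oo] --> (1 : R).
Proof.
move=> Bx.
have H : (1 + (n.+1%:R * w n x)^-1) * expR (- (n.+1%:R * w n x)^-1) @[n --> \oo] --> (1 : R).
  rewrite -[X in _ --> X](mul1r (1 : R)); apply: cvgM; last exact: cvg_exp_scaled_profile.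
  rewrite -[X in _ --> X](addr0 (1 : R)); apply: cvgD; first exact: cvg_cst.
  exact: cvg_scaled_profile.
apply: cvg_trans H; apply: near_eq_cvg.
apply: filterS (near_truncated_profile_gt0 Bx) => n s0; by rewrite dampingE.
Qed.

Lemma cvg_extremal_approx x : B x -> phi n x @[n --> \oo] --> u x.
Proof.
move=> Bx; rewrite -[X in _ --> X]mulr1; apply: cvgM; first exact: cvg_truncated_profile.
apply: (@cvg_trans _ (expR (- (n.+1%:R * w n x)^-1) @[n --> \oo])).
  apply: near_eq_cvg; apply: filterS (near_truncated_profile_gt0 Bx) => n s0.
  by rewrite /= /flat s0 oppr0 powRr0 mul1r powR_inv1// ltW.
exact: cvg_exp_scaled_profile.
Qed.

Lemma extremal_approx_bound n x : 0 <= phi n x <= 1.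
Proof.
have [w0|w0] := leP (w n x) 0; first by rewrite extremal_approx_out// lexx ler01.
rewrite /phi /= mulr_ge0 ?flat_ge0 ?(ltW w0)//=.
by rewrite mulr_ile1 ?flat_ge0 ?flat0_le1 ?truncated_profile_le1// ltW.
Qed.

Lemma cvg_grad_extremal_approx x : B x ->
  enorm (grad (phi n) x - K x) @[n --> \oo] --> 0.
Proof.
move=> Bx; have [->|x0] := eqVneq x 0.
  rewrite (_ : (fun n => _) = cst 0); first exact: cvg_cst.
  by apply/funext => n; rewrite grad_extremal_approx /extremal_grad !scaler0 subr0 enorm0.
rewrite (_ : (fun n => _) = fun n => `|c * enorm x `^ (a - 2) -
   damping (n.+1%:R * w n x) * (c * sq n x `^ (a / 2 - 1))| * enorm x); last first.
  apply/funext => n; rewrite grad_extremal_approx /extremal_grad -scalerBl enormZ.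
  by rewrite opprK addrC.
rewrite -[X in _ --> X](mul0r (enorm x)); apply: cvgMl.
rewrite -[X in _ --> X](@normr0 R R); apply: cvg_norm.
rewrite -[X in _ --> X](subrr (c * enorm x `^ (a - 2))); apply: cvgB; first exact: cvg_cst.
rewrite -[X in _ --> X]mul1r; apply: cvgM; first exact: cvg_damping.
apply: cvgMr; rewrite norm_pow.
apply: (@cvg_comp _ _ _ (fun n => sq n x) (fun s => s `^ (a / 2 - 1)) _ (nbhs (enorm x ^+ 2))).
  exact: cvg_smoothed_sqnorm.
by apply: powR_continuous; rewrite exprn_gt0// enorm_gt0.
Qed.

End extremal_approximation.

(** * Membership of u_p in W_0^{1,p} *)

Section extremal_membership.
Context {R : realType} {N : nat}.
Variables (p r : R).
Hypotheses (N2 : (2 <= N)%N) (Np : N%:R < p) (r0 : 0 < r).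
Local Notation mu := (@lebesgue_row R N).
Local Notation B := (@eball R N r).
Local Notation pint := (pint B p).
Local Notation gint := (gint B p).
Local Notation Lam := (pole_constant p r (0 : 'rV[R]_N)).
Local Notation a := ((p - N%:R) / (p - 1)).
Local Notation c := (a / r `^ a).
Local Notation u := (@radial_extremal R N r p).
Local Notation K := (@extremal_grad R N p r).
Local Notation phi := (@extremal_approx R N p r).

Let N1 : 1 < N%:R :> R. Proof. by rewrite ltr1n. Qed.
Let p1 : 1 < p. Proof. exact: lt_trans Np. Qed.
Let p0 : 0 < p. Proof. exact: lt_trans p1. Qed.
Let oB : open B. Proof. exact: open_eball. Qed.
Let mB : measurable B. Proof. exact: measurable_eball. Qed.

Lemma measurable_extremal_grad i : measurable_fun B (fun x => K x ord0 i).
Proof.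
apply: measurable_funTS.
rewrite (_ : (fun x => _) = fun x => - (c * enorm x `^ (a - 2)) * x ord0 i); last first.
  by apply/funext => x; rewrite mxE.
apply: measurable_realfun.measurable_funM; last exact: measurable_row_coord.
apply: measurableT_comp => //; apply: measurable_realfun.measurable_funM.
  exact: measurable_cst.
by apply: measurable_powR_comp; exact: measurable_enorm.
Qed.

Lemma gint_extremal_grad_le : (gint K <= Lam%:E)%E.
Proof. by rewrite gintE; exact: extremal_energy_le. Qed.

Lemma ball_integrable_cst (M : R) : mu.-integrable B (EFin \o cst M).
Proof.
apply: measurable_bounded_integrable => //; first exact: lebesgue_row_eball_lty.
exists `|M|; split; first exact: num_real.
by move=> y My x _; rewrite /= ltW.
Qed.

Lemma radial_extremal_dist_le1 n x : B x -> `|phi n x - u x| <= 1.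
Proof.
move=> Bx; have /andP[h1 h2] := extremal_approx_bound p r0 n x.
have h3 := radial_extremal_gt0 N2 Np r0 Bx; have h4 := radial_extremal_le1 p r0 x.
by rewrite ler_norml; apply/andP; split; lra.
Qed.

Lemma cvg_pint_extremal_approx : pint (phi n \- u) @[n --> \oo] --> 0%E.
Proof.
have mphi n := test_measurable (extremal_approx_test N2 Np r0 n).
have mu_ := @measurable_radial_extremal R N p r r0.
have := @dominated_convergence _ _ R mu B mB (fun n x => (`|(phi n \- u) x| `^ p)%:E)
  (cst 0%E) (EFin \o cst 1).
move=> /(_ _ _ _ (ball_integrable_cst 1) _)[].
- by move=> n; apply: measurable_pint; exact: measurable_realfun.measurable_funB.
- exact: measurable_cst.
- apply: aeW => x Bx; apply: cvg_EFin; first exact: nearW.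
  apply: cvg_powR0 => //.
  rewrite -[X in _ --> X](@normr0 R R); apply: cvg_norm.
  rewrite -[X in _ --> X](subrr (u x)); apply: cvgB; last exact: cvg_cst.
  exact: cvg_extremal_approx.
- apply: aeW => x n Bx; rewrite /= lee_fin ger0_norm ?powR_ge0//.
  have e1 : 1 = 1 `^ p :> R by rewrite powR1.
  rewrite [leRHS]e1; apply: ge0_ler_powR; rewrite ?nnegrE ?(ltW p0)//.
  exact: radial_extremal_dist_le1.
move=> _ _; rewrite integral0; apply: cvg_trans; apply: near_eq_cvg; apply: nearW => n.
by rewrite pintE.
Qed.

Lemma integrable_extremal_grad : mu.-integrable B (fun x => (enorm (K x) `^ p)%:E).
Proof.
apply/integrableP; split; first by apply: measurable_gint => //; exact: measurable_extremal_grad.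
have /le_lt_trans := extremal_energy_le N2 Np r0.
move=> /(_ +oo%E (ltry _)); apply: le_lt_trans.
rewrite le_eqVlt; apply/orP; left; apply/eqP; apply: eq_integral => x _.
by rewrite gee0_abs// lee_fin powR_ge0.
Qed.

Lemma cvg_gint_extremal_approx :
  gint (fun x => grad (phi n) x - K x) @[n --> \oo] --> 0%E.
Proof.
have tphi n := extremal_approx_test N2 Np r0 n.
have mK := measurable_extremal_grad.
(* The distance of the two gradients is at most 2 |K|; the majorant is integrable by the energy
   bound for u_p. *)
have iK : mu.-integrable B (fun x => (2 `^ p)%:E * (enorm (K x) `^ p)%:E)%E.
  by apply: integrableZl => //; exact: integrable_extremal_grad.
have := @dominated_convergence _ _ R mu B mB (fun n x => (enorm (grad (phi n) x - K x) `^ p)%:E)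
  (cst 0%E) _.
move=> /(_ _ _ _ _ iK _)[].
- move=> n; apply: measurable_gint => // i; exact: measurable_gradB.
- exact: measurable_cst.
- apply: aeW => x Bx; apply: cvg_EFin; first exact: nearW.
  apply: cvg_powR0 => //; first by move=> n; exact: enorm_ge0.
  exact: cvg_grad_extremal_approx.
- apply: aeW => x n Bx; rewrite -EFinM /= lee_fin ger0_norm ?powR_ge0//.
  rewrite -powRM ?enorm_ge0//; apply: ge0_ler_powR; rewrite ?nnegrE ?(ltW p0) ?enorm_ge0//.
    by rewrite mulr_ge0 ?enorm_ge0.
  apply: le_trans (enormD _ _) _; rewrite enormN mulr_natl mulr2n lerD2r.
  exact: enorm_grad_extremal_approx_le.
move=> _ _; rewrite integral0; apply: cvg_trans; apply: near_eq_cvg; apply: nearW => n.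
by rewrite gintE.
Qed.

Lemma pint_radial_extremal : (pint u < +oo)%E.
Proof.
apply: (@le_lt_trans _ _ (\int[mu]_(x in B) (cst 1%:E x))%E).
  rewrite pintE; apply: ge0_le_integral => //.
  - by apply: measurable_pint; exact: measurable_radial_extremal.
  move=> x Bx; have e1 : 1 = 1 `^ p :> R by rewrite powR1.
  rewrite lee_fin [leRHS]e1; apply: ge0_ler_powR; rewrite ?nnegrE ?(ltW p0)//.
  by rewrite ger0_norm ?radial_extremal_le1// ltW// radial_extremal_gt0.
by rewrite integral_cst// mul1e; exact: lebesgue_row_eball_lty.
Qed.

(** Integration by parts holds for the test functions phi n and passes to the limit, with majorants
    |D_i psi| and |K| |psi|; nothing has to be integrated by parts across the singularity at the
    origin. *)
Lemma radial_extremal_weak_gradient : is_weak_gradient B u K.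
Proof.
move=> i; have mK := measurable_extremal_grad.
have tphi n := extremal_approx_test N2 Np r0 n.
have mphi n := test_measurable (tphi n).
have mu_ := @measurable_radial_extremal R N p r r0.
have mG : measurable_fun B (enorm \o K) by exact: measurable_enorm_comp.
have lu : Defs.locally_integrable B u.
  by apply: (pint_locally_integrable N2 Np) => //; exact: pint_radial_extremal.
have lG : Defs.locally_integrable B (enorm \o K).
  apply: (pint_locally_integrable N2 Np) => //.
  by rewrite -gint_pint; apply: le_lt_trans gint_extremal_grad_le (ltry _).
have lKi : Defs.locally_integrable B (fun x => K x ord0 i).
  split; first exact: mK.
  move=> C cC CB; have mC := compact_row_measurable cC.
  apply: le_integrable (lG.2 C cC CB) => //.
    by apply/measurable_EFinP; exact: measurable_funS CB (mK i).
  by move=> x _; rewrite /= lee_fin [leRHS]ger0_norm ?enorm_ge0// coord_le_enorm.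
split=> // psi tpsi; have tpi := test_partial i tpsi.
have lt (f : 'rV[R]_N -> R) : test_function B f -> Defs.locally_integrable B f.
  by move=> tf; exact: test_locally_integrable.
have lone : Defs.locally_integrable B (cst 1 : 'rV[R]_N -> R).
  by apply: continuous_locally_integrable => x; exact: cst_continuous.
have c1 : (\int[mu]_(x in B) (phi n x * partial i psi x)%:E @[n --> \oo] -->
    \int[mu]_(x in B) (u x * partial i psi x)%:E)%E.
  have := @dominated_convergence _ _ R mu B mB (fun n x => (phi n x * partial i psi x)%:E)
    (fun x => (u x * partial i psi x)%:E) (fun x => `|(1 * partial i psi x)%:E|)%E.
  case; last by [].
  - move=> n; apply/measurable_EFinP; apply: measurable_realfun.measurable_funM => //.
    exact: test_measurable.
  - apply/measurable_EFinP; apply: measurable_realfun.measurable_funM => //.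
    exact: test_measurable.
  - apply: aeW => x Bx; apply: cvg_EFin; first exact: nearW.
    by apply: cvgMl; exact: cvg_extremal_approx.
  - by apply: integrable_abse; exact: (locally_integrableMtest oB lone).
  - apply: aeW => x n Bx; rewrite /= lee_fin mul1r (normrM (phi n x)) ler_piMl//.
    have /andP[h1 h2] := extremal_approx_bound p r0 n x.
    by rewrite ger0_norm.
have c2 : (\int[mu]_(x in B) (grad (phi n) x ord0 i * psi x)%:E @[n --> \oo] -->
    \int[mu]_(x in B) (K x ord0 i * psi x)%:E)%E.
  have := @dominated_convergence _ _ R mu B mB (fun n x => (grad (phi n) x ord0 i * psi x)%:E)
    (fun x => (K x ord0 i * psi x)%:E) (fun x => `|((enorm \o K) x * psi x)%:E|)%E.
  case; last by [].
  - move=> n; apply/measurable_EFinP; apply: measurable_realfun.measurable_funM.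
      exact: test_grad_measurable.
    exact: test_measurable.
  - apply/measurable_EFinP; apply: measurable_realfun.measurable_funM => //.
    exact: test_measurable.
  - apply: aeW => x Bx; apply: cvg_EFin; first exact: nearW.
    apply: cvgMl; apply/cvgrPdist_le => e e0.
    have /cvgrPdist_le/(_ e e0) := cvg_grad_extremal_approx N2 Np r0 Bx.
    apply: filterS => n; rewrite sub0r normrN ger0_norm ?enorm_ge0//; apply: le_trans.
    rewrite distrC; apply: le_trans (coord_le_enorm _ i).
    by rewrite !mxE.
  - by apply: integrable_abse; exact: (locally_integrableMtest oB lG).
  - apply: aeW => x n Bx; rewrite /= lee_fin !normrM ler_wpM2r// [leRHS]ger0_norm ?enorm_ge0//.
    by apply: le_trans (coord_le_enorm _ i) _; exact: enorm_grad_extremal_approx_le.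
apply/eqP; rewrite -eqe EFinN !RintegralE_loc//; apply/eqP.
have E : (fun n => \int[mu]_(x in B) (phi n x * partial i psi x)%:E)%E =
    (fun n => - \int[mu]_(x in B) (grad (phi n) x ord0 i * psi x)%:E)%E.
  apply/funext => n; have [lg hg] := test_weak_gradient oB (tphi n) i.
  by rewrite -!RintegralE_loc ?hg ?EFinN//; exact: lt.
rewrite E in c1; apply: (cvg_unique _ c1); first exact: ereal_hausdorff.
exact: cvgeN.
Qed.

Lemma radial_extremal_approx : approx p r u K phi.
Proof.
split; [exact: measurable_radial_extremal|exact: pint_radial_extremal|
  exact: radial_extremal_weak_gradient|
  exact: le_lt_trans gint_extremal_grad_le (ltry _)|split].
- exact: extremal_approx_test.
- exact: cvg_pint_extremal_approx.
- exact: cvg_gint_extremal_approx.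
Qed.

End extremal_membership.

(** * The value of Lambda_p and the extremality of u_p *)

Section extremality.
Context {R : realType} {N : nat}.
Variables (p r : R).
Hypotheses (N2 : (2 <= N)%N) (Np : N%:R < p) (r0 : 0 < r).
Local Notation mu := (@lebesgue_row R N).
Local Notation B := (@eball R N r).
Local Notation gint := (gint B p).
Local Notation Lam := (pole_constant p r (0 : 'rV[R]_N)).
Local Notation a := ((p - N%:R) / (p - 1)).
Local Notation u := (@radial_extremal R N r p).
Local Notation K := (@extremal_grad R N p r).
Local Notation phi := (@extremal_approx R N p r).

Let N1 : 1 < N%:R :> R. Proof. by rewrite ltr1n. Qed.
Let p1 : 1 < p. Proof. exact: lt_trans Np. Qed.
Let p0 : 0 < p. Proof. exact: lt_trans p1. Qed.
Let a0 : 0 < a. Proof. by rewrite divr_gt0// subr_gt0. Qed.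
Let oB : open B. Proof. exact: open_eball. Qed.
Let mB : measurable B. Proof. exact: measurable_eball. Qed.
Let B0 : B 0. Proof. by rewrite /eball/= enorm0. Qed.
Let L0 : 0 < Lam. Proof. exact: Lam_gt0. Qed.

(** Form of the sharp inequality at the pole 0 that refers only to the values of the approximating
    test functions there, hence not to the pointwise value of a function defined up to a null
    set. *)
Lemma approx_center v G psi (l : R) : approx p r v G psi ->
  psi n 0 @[n --> \oo] --> l -> ((Lam * `|l| `^ p)%:E <= gint G)%E.
Proof.
move=> ap cl; have [V [unif _ _ _]] := approx_uniform_limit N2 Np r0 ap.
have -> : l = V 0.
  apply: (cvg_unique _ cl) => //; apply/cvgrPdist_le => e e0; have [n0 Hn] := unif _ e0.
  by exists n0 => // n /= nn; rewrite distrC; exact: Hn.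
by apply: approx_sharp ap unif _ => //; rewrite enorm0.
Qed.

(** The lower bound is the sharp inequality at the pole 0, where the approximations tend to u_p(0) =
    1. *)
Lemma gint_extremal_grad : gint K = Lam%:E.
Proof.
apply/eqP; rewrite eq_le gint_extremal_grad_le//=.
have := approx_center (radial_extremal_approx N2 Np r0) (cvg_extremal_approx N2 Np r0 B0).
by rewrite radial_extremal0// normr1 powR1 mulr1.
Qed.

Lemma approx_bound v G psi : approx p r v G psi ->
  {ae mu, forall x, B x -> ((Lam * `|v x| `^ p)%:E <= gint G)%E}.
Proof.
move=> ap; have [V [unif _ vV _]] := approx_uniform_limit N2 Np r0 ap.
apply: filterS vV => x vV Bx; rewrite vV//.
apply: le_trans (approx_sharp N2 Np r0 ap unif Bx).
by rewrite lee_fin ler_wpM2r ?powR_ge0// pole_constant_le.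
Qed.

Let m := fine (mu B).
Let m_gt0 : 0 < m.
Proof. by rewrite fine_gt0// lebesgue_row_eball_gt0//= lebesgue_row_eball_lty. Qed.
Let mE : mu B = m%:E.
Proof. by rewrite fineK// ge0_fin_numE// lebesgue_row_eball_lty. Qed.

(** If g is the energy of v, then |v|^p <= g / Lam almost everywhere, so 1 <= (g / Lam)^(q/p) m; it
    remains to take the power p/q. *)
Lemma lambda_ge (q : R) : 0 < q -> ((Lam * m `^ (- p / q))%:E <= lambda_ B p q)%E.
Proof.
move=> q0; apply: le_ereal_inf_tmp => _ [v [Wv nv] <-].
have [G [psi ap]] := (in_W01pP r N2 Np v).1 Wv.
rewrite (approx_grad_norm N2 Np ap).
have [mv pv _ gG _] := ap.
have [g gE] : exists g : R, gint G = g%:E.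
  by exists (fine (gint G)); rewrite fineK// ge0_fin_numE// gint_ge0.
have g0 : 0 <= g by rewrite -lee_fin -gE gint_ge0.
rewrite gE lee_fin.
have : (\int[mu]_(x in B) (`|v x| `^ q)%:E = 1)%E.
  by rewrite -poweR_Lnorm_on ?gt_eqF// nv poweR_EFin powR1.
have ae := approx_bound ap; rewrite gE in ae.
have gL0 : 0 <= g / Lam by rewrite divr_ge0// ltW.
have le1 : (\int[mu]_(x in B) (`|v x| `^ q)%:E <=
    \int[mu]_(x in B) (cst ((g / Lam) `^ (q / p))%:E x))%E.
  apply: ae_ge0_le_integral => //.
  - by apply: measurable_pint.
  - by move=> x _; rewrite lee_fin powR_ge0.
  apply: filterS ae => x /[apply]; rewrite !lee_fin => vx.
  have -> : `|v x| `^ q = (`|v x| `^ p) `^ (q / p).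
    by rewrite -powRrM; congr powR; field; rewrite gt_eqF.
  apply: ge0_ler_powR; rewrite ?nnegrE ?gL0 ?powR_ge0 ?(divr_ge0 (ltW q0) (ltW p0))//.
  by rewrite ler_pdivlMr// mulrC.
move=> E; rewrite E integral_cst// [X in (_ * X)%E](mE) -EFinM lee_fin in le1.
have e1 : 1 = 1 `^ (p / q) :> R by rewrite powR1.
have h : 1 <= g / Lam * m `^ (p / q).
  rewrite [leLHS]e1; apply: (@le_trans _ _ (((g / Lam) `^ (q / p) * m) `^ (p / q))).
    apply: ge0_ler_powR; rewrite ?nnegrE ?(divr_ge0 (ltW p0) (ltW q0))//.
    by rewrite mulr_ge0 ?powR_ge0 ?(ltW m_gt0).
  rewrite powRM ?powR_ge0 ?(ltW m_gt0)// -powRrM.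
  rewrite (_ : q / p * (p / q) = 1) ?powRr1//.
  by field; rewrite !gt_eqF.
rewrite mulNr powRN ler_pdivrMr ?powR_gt0// -[leLHS]mulr1.
by rewrite -ler_pdivlMl// mulrA [_^-1 * _]mulrC.
Qed.

(** The competitor is u_p divided by its L^q norm, which is bounded below because u_p >= 1 - d on a
    ball of volume b that does not depend on q. *)
Lemma lambda_le (d : R) : 0 < d < 1 -> exists2 b : R, 0 < b &
  forall q : R, 0 < q ->
    (lambda_ B p q <= (Lam * (b `^ (- p / q) * (1 - d) `^ (- p)))%:E)%E.
Proof.
move=> /andP[d0 d1]; have d1' : 0 < 1 - d by rewrite subr_gt0.
(* On the ball of this radius (|x| / r)^a is less than d. *)
pose rho := r * d `^ a^-1.
have rho0 : 0 < rho by rewrite mulr_gt0// powR_gt0.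
have rhor : rho <= r.
  rewrite /rho ger_pMr//; have e1 : 1 = 1 `^ a^-1 :> R by rewrite powR1.
  by rewrite [leRHS]e1; apply: ge0_ler_powR; rewrite ?nnegrE ?invr_ge0 ?(ltW a0) ?(ltW d0) ?(ltW d1).
have rhoB : eball rho `<=` B by move=> x /= xr; exact: lt_le_trans rhor.
pose b := fine (mu (eball rho)).
have b0 : 0 < b.
  by rewrite fine_gt0// lebesgue_row_eball_gt0//= lebesgue_row_eball_lty.
have bE : mu (eball rho) = b%:E by rewrite fineK// ge0_fin_numE// lebesgue_row_eball_lty.
exists b => // q q0; have qn0 : q != 0 by rewrite gt_eqF.
have mu_ := @measurable_radial_extremal R N p r r0.
have mp := measurable_pint q mu_.
have ap := radial_extremal_approx N2 Np r0.
have u_ge x : eball rho x -> 1 - d <= u x.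
  move=> xr; rewrite radial_extremalE// lerD2l lerN2 ler_pdivrMr ?powR_gt0//.
  have -> : d * r `^ a = rho `^ a.
    by rewrite /rho powRM ?powR_ge0 ?(ltW r0)// -powRrM mulVf ?gt_eqF// powRr1 ?(ltW d0)// mulrC.
  by apply: ge0_ler_powR; rewrite ?nnegrE ?enorm_ge0 ?(ltW a0) ?(ltW rho0) ?(ltW xr).
have lo : ((b * (1 - d) `^ q)%:E <= pint B q u)%E.
  rewrite pintE; apply: (@le_trans _ _ (\int[mu]_(x in eball rho) (`|u x| `^ q)%:E)%E).
    have -> : ((b * (1 - d) `^ q)%:E = \int[mu]_(x in eball rho) (cst ((1 - d) `^ q)%:E x))%E.
      rewrite integral_cst; last exact: measurable_eball.
      by rewrite mulrC EFinM; congr (_ * _)%E.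
    apply: ge0_le_integral => //.
    - exact: measurable_eball.
    - by move=> x _; rewrite lee_fin powR_ge0.
    - exact: measurable_funS rhoB mp.
    move=> x xr; rewrite lee_fin; apply: ge0_ler_powR; rewrite ?nnegrE ?(ltW q0) ?(ltW d1')//.
    by apply: le_trans (u_ge _ xr) _; exact: ler_norm.
  by apply: ge0_subset_integral => //; exact: measurable_eball.
have hi : (pint B q u <= m%:E)%E.
  rewrite pintE; apply: (@le_trans _ _ (\int[mu]_(x in B) (cst 1%:E x))%E).
    apply: ge0_le_integral => // x Bx.
    have e1 : 1 = 1 `^ q :> R by rewrite powR1.
    rewrite lee_fin [leRHS]e1; apply: ge0_ler_powR; rewrite ?nnegrE ?(ltW q0)//.
    by rewrite ger0_norm ?radial_extremal_le1// ltW// radial_extremal_gt0.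
  by rewrite integral_cst// mul1e [leLHS]mE.
have [s sE] : exists s : R, pint B q u = s%:E.
  exists (fine (pint B q u)); rewrite fineK// ge0_fin_numE ?pint_ge0//.
  exact: le_lt_trans hi (ltry _).
rewrite sE lee_fin in lo.
have bd0 : 0 < b * (1 - d) `^ q by rewrite mulr_gt0// powR_gt0.
have s0 : 0 < s by exact: lt_le_trans lo.
(* The inverse of the L^q norm of u_p, s being its q-th power. *)
pose c := s `^ (- q^-1).
have c0 : 0 < c by rewrite powR_gt0.
have apc := approxZ N2 Np c ap.
have H : (lambda_ B p q <= grad_norm B p (fun x => (c * u x)%R) `^ p)%E.
  apply: ereal_inf_lbound; exists (fun x => c * u x) => //; split.
    by apply/(in_W01pP r N2 Np); exists (fun x => c *: K x), (fun n x => c * phi n x).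
  rewrite Lnorm_on_poweR// (_ : integral _ _ _ = 1%E) ?poweR_EFin ?powR1//.
  rewrite -pintE pintZ// sE -EFinM; congr EFin.
  rewrite gtr0_norm// /c -powRrM mulNr mulVf// powR_inv1 ?(ltW s0)// mulVf// gt_eqF//.
apply: le_trans H _.
rewrite (approx_grad_norm N2 Np apc) gintZ//; last exact: measurable_extremal_grad.
rewrite gint_extremal_grad -EFinM lee_fin mulrC ler_wpM2l ?(ltW L0)//.
rewrite gtr0_norm// /c -powRrM.
have -> : (1 - d) `^ (- p) = ((1 - d) `^ q) `^ (- p / q).
  by rewrite -powRrM; congr powR; field.
rewrite -powRM ?powR_ge0 ?(ltW b0)//.
have -> : - q^-1 * p = - (p / q) by rewrite mulNr mulrC.
rewrite mulNr !powRN lef_pV2 ?posrE ?powR_gt0//.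
by apply: ge0_ler_powR; rewrite ?nnegrE ?divr_ge0 ?(ltW p0) ?(ltW q0) ?(ltW bd0) ?(ltW s0).
Qed.

Lemma cvg_powR_div_pinfty (b s : R) : 0 < b -> b `^ (s / q) @[q --> +oo] --> (1 : R).
Proof.
move=> b0.
have -> : (fun q => b `^ (s / q)) = (fun q => expR (s * ln b * q^-1)).
  by apply/funext => q; rewrite /powR gt_eqF//; congr expR; ring.
rewrite -[X in _ --> X]expR0; apply: continuous_cvg; first exact: continuous_expR.
rewrite -[X in _ --> X](mulr0 (s * ln b)); apply: cvgMr.
apply/gtr0_cvgV0; last exact: cvg_id.
by near=> t; near: t; exact: nbhs_pinfty_gt.
Unshelve. all: by end_near. Qed.

(** A squeeze: fixed powers b^(s / q) tend to 1 as q grows, and the remaining factor (1 - d)^(-p)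
    can be taken as close to 1 as desired. *)
Lemma Lambda_ball : Lambda_ B p = Lam%:E.
Proof.
rewrite /Lambda_; apply: cvg_lim; first exact: ereal_hausdorff.
apply: cvg_EFinP => e e0.
have lo : \forall q \near +oo, Lam - e <= Lam * m `^ (- p / q).
  have cv : Lam * m `^ (- p / q) @[q --> +oo] --> Lam * 1.
    by apply: cvgMr; exact: cvg_powR_div_pinfty.
  have h : Lam - e < Lam * 1 by rewrite mulr1 ltrBlDr ltrDl.
  by apply: filterS (cvgr_gt _ cv _ h) => q /ltW.
pose eta := e / Lam / 2.
have eta0 : 0 < eta by rewrite !divr_gt0.
(* So that (1 - d)^(-p) = 1 + eta, with Lam eta = e / 2. *)
pose d := 1 - (1 + eta) `^ (- p^-1).
have e10 : 0 < 1 + eta by rewrite addr_gt0.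
have d01 : 0 < d < 1.
  rewrite /d subr_gt0 gtrBl powR_gt0// andbT powRN invf_lt1 ?powR_gt0//.
  have e1 : 1 = 1 `^ p^-1 :> R by rewrite powR1.
  rewrite [ltLHS]e1; apply: gt0_ltr_powR; rewrite ?nnegrE ?invr_gt0 ?(ltW e10)//.
  by rewrite ltrDl.
have [b b0 Hb] := lambda_le d01.
have dp : (1 - d) `^ (- p) = 1 + eta.
  by rewrite /d subKr -powRrM mulrNN mulVf ?gt_eqF// powRr1// ltW.
have hi : \forall q \near +oo, Lam * (b `^ (- p / q) * (1 - d) `^ (- p)) <= Lam + e.
  have cv : Lam * (b `^ (- p / q) * (1 - d) `^ (- p)) @[q --> +oo] -->
      Lam * (1 * (1 - d) `^ (- p)).
    by apply: cvgMr; apply: cvgMl; exact: cvg_powR_div_pinfty.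
  have h : Lam * (1 * (1 - d) `^ (- p)) < Lam + e.
    rewrite mul1r dp mulrDr mulr1 ltrD2l /eta.
    have -> : Lam * (e / Lam / 2) = e / 2 by field; rewrite gt_eqF.
    by rewrite ltr_pdivrMr// ltr_pMr// ltr1n.
  by apply: filterS (cvgr_lt _ cv _ h) => q /ltW.
have q_gt0 : \forall q \near +oo, 0 < q :> R by exact: nbhs_pinfty_gt.
apply: filterS3 q_gt0 lo hi => q q0 h1 h2; apply/andP; split.
  by apply: le_trans (lambda_ge q0); rewrite lee_fin.
by apply: le_trans (Hb q q0) _; rewrite lee_fin.
Qed.

(** The essential supremum is that of the extension by 0 to the whole space; since M >= 0 the points
    outside the ball impose nothing. *)
Lemma Lnorm_on_oo_le v (M : R) : 0 <= M ->
  (Lnorm_on B +oo%E v <= M%:E)%E <-> {ae mu, forall x, B x -> `|v x| <= M}.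
Proof.
(* On a null space the norm of exponent +oo is 0 by convention; this excludes that case. *)
move=> M0; have T0 : (0 < mu [set: 'rV[R]_N])%E.
  by apply: (@lebesgue_row_open_gt0 _ _ _ 0) => //; exact: openT.
rewrite /Lnorm_on unlock T0; split.
  move=> /ess_supP; apply: filterS => x + Bx.
  by rewrite /= patchE mem_set//= lee_fin.
move=> H; apply/ess_supP; apply: filterS H => x Hx.
rewrite /= patchE; case: ifPn; first by rewrite inE => /Hx; rewrite lee_fin.
by rewrite abse0 lee_fin.
Qed.

Lemma ae_open_exists (P : 'rV[R]_N -> Prop) (U : set 'rV[R]_N) y :
  {ae mu, forall x, P x} -> open U -> U y -> exists2 x, U x & P x.
Proof.
move=> [Z [mZ Z0 PZ]] oU Uy; apply: contrapT => H.
have UZ : U `<=` Z.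
  by move=> x Ux; apply: PZ => Px; apply: H; exists x.
have := lebesgue_row_open_gt0 oU Uy; rewrite lt0e => /andP[/eqP + _]; apply.
by apply: subset_measure0 Z0 => //; exact: open_row_measurable.
Qed.

Lemma radial_extremal_sup_norm : Lnorm_on B +oo%E u = 1%E.
Proof.
apply/eqP; rewrite eq_le; apply/andP; split.
  apply/Lnorm_on_oo_le => //; apply: aeW => x Bx.
  by rewrite ger0_norm ?radial_extremal_le1// ltW// radial_extremal_gt0.
rewrite leNgt; apply/negP => lt1.
have ge0 : (0 <= Lnorm_on B +oo%E u)%E by exact: Lnorm_ge0.
have [M [ME M0 M1]] : exists M : R, [/\ Lnorm_on B +oo%E u = M%:E, 0 <= M & M < 1].
  move: ge0 lt1; case: (Lnorm_on _ _ _) => [M||]//; rewrite lee_fin lte_fin.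
  by move=> *; exists M.
have := (Lnorm_on_oo_le u M0).1; rewrite ME => /(_ (lexx _)) ae.
(* Near the centre u_p >= 1 - d > M on a ball of positive measure, against the essential bound M. *)
pose d := (1 - M) / 2.
have d0 : 0 < d by rewrite divr_gt0// subr_gt0.
pose rho := r * d `^ a^-1.
have rho0 : 0 < rho by rewrite mulr_gt0// powR_gt0.
have rr : eball rho (0 : 'rV[R]_N) by rewrite /eball/= enorm0.
have [x [xr xB] Hx] := ae_open_exists ae (openI (@open_eball R N rho) oB) (conj rr B0).
have := Hx xB; apply/negP; rewrite -ltNge; apply: lt_le_trans (ler_norm _).
have h : enorm x `^ a / r `^ a <= d.
  rewrite ler_pdivrMr ?powR_gt0//.
  have -> : d * r `^ a = rho `^ a.
    by rewrite /rho powRM ?powR_ge0 ?(ltW r0)// -powRrM mulVf ?gt_eqF// powRr1 ?(ltW d0)// mulrC.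
  by apply: ge0_ler_powR; rewrite ?nnegrE ?enorm_ge0 ?(ltW a0) ?(ltW rho0) ?(ltW xr).
rewrite radial_extremalE//; apply: lt_le_trans (lerB (lexx 1) h).
by rewrite /d; lra.
Qed.

Lemma radial_extremal_is_extremal : is_extremal B p u.
Proof.
have ap := radial_extremal_approx N2 Np r0; split.
- by apply/(in_W01pP r N2 Np); exists K, phi.
- by rewrite (approx_grad_norm N2 Np ap) gint_extremal_grad Lambda_ball.
- exact: radial_extremal_sup_norm.
Qed.

End extremality.

(** * Uniqueness *)

Lemma ge0_integralD_le d (T : measurableType d) (R : realType)
    (mu : {measure set T -> \bar R}) (D : set T) (c : R) (f g h k : T -> R) :
  measurable D -> 0 <= c ->
  measurable_fun D f -> measurable_fun D g -> measurable_fun D h -> measurable_fun D k ->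
  (forall x, 0 <= f x) -> (forall x, 0 <= g x) -> (forall x, 0 <= h x) -> (forall x, 0 <= k x) ->
  (forall x, f x + g x <= c * h x + c * k x) ->
  (\int[mu]_(x in D) (f x)%:E + \int[mu]_(x in D) (g x)%:E <=
   c%:E * \int[mu]_(x in D) (h x)%:E + c%:E * \int[mu]_(x in D) (k x)%:E)%E.
Proof.
move=> mD c0 mf mg mh mk f0 g0 h0 k0 fgh.
have mf' : measurable_fun D (EFin \o f) by apply/measurable_EFinP.
have mg' : measurable_fun D (EFin \o g) by apply/measurable_EFinP.
have mh' : measurable_fun D (EFin \o h) by apply/measurable_EFinP.
have mk' : measurable_fun D (EFin \o k) by apply/measurable_EFinP.
rewrite -(ge0_integralD _ mD _ mf' _ mg'); try by move=> x _; rewrite lee_fin.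
rewrite -(ge0_integralZl mu mD mh'); try by move=> *; rewrite ?lee_fin.
rewrite -(ge0_integralZl mu mD mk'); try by move=> *; rewrite ?lee_fin.
rewrite -ge0_integralD//; first last.
- exact: measurable_funeM.
- by move=> x _; rewrite mule_ge0 ?lee_fin.
- exact: measurable_funeM.
- by move=> x _; rewrite mule_ge0 ?lee_fin.
apply: ge0_le_integral => //.
- by move=> x _; rewrite -EFinD lee_fin addr_ge0.
- exact: emeasurable_funD.
- by apply: emeasurable_funD; exact: measurable_funeM.
by move=> x _; rewrite -!EFinM -!EFinD lee_fin.
Qed.

Section uniqueness.
Context {R : realType} {N : nat}.
Variables (p r : R).
Hypotheses (N2 : (2 <= N)%N) (Np : N%:R < p) (r0 : 0 < r).
Local Notation mu := (@lebesgue_row R N).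
Local Notation B := (@eball R N r).
Local Notation gint := (gint B p).
Local Notation Lam := (pole_constant p r (0 : 'rV[R]_N)).
Local Notation u := (@radial_extremal R N r p).
Local Notation K := (@extremal_grad R N p r).
Local Notation phi := (@extremal_approx R N p r).

Let N1 : 1 < N%:R :> R. Proof. by rewrite ltr1n. Qed.
Let p2 : 2 < p. Proof. by apply: le_lt_trans Np; rewrite ler_nat. Qed.
Let p1 : 1 < p. Proof. exact: lt_trans Np. Qed.
Let p0 : 0 < p. Proof. exact: lt_trans p1. Qed.
Let oB : open B. Proof. exact: open_eball. Qed.
Let mB : measurable B. Proof. exact: measurable_eball. Qed.
Let B0 : B 0. Proof. by rewrite /eball/= enorm0. Qed.
Let L0 : 0 < Lam. Proof. exact: Lam_gt0. Qed.

Lemma gint_clarkson (G H : 'rV[R]_N -> 'rV[R]_N) :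
  (forall i, measurable_fun B (fun x => G x ord0 i)) ->
  (forall i, measurable_fun B (fun x => H x ord0 i)) ->
  (gint (fun x => 2^-1 *: (G x + H x))%R + gint (fun x => 2^-1 *: (G x - H x))%R <=
   2^-1%:E * gint G + 2^-1%:E * gint H)%E.
Proof.
move=> mG mH.
have h0 : 0 <= 2^-1 :> R by rewrite invr_ge0.
have mS (s : R) i : measurable_fun B (fun x => (2^-1 *: (G x + s *: H x)) ord0 i).
  rewrite (_ : (fun x => _) = fun x => 2^-1 * (G x ord0 i + s * H x ord0 i)); last first.
    by apply/funext => x; rewrite !mxE.
  apply: measurable_realfun.measurable_funM => //; apply: measurable_realfun.measurable_funD => //.
  exact: measurable_realfun.measurable_funM.
have mSp i : measurable_fun B (fun x => (2^-1 *: (G x + H x)) ord0 i).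
  by have := mS 1 i; congr measurable_fun; apply/funext => x; rewrite scale1r.
have mSm i : measurable_fun B (fun x => (2^-1 *: (G x - H x)) ord0 i).
  by have := mS (-1) i; congr measurable_fun; apply/funext => x; rewrite scaleN1r.
rewrite !gintE; apply: ge0_integralD_le => //.
- by apply/measurable_EFinP; exact: (measurable_gint p mSp).
- by apply/measurable_EFinP; exact: (measurable_gint p mSm).
- by apply/measurable_EFinP; exact: (measurable_gint p mG).
- by apply/measurable_EFinP; exact: (measurable_gint p mH).
- by move=> x; exact: powR_ge0.
- by move=> x; exact: powR_ge0.
- by move=> x; exact: powR_ge0.
- by move=> x; exact: powR_ge0.
by move=> x; exact: enorm_clarkson.
Qed.

(** At a maximum point x0 of |V| on the closed ball, |V x0| >= 1 by the sup norm, and the sharp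
    inequality there, with energy C(0), gives C(x0) <= C(0). Hence x0 = 0 and |V 0| = 1; positivity
    of v selects the sign. *)
Lemma extremal_center v G psi V : approx p r v G psi -> gint G = Lam%:E ->
  Lnorm_on B +oo%E v = 1%E -> positive_on B v ->
  (forall e : R, 0 < e -> exists n0, forall n x, (n0 <= n)%N -> `|psi n x - V x| <= e) ->
  continuous V -> {ae mu, forall x, B x -> v x = V x} ->
  (forall x, r <= enorm x -> V x = 0) -> V 0 = 1.
Proof.
move=> ap gG nv pv unif cV vV V0.
have cnV : continuous (fun x => `|V x|).
  by move=> x; apply: continuous_comp; [exact: cV|exact: norm_continuous].
have [x0 _ Mx0] : exists2 x0 : 'rV[R]_N, x0 \in [set x : 'rV[R]_N | enorm x <= r] &
    forall t : 'rV[R]_N, t \in [set x : 'rV[R]_N | enorm x <= r] -> `|V t| <= `|V x0|.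
  apply: EVT_max_rV.
  - by exists 0; rewrite /= enorm0 ltW.
  - exact: compact_cball.
  - exact: continuous_subspaceT.
have V1 : 1 <= `|V x0|.
  rewrite -lee_fin -nv; apply/Lnorm_on_oo_le => //.
  apply: filterS vV => x vV Bx; rewrite vV//; apply: Mx0.
  by rewrite inE/= ltW.
have x0r : enorm x0 < r.
  rewrite ltNge; apply/negP => /V0 x00; move: V1.
  by rewrite x00 normr0 ler10.
have sh := approx_sharp N2 Np r0 ap unif x0r.
rewrite gG lee_fin in sh.
have x00 : x0 = 0.
  apply/eqP; apply: contraT => x0n.
  have := pole_constant_lt N2 Np r0 x0r x0n; rewrite ltNge => /negP; case.
  apply: le_trans sh; rewrite ler_peMr//; first by rewrite ltW// pole_constant_gt0.
  have e1 : 1 = 1 `^ p :> R by rewrite powR1.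
  by rewrite [leLHS]e1; apply: ge0_ler_powR; rewrite ?nnegrE// ltW.
rewrite x00 in V1 sh.
have V0le1 : `|V 0| <= 1.
  rewrite leNgt; apply/negP => V01; move: sh; apply/negP; rewrite -ltNge.
  rewrite ltr_pMr//; have e1 : 1 = 1 `^ p :> R by rewrite powR1.
  by rewrite [ltLHS]e1; apply: gt0_ltr_powR; rewrite ?nnegrE.
have V0E : `|V 0| = 1 by apply/eqP; rewrite eq_le V0le1.
(* V agrees with v only almost everywhere; if V 0 were negative, V would be negative on an open set,
   which contains a point where V = v > 0. *)
have V0ge0 : 0 <= V 0.
  rewrite leNgt; apply/negP => V0lt.
  have oU : open (V @^-1` [set t | t < 0] `&` B).
    by apply: openI => //; move/continuousP: cV; apply; exact: open_lt.
  have [x [Vx Bx] vx] := ae_open_exists vV oU (conj V0lt B0).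
  by have := pv x Bx; rewrite vx// ltNge (ltW Vx).
by rewrite -V0E ger0_norm.
Qed.

Lemma extremal_unique v : is_extremal B p v -> positive_on B v ->
  {ae mu, forall x, B x -> v x = u x}.
Proof.
move=> [Wv gv nv] pv.
have [G [psi ap]] := (in_W01pP r N2 Np v).1 Wv.
have gG : gint G = Lam%:E by rewrite -(approx_grad_norm N2 Np ap) gv Lambda_ball.
have [V [unif cV vV V0]] := approx_uniform_limit N2 Np r0 ap.
have V1 := extremal_center ap gG nv pv unif cV vV V0.
have psi0 : psi n 0 @[n --> \oo] --> (1 : R).
  rewrite -V1; apply/cvgrPdist_le => e e0; have [n0 Hn] := unif _ e0.
  by exists n0 => // n /= nn; rewrite distrC; exact: Hn.
have apu := radial_extremal_approx N2 Np r0.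
have phi0 : phi n 0 @[n --> \oo] --> (1 : R).
  by have := cvg_extremal_approx N2 Np r0 B0; rewrite radial_extremal0.
have aps := approxZ N2 Np 2^-1 (approxD N2 Np ap apu).
have apd := approxZ N2 Np 2^-1 (approxD N2 Np ap (approxZ N2 Np (-1) apu)).
have lo := approx_center N2 Np r0 aps (l := 1).
have {}lo : (Lam%:E <= gint (fun x => 2^-1 *: (G x + K x))%R)%E.
  move: lo; rewrite normr1 powR1 mulr1; apply.
  rewrite [X in _ --> X](_ : 1 = 2^-1 * (1 + 1) :> R); last by field.
  by apply: cvgMr; exact: cvgD.
have mG : forall i, measurable_fun B (fun x => G x ord0 i).
  by have [_ _ wG _ _] := ap; exact: weak_gradient_measurable wG.
have mK := @measurable_extremal_grad R N p r.
have cl := gint_clarkson mG mK.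
rewrite gG gint_extremal_grad// -EFinM -EFinD in cl.
have gd : gint (fun x => 2^-1 *: (G x - K x)) = 0%E.
  apply/eqP; rewrite eq_le gint_ge0 andbT.
  have {}cl := le_trans (leeD2r _ lo) cl.
  have : (Lam%:E + gint (fun x => 2^-1 *: (G x - K x))%R <= Lam%:E + 0)%E.
    apply: le_trans cl _; rewrite adde0 lee_fin le_eqVlt; apply/orP; left; apply/eqP.
    by field.
  by rewrite leeD2lE.
(* The sup bound for the half difference, of energy 0, gives the equality directly, without
   integrating the equality of gradients. *)
have := approx_bound N2 Np r0 apd.
rewrite (_ : gint _ = 0%E); last first.
  by rewrite -[RHS]gd; apply: eq_gint => x _; rewrite scaleN1r.
apply: filterS => x /[apply]; rewrite lee_fin pmulr_rle0// => vx.
have : `|2^-1 * (v x + -1 * u x)| `^ p == 0 by rewrite eq_le vx powR_ge0.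
rewrite powR_eq0 normr_eq0 mulf_eq0 invr_eq0 pnatr_eq0/= mulN1r subr_eq0.
by move=> /andP[/eqP].
Qed.

End uniqueness.

(** Uniqueness is up to a null set because extremals are Borel representatives, whereas positivity
    is read at every point of the given representative. *)
Theorem theorem2p11 (R : realType) (N : nat) (p r : R)
    (hN : (2 <= N)%N) (hp : N%:R < p) (hr : 0 < r) :
  let B : set 'rV[R]_N := eball r in
  let u_p : 'rV[R]_N -> R := radial_extremal r p in
  (is_extremal B p u_p /\ positive_on B u_p) /\
  (forall v : 'rV[R]_N -> R, is_extremal B p v -> positive_on B v ->
    {ae lebesgue_row N, forall x, B x -> v x = u_p x}).
Proof.
split; first split.
- exact: radial_extremal_is_extremal.
- by move=> x; exact: radial_extremal_gt0.
- by move=> v; exact: extremal_unique.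
Qed.
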